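(* Let $\alpha\in(0,\frac{\pi}{2}]$ and $\lambda>0$. For $m\in X_0$ and any family $\{m_\eta\}_{\eta\downarrow0}\subset X^\alpha$ with $m_\eta\rightharpoonup m$ weakly in $\dot H^1(\Omega)$ as $\eta\downarrow0$, the following lower bound holds: $$\liminf_{\eta\downarrow0}E_\eta(m_\eta)\ge E_0(m).$$
   Context: $\Omega=\mathbb{R}\times(-1,1)$, with points $x=(x_1,x_3)$ and $\nabla=(\partial_{x_1},\partial_{x_3})$. For $m=(m_1,m_2,m_3)$ on $\Omega$ write $m'=(m_1,m_3)$. $\dot H^1(\Omega,\mathbb{S}^2)$ is the set of weakly differentiable $m:\Omega\to\mathbb{S}^2$ with $\int_\Omega|\nabla m|^2dx<\infty$. Weak convergence $m_\eta\rightharpoonup m$ in $\dot H^1(\Omega)$ of $\mathbb{S}^2$-valued maps means $\nabla m_\eta\rightharpoonup\nabla m$ weakly in $L^2(\Omega)$ and $m_\eta\to m$ in $L^2_{\rm loc}(\Omega)$. Convention: $f(\pm\infty,\cdot)=a_\pm$ means $\int_{\Omega\cap\{x_1\ge0\}}|f-a_+|^2dx+\int_{\Omega\cap\{x_1\le0\}}|f-a_-|^2dx<\infty$. For an angle $\theta\in[0,\pi]$ put $m_\theta^\pm=(\cos\theta,\pm\sin\theta,0)$ and $X^\theta=\{m\in\dot H^1(\Omega,\mathbb{S}^2): m(\pm\infty,\cdot)=m_\theta^\pm\}$. Stray field: for $m\in X^\alpha$, $h(m)\in L^2(\mathbb{R}^2,\mathbb{R}^2)$ is the unique $L^2$ field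 with $\nabla\cdot(h(m)+m'\mathbf 1_\Omega)=0$ and $\nabla\times h(m)=0$ in $\mathcal D'(\mathbb{R}^2)$. For $\eta\in(0,1)$ and $m\in X^\alpha$, $$E_\eta(m)=\int_\Omega|\nabla m|^2dx+\lambda\ln\tfrac1\eta\int_{\mathbb{R}^2}|h(m)|^2dx+\eta\int_\Omega (m_1-\cos\alpha)^2+m_3^2\,dx .$$ If $m\in\dot H^1(\Omega,\mathbb{S}^2)$ satisfies $\nabla\cdot m'=0$ in $\Omega$ and $m_3=0$ on $\partial\Omega$, there is a unique constant angle $\theta_m\in[0,\pi]$ with $\frac12\int_{-1}^1m_1(x_1,x_3)\,dx_3=\cos\theta_m$ for all $x_1\in\mathbb{R}$. Define $$X_0=\{m\in\dot H^1(\Omega,\mathbb{S}^2):\nabla\cdot m'=0\text{ in }\Omega,\ m_3=0\text{ on }\partial\Omega,\ m(\pm\infty,\cdot)=m^\pm_{\theta_m}\},$$ and for $m\in X_0$, $$E_0(m)=\int_\Omega|\nabla m|^2dx+2\pi\lambda(\cos\theta_m-\cos\alpha)^2 .$$ *)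

(* Defs.v *)
From HB Require Import structures.
From mathcomp Require Import all_boot all_order all_algebra.
From mathcomp Require Import all_classical all_reals all_analysis.
Set Implicit Arguments.
Unset Strict Implicit.
Unset Printing Implicit Defensive.
Import Order.TTheory GRing.Theory Num.Theory numFieldNormedType.Exports.
Local Open Scope classical_set_scope.
Local Open Scope ring_scope.

(* A point is x = (x_1, x_3).  The indices 0, 1 : 'I_2 stand for the directions
   x_1, x_3, and 0, 1, 2 : 'I_3 for the components m_1, m_2, m_3.  Functions on
   Omega or on the plane are total functions on R * R standing for their
   almost-everywhere classes: changing a representative on a null set, or off
   Omega for a function on Omega, affects none of the notions below. *)
Definition mu2 (R : realType) := (@lebesgue_measure R \x @lebesgue_measure R)%E.

Definition Omega (R : realType) : set (R * R) := [set x | -1 < x.2 < 1].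

Definition unit_vec (R : realType) (j : 'I_2) : R * R :=
  if j == 0 then (1, 0) else (0, 1).

Definition partial (R : realType) (j : 'I_2) (f : R * R -> R) : R * R -> R :=
  fun x => 'D_(unit_vec R j) f x.

Definition iter_partial (R : realType) (s : seq 'I_2) (f : R * R -> R) :
  R * R -> R := foldr (@partial R) f s.

Definition smooth (R : realType) (f : R * R -> R) : Prop :=
  forall s : seq 'I_2, continuous (iter_partial s f) /\
    forall (j : 'I_2) (x : R * R), derivable (iter_partial s f) x (unit_vec R j).

Definition test_fun (R : realType) (U : set (R * R)) (phi : R * R -> R) : Prop :=
  let supp := closure [set x | phi x != 0] in
  [/\ smooth phi, compact supp & supp `<=` U].

Definition L1loc (R : realType) (U : set (R * R)) (f : R * R -> R) : Prop :=
  measurable_fun U f /\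
  forall K : set (R * R), compact K -> K `<=` U ->
    (\int[@mu2 R]_(x in K) `|f x|%:E < +oo)%E.

Definition L2 (R : realType) (U : set (R * R)) (f : R * R -> R) : Prop :=
  measurable_fun U f /\ (\int[@mu2 R]_(x in U) (f x ^+ 2)%:E < +oo)%E.

Definition is_weak_partial (R : realType) (U : set (R * R)) (j : 'I_2)
    (f g : R * R -> R) : Prop :=
  [/\ L1loc U f, L1loc U g &
    forall phi, test_fun U phi ->
      \int[@mu2 R]_(x in U) (f x * partial j phi x) =
      - \int[@mu2 R]_(x in U) (g x * phi x)].

(* The weak partial derivative on Omega, chosen among its a.e. equal
   representatives (and 0 when there is none). *)
Definition weak_partial (R : realType) (j : 'I_2) (f : R * R -> R) :
  R * R -> R := xget (fun=> 0) [set g | is_weak_partial (@Omega R) j f g].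

Definition sq_grad (R : realType) (m : 'I_3 -> R * R -> R) (x : R * R) : R :=
  \sum_(i < 3) \sum_(j < 2) weak_partial j (m i) x ^+ 2.

Definition dirichlet (R : realType) (m : 'I_3 -> R * R -> R) : \bar R :=
  (\int[@mu2 R]_(x in @Omega R) (sq_grad m x)%:E)%E.

Definition H1dot_S2 (R : realType) (m : 'I_3 -> R * R -> R) : Prop :=
  [/\ forall i j, exists g, is_weak_partial (@Omega R) j (m i) g,
      {ae @mu2 R, forall x, @Omega R x -> \sum_(i < 3) m i x ^+ 2 = 1} &
      (dirichlet m < +oo)%E].

Definition weak_cvg_H1dot (R : realType) (m_ : R -> 'I_3 -> R * R -> R)
    (m : 'I_3 -> R * R -> R) : Prop :=
  (forall (i : 'I_3) (j : 'I_2) (g : R * R -> R), L2 (@Omega R) g ->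
     \int[@mu2 R]_(x in @Omega R) (weak_partial j (m_ eta i) x * g x)
       @[eta --> 0^'+] -->
     \int[@mu2 R]_(x in @Omega R) (weak_partial j (m i) x * g x)) /\
  (forall K : set (R * R), compact K -> K `<=` @Omega R ->
     (\int[@mu2 R]_(x in K) (\sum_(i < 3) (m_ eta i x - m i x) ^+ 2)%:E)%E
       @[eta --> 0^'+] --> 0%E).

(* f(+-oo, .) = a_+- *)
Definition limits_at_infty (R : realType) (f : 'I_3 -> R * R -> R)
    (a_plus a_minus : 'I_3 -> R) : Prop :=
  (\int[@mu2 R]_(x in @Omega R `&` [set x | (0 <= x.1)%R])
      (\sum_(i < 3) (f i x - a_plus i) ^+ 2)%:E +
   \int[@mu2 R]_(x in @Omega R `&` [set x | (x.1 <= 0)%R])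
      (\sum_(i < 3) (f i x - a_minus i) ^+ 2)%:E < +oo)%E.

Definition m_plus (R : realType) (theta : R) : 'I_3 -> R :=
  fun i => [:: cos theta; sin theta; 0]`_i.

Definition m_minus (R : realType) (theta : R) : 'I_3 -> R :=
  fun i => [:: cos theta; - sin theta; 0]`_i.

Definition X (R : realType) (theta : R) (m : 'I_3 -> R * R -> R) : Prop :=
  H1dot_S2 m /\ limits_at_infty m (m_plus theta) (m_minus theta).

Definition prime_part (R : realType) (m : 'I_3 -> R * R -> R) :
  'I_2 -> R * R -> R := fun j => if j == 0 then m 0 else m 2.

(* div v = 0 and curl v = 0 in D'(U) *)
Definition div_free (R : realType) (U : set (R * R)) (v : 'I_2 -> R * R -> R) :
    Prop :=
  forall phi, test_fun U phi ->
    \int[@mu2 R]_(x in U) (v 0 x * partial 0 phi x + v 1 x * partial 1 phi x) = 0.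

Definition curl_free (R : realType) (U : set (R * R)) (v : 'I_2 -> R * R -> R) :
    Prop :=
  forall phi, test_fun U phi ->
    \int[@mu2 R]_(x in U) (v 0 x * partial 1 phi x - v 1 x * partial 0 phi x) = 0.

Definition is_stray_field (R : realType) (m : 'I_3 -> R * R -> R)
    (h : 'I_2 -> R * R -> R) : Prop :=
  [/\ forall j, L2 setT (h j),
      div_free setT (fun j x => h j x + (prime_part m j \_ (@Omega R)) x) &
      curl_free setT h].

(* The stray field h(m), chosen among its a.e. equal representatives. *)
Definition stray_field (R : realType) (m : 'I_3 -> R * R -> R) :
  'I_2 -> R * R -> R := xget (fun _ _ => 0) [set h | is_stray_field m h].

Definition E_eta (R : realType) (alpha lambda eta : R)
    (m : 'I_3 -> R * R -> R) : \bar R :=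
  (dirichlet m
   + (lambda * ln (1 / eta))%:E
     * \int[@mu2 R]_x (\sum_(j < 2) stray_field m j x ^+ 2)%:E
   + eta%:E
     * \int[@mu2 R]_(x in @Omega R) ((m 0%R x - cos alpha) ^+ 2 + m 2%R x ^+ 2)%:E)%E.

(* g is the trace on the boundary {x_3 = 1} \cup {x_3 = -1} of Omega of the
   locally H^1 function f: the restriction map of smooth functions, extended by
   continuity from H^1 of bounded pieces of the strip to L^2 of the matching
   pieces of the boundary. *)
Definition is_trace (R : realType) (f g : R * R -> R) : Prop :=
  (forall s : bool, measurable_fun setT (fun t : R => g (t, (-1) ^+ s))) /\
  exists phi : nat -> R * R -> R,
    (forall n, smooth (phi n)) /\
    forall L : R, 0 < L ->
      let B := @Omega R `&` [set x | `|x.1| < L] in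
      [/\ (\int[@mu2 R]_(x in B) ((phi n x - f x) ^+ 2)%:E)%E
            @[n --> \oo] --> 0%E,
          forall j, (\int[@mu2 R]_(x in B)
              ((partial j (phi n) x - weak_partial j f x) ^+ 2)%:E)%E
            @[n --> \oo] --> 0%E &
          forall s : bool, (\int[@lebesgue_measure R]_(t in [set t | (`|t| < L)%R])
              ((phi n (t, (-1) ^+ s) - g (t, (-1) ^+ s)) ^+ 2)%:E)%E
            @[n --> \oo] --> 0%E].

(* The mean of m_1 over vertical slices is defined up to a null set of x_1
   (its continuous representative then takes the value for all x_1). *)
Definition is_mean_angle (R : realType) (m : 'I_3 -> R * R -> R) (theta : R) :
    Prop :=
  0 <= theta <= pi /\
  {ae @lebesgue_measure R, forall x1 : R,
     1 / 2 * \int[@lebesgue_measure R]_(x3 in `]-1, 1[) m 0 (x1, x3) = cos theta}.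

(* theta_m *)
Definition mean_angle (R : realType) (m : 'I_3 -> R * R -> R) : R :=
  xget 0 [set theta | is_mean_angle m theta].

Definition X0 (R : realType) (m : 'I_3 -> R * R -> R) : Prop :=
  [/\ H1dot_S2 m,
      div_free (@Omega R) (prime_part m),
      is_trace (m 2) (fun=> 0) &
      limits_at_infty m (m_plus (mean_angle m)) (m_minus (mean_angle m))].

Definition E_0 (R : realType) (alpha lambda : R) (m : 'I_3 -> R * R -> R) :
    \bar R :=
  (dirichlet m + (2 * pi * lambda * (cos (mean_angle m) - cos alpha) ^+ 2)%:E)%E.

(* Main.v *)
Require Import Defs.
From HB Require Import structures.
From mathcomp Require Import all_boot all_order all_algebra.
From mathcomp Require Import all_classical all_reals all_analysis.
From mathcomp Require Import measurable_realfun ring lra.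

(** Why the lower bound holds. Let h be the stray field of m in X^alpha, and let
    phi be a test function that does not depend on x_3 in the strip. As
    integrals over the strip of d_1 phi vanish, testing the equation of h with phi
    gives
      int h . grad phi = - int_Omega (m_1 - cos alpha) d_1 phi,
    and the square of h + c grad phi being nonnegative,
      int |h|^2 >= 2 c int_Omega (m_1 - cos alpha) d_1 phi - c^2 int |grad phi|^2
    (stray_lower_bound). Take for phi the angle between (x_1, |x_3|) and the
    vertical, smoothed at the scale of the strip and cut off at distance L / eta.
    Its gradient decays like the inverse of the distance to the origin, so its
    energy is 2 pi ln (1 / eta) to leading order (profile_energy).

    In the strip, d_1 phi is the sum of a kernel in x_1 of integral pi, cut off, and
    of a part of order eta / L living where |x_1| is of order L / eta. By Young's
    inequality the second part is absorbed by the anisotropy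
    eta int (m_1 - cos alpha)^2, up to an error of order 1 / L (transition_lower).
    In the first part one can pass to the limit, because m_1 is bounded and the
    kernel is integrable; as the mean of m_1 over almost every vertical segment is
    cos theta_m, the limit is 2 pi d where d = cos theta_m - cos alpha
    (cvg_transition_term). With c = d / ln (1 / eta)
    the stray field energy multiplied by lambda ln (1 / eta) is thus at least
    4 pi lambda d^2 - 2 pi lambda d^2, up to small errors, while the Dirichlet
    energy is weakly lower semicontinuous (gradient_product_tangent,
    cvg_gradient_product).

    Two objects enter the statement through a choice among the solutions of
    a problem, and have to be shown to exist. The stray field is obtained by
    projecting onto the curl-free fields (projection, stray_fieldP). The mean angle
    exists because the flux of the divergence-free field m' through vertical
    segments is constant, its normal component having zero trace on the boundary
    (X0_flux, X0_is_mean_angle). *)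

Set Implicit Arguments.
Unset Strict Implicit.
Unset Printing Implicit Defensive.
Import Order.TTheory GRing.Theory Num.Theory numFieldNormedType.Exports.
Local Open Scope classical_set_scope.
Local Open Scope ring_scope.

(** * Square-integrable functions *)

Section square_integrable.
Context d (T : measurableType d) (R : realType).
Context (mu : {measure set T -> \bar R}).
Implicit Types (D : set T) (f g : T -> R).

(** Square integrability over any measure space: it is needed on the plane, on the
    line, and for the Hilbert space arguments on vector fields. *)
Definition sqint D f :=
  measurable_fun D f /\ (\int[mu]_(x in D) (f x ^+ 2)%:E < +oo)%E.

Lemma sqint_integrable_sqr D f : sqint D f ->
  mu.-integrable D (fun x => (f x ^+ 2)%:E).
Proof.
move=> [mf fi]; apply/integrableP; split.
  by apply/measurable_EFinP; exact: measurable_funX.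
under eq_integral do rewrite gee0_abs ?lee_fin ?sqr_ge0//.
exact: fi.
Qed.

Lemma integrable_sqr_sqint D f : measurable_fun D f ->
  mu.-integrable D (fun x => (f x ^+ 2)%:E) -> sqint D f.
Proof.
move=> mf /integrableP[_ fi]; split => //.
move: fi; under eq_integral do rewrite gee0_abs ?lee_fin ?sqr_ge0//.
by [].
Qed.

Lemma sqint_int_sqr D f : sqint D f ->
  (\int[mu]_(x in D) (f x ^+ 2)%:E)%E = (\int[mu]_(x in D) (f x ^+ 2))%:E.
Proof.
move=> [mf fi]; rewrite /Rintegral fineK// ge0_fin_numE// integral_ge0// => x _.
by rewrite lee_fin sqr_ge0.
Qed.

Lemma sqint_integrable_mul D f g : measurable D -> sqint D f -> sqint D g ->
  mu.-integrable D (fun x => (f x * g x)%:E).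
Proof.
move=> mD sf sg.
have : mu.-integrable D ((fun x => (f x ^+ 2)%:E) \+ (fun x => (g x ^+ 2)%:E))%E.
  by apply: integrableD => //; exact: sqint_integrable_sqr.
apply: le_integrable => //.
  by apply/measurable_EFinP; apply: measurable_funM; [exact: sf.1|exact: sg.1].
move=> x Dx /=; rewrite lee_fin ler_norml (ger0_norm (addr_ge0 _ _)) ?sqr_ge0//.
apply/andP; split; nra.
Qed.

Lemma le_sqint D f g : measurable D -> measurable_fun D f ->
  (forall x, D x -> `|f x| <= `|g x|) -> sqint D g -> sqint D f.
Proof.
move=> mD mf fg [mg gi]; split => //; apply: le_lt_trans gi.
apply: ge0_le_integral => //.
- by move=> x _; rewrite lee_fin sqr_ge0.
- by apply/measurable_EFinP; exact: measurable_funX.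
- by apply/measurable_EFinP; exact: measurable_funX.
- move=> x Dx; rewrite lee_fin -(real_normK (num_real (f x))).
  by rewrite -(real_normK (num_real (g x))) lerXn2r ?nnegrE// fg.
Qed.

Lemma sqintZ D (k : R) f : measurable D -> sqint D f -> sqint D (fun x => k * f x).
Proof.
move=> mD sf; apply: integrable_sqr_sqint.
  by apply: measurable_funM => //; exact: sf.1.
have := integrableZl mD (k ^+ 2) (sqint_integrable_sqr sf).
by apply: eq_integrable => // x _; rewrite -EFinM exprMn.
Qed.

Lemma sqintD D f g : measurable D -> sqint D f -> sqint D g ->
  sqint D (fun x => f x + g x).
Proof.
move=> mD sf sg; apply: integrable_sqr_sqint.
  by apply: measurable_funD => //; [exact: sf.1|exact: sg.1].
have : mu.-integrable D (fun x => (2 * (f x ^+ 2) + 2 * (g x ^+ 2))%:E).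
  have := integrableD mD (integrableZl mD 2 (sqint_integrable_sqr sf))
    (integrableZl mD 2 (sqint_integrable_sqr sg)).
  by apply: eq_integrable => // x _; rewrite /= -!EFinM -EFinD.
apply: le_integrable => //.
  apply/measurable_EFinP; apply: measurable_funX.
  by apply: measurable_funD => //; [exact: sf.1|exact: sg.1].
move=> x Dx /=; rewrite lee_fin ger0_norm ?sqr_ge0//.
by apply: le_trans (ler_norm _); have := sqr_ge0 (f x - g x); nra.
Qed.

Lemma sqintB D f g : measurable D -> sqint D f -> sqint D g ->
  sqint D (fun x => f x - g x).
Proof.
move=> mD sf sg; have := sqintD mD sf (sqintZ (-1) mD sg).
by under eq_fun do rewrite mulN1r.
Qed.

Lemma sqintS D E f : measurable D -> measurable E -> E `<=` D ->
  sqint D f -> sqint E f.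
Proof.
move=> mD mE ED sf; apply: integrable_sqr_sqint.
  exact: measurable_funS sf.1.
exact: integrableS (sqint_integrable_sqr sf).
Qed.

Lemma bounded_sqint D f (M : R) : measurable D -> (mu D < +oo)%E ->
  measurable_fun D f -> (forall x, D x -> `|f x| <= M) -> sqint D f.
Proof.
move=> mD Doo mf fM; apply: (@le_sqint _ _ (cst `|M|)) => //.
  by move=> x Dx; rewrite /= normr_id (le_trans (fM _ Dx))// ler_norm.
split; first exact: measurable_cst.
rewrite (eq_integral (cst (`|M| ^+ 2)%:E))// integral_cst// lte_mul_pinfty// ?lee_fin ?sqr_ge0//.
Qed.

Lemma bounded_integrable D f (M : R) : measurable D -> (mu D < +oo)%E ->
  measurable_fun D f -> (forall x, D x -> `|f x| <= M) ->
  mu.-integrable D (fun x => (f x)%:E).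
Proof.
move=> mD Doo mf fM; apply: measurable_bounded_integrable => //.
exists M; split; first exact: num_real.
move=> z Mz x Dx /=; apply: le_trans (fM _ Dx) _; exact: ltW.
Qed.

(** The discriminant of the nonnegative quadratic t |-> ||f + t g||^2. *)
Lemma cauchy_schwarz_integral D f g : measurable D -> sqint D f -> sqint D g ->
  (\int[mu]_(x in D) (f x * g x)) ^+ 2 <=
  (\int[mu]_(x in D) (f x ^+ 2)) * (\int[mu]_(x in D) (g x ^+ 2)).
Proof.
move=> mD sf sg.
set A := \int[mu]_(x in D) (f x ^+ 2); set B := \int[mu]_(x in D) (f x * g x).
set C := \int[mu]_(x in D) (g x ^+ 2).
have quad (s t : R) : 0 <= s ^+ 2 * A + 2 * s * t * B + t ^+ 2 * C.
  have -> : s ^+ 2 * A + 2 * s * t * B + t ^+ 2 * C =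
      \int[mu]_(x in D) ((s * f x + t * g x) ^+ 2).
    rewrite -!RintegralZl//; [|exact: sqint_integrable_sqr|
      exact: sqint_integrable_mul|exact: sqint_integrable_sqr].
    have i1 : mu.-integrable D (fun x => (s ^+ 2 * f x ^+ 2)%:E).
      by under eq_fun do rewrite EFinM; apply: integrableZl => //; exact: sqint_integrable_sqr.
    have i2 : mu.-integrable D (fun x => (2 * s * t * (f x * g x))%:E).
      by under eq_fun do rewrite EFinM; apply: integrableZl => //; exact: sqint_integrable_mul.
    have i3 : mu.-integrable D (fun x => (t ^+ 2 * g x ^+ 2)%:E).
      by under eq_fun do rewrite EFinM; apply: integrableZl => //; exact: sqint_integrable_sqr.
    rewrite -RintegralD// -RintegralD//; last exact: (integrableD mD i1 i2).
    by apply: eq_Rintegral => x _; ring.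
  by apply: Rintegral_ge0 => x _; rewrite sqr_ge0.
have A0 : 0 <= A by apply: Rintegral_ge0 => x _; rewrite sqr_ge0.
have C0 : 0 <= C by apply: Rintegral_ge0 => x _; rewrite sqr_ge0.
have [A00|/eqP An0] := eqVneq A 0.
  have [->|B0] := eqVneq B 0; first by rewrite expr0n mulr_ge0.
  have := quad (- (C + 1) / (2 * B)) 1; rewrite A00 mulr0 expr1n mul1r.
  have -> : 2 * (- (C + 1) / (2 * B)) * 1 * B = - (C + 1) by field.
  lra.
have Agt0 : 0 < A by rewrite lt_def A0 andbT; apply/eqP.
have := quad (- B) A.
have -> : (- B) ^+ 2 * A + 2 * - B * A * B + A ^+ 2 * C = A * (A * C - B ^+ 2).
  by ring.
by rewrite pmulr_rge0// subr_ge0.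
Qed.

End square_integrable.

(** * Smooth functions of one and two variables *)

Section smooth_functions.
Variable R : realType.
Implicit Types (f g : R -> R) (F : R * R -> R) (k : nat) (t : R).

Lemma is_derive_slice1 F (a b l : R) :
  is_derive (a, b) (unit_vec R 0) F l <-> is_derive a 1 (fun s => F (s, b)) l.
Proof.
have e : (fun h : R => h^-1 *: ((F \o shift (a, b)) (h *: unit_vec R 0) - F (a, b)))
    = (fun h : R => h^-1 *: (((fun s => F (s, b)) \o shift a) (h *: 1) - F (a, b))).
  apply/funext => h; rewrite /unit_vec/=; congr (_ *: (F _ - _)).
  by congr (_, _); rewrite /= /GRing.scale/= mulr0 add0r.
by split => -[d v]; split; move: d v; rewrite /derivable /derive e.
Qed.

Lemma is_derive_slice2 F (a b l : R) :
  is_derive (a, b) (unit_vec R 1) F l <-> is_derive b 1 (fun t => F (a, t)) l.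
Proof.
have e : (fun h : R => h^-1 *: ((F \o shift (a, b)) (h *: unit_vec R 1) - F (a, b)))
    = (fun h : R => h^-1 *: (((fun t => F (a, t)) \o shift b) (h *: 1) - F (a, b))).
  apply/funext => h; rewrite /unit_vec/=; congr (_ *: (F _ - _)).
  by congr (_, _); rewrite /= /GRing.scale/= mulr0 add0r.
by split => -[d v]; split; move: d v; rewrite /derivable /derive e.
Qed.

(** The functions e^(-1/t) t^(-k), extended by 0 to t <= 0. Their derivatives are
    combinations of functions of the same family, also at 0, which is how
    e^(-1/t) is seen to be smooth. *)
Definition flat_exp (k : nat) (t : R) : R :=
  if 0 < t then expR (- t^-1) * t^-1 ^+ k else 0.

Lemma flat_expE k t : 0 < t -> flat_exp k t = expR (- t^-1) * t^-1 ^+ k.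
Proof. by rewrite /flat_exp => ->. Qed.

Lemma flat_exp0 k t : t <= 0 -> flat_exp k t = 0.
Proof. by rewrite /flat_exp ltNge => ->. Qed.

Lemma flat_exp_ge0 k t : 0 <= flat_exp k t.
Proof.
rewrite /flat_exp; case: ifP => // t0.
by rewrite mulr_ge0 ?expR_ge0// exprn_ge0// invr_ge0 ltW.
Qed.

Lemma flat_exp_le k t : flat_exp k t <= k`!%:R.
Proof.
rewrite /flat_exp; case: ifP => // t0.
case: k => [|k].
  by rewrite expr0 mulr1 -expR0 ler_expR oppr_le0 invr_ge0 ltW.
have u0 : 0 <= t^-1 by rewrite invr_ge0 ltW.
have := expR_ge1Dxn k u0 => h.
rewrite expRN mulrC ler_pdivrMr ?expR_gt0//.
rewrite -ler_pdivrMl ?ltr0n ?fact_gt0// mulrC.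
by apply: le_trans h; rewrite lerDr.
Qed.

Lemma flat_exp_small k t : flat_exp k t <= k.+2`!%:R * t ^+ 2.
Proof.
case: (ltP 0 t) => t0; last by rewrite flat_exp0// mulr_ge0// sqr_ge0.
have := flat_exp_le k.+2 t; rewrite !flat_expE// => h.
rewrite -ler_pdivrMr ?exprn_gt0//; apply: le_trans h.
by rewrite -mulrA -exprVn -exprD addn2.
Qed.

(** At 0 the difference quotient tends to 0 because flat_exp k is O(t^2). *)
Lemma is_derive_flat_exp k t :
  is_derive t 1 (flat_exp k) (- k%:R * flat_exp k.+1 t + flat_exp k.+2 t).
Proof.
have [t0|t0|->] := ltrgt0P t.
- have h : is_derive t 1 (fun s => expR (- s^-1) * s^-1 ^+ k)
      (- k%:R * flat_exp k.+1 t + flat_exp k.+2 t).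
    have dv : is_derive t 1 (fun s : R => s^-1) (- t ^- 2 *: 1).
      by apply: is_deriveV; rewrite ?gt_eqF.
    have d1 : is_derive t 1 (fun s : R => expR (- s^-1)) (expR (- t^-1) * - (- t ^- 2 *: 1)).
      by apply: (@is_derive1_comp _ expR (fun s => - s^-1)).
    have := is_deriveM d1 (is_deriveX k dv); rewrite exprfctE => h.
    apply: (is_derive_eq h); rewrite !flat_expE// /GRing.scale/= !mulr1.
    rewrite -exprVn -mulr_natl.
    case: k h => [|k] _; first by rewrite !expr0 /=; ring.
    by rewrite succnK !exprS; ring.
  apply: near_eq_is_derive h.
  near=> s; rewrite flat_expE//.
  by near: s; exact: lt_nbhsr.
- rewrite !flat_exp0 ?ltW// mulr0 addr0.
  apply: (@near_eq_is_derive _ _ _ (cst 0)).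
  near=> s; rewrite flat_exp0//.
  by apply: ltW; near: s; exact: lt_nbhsl.
- rewrite !flat_exp0// mulr0 addr0.
  apply/is_derive1_caratheodory.
  exists (fun s => flat_exp k s / s); split.
  + move=> z; rewrite (@flat_exp0 _ 0)// !subr0.
    have [->|z0] := eqVneq z 0; first by rewrite flat_exp0// mulr0.
    by rewrite divfK.
  + rewrite /prop_for /continuous_at /= (@flat_exp0 k 0)// mul0r.
    apply/cvgr0Pnorm_le => e e0; near=> s.
    rewrite normrM (ger0_norm (flat_exp_ge0 _ _)).
    have [->|s0] := eqVneq s 0; first by rewrite invr0 normr0 mulr0 ltW.
    rewrite normrV ?unitfE// ler_pdivrMr ?normr_gt0//.
    apply: le_trans (flat_exp_small _ _) _.
    rewrite -(real_normK (num_real s)) expr2 mulrA ler_pM2r ?normr_gt0//.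
    rewrite -ler_pdivlMl ?ltr0n ?fact_gt0//.
    near: s; apply/nbhs_normP.
    exists ((k.+2)`!%:R^-1 * e); first by rewrite /= mulr_gt0// invr_gt0 ltr0n fact_gt0.
    by move=> s /=; rewrite sub0r normrN => /ltW.
  + by rewrite flat_exp0// mul0r.
Unshelve. all: by end_near. Qed.

(** A syntax for smooth functions of one variable. The derivative of a member is
    again a member, so that membership gives all derivatives at once; cinf_prim
    admits functions, such as atan, known through their derivative. *)
Inductive cinf : (R -> R) -> Prop :=
| cinf_cst c : cinf (fun=> c)
| cinf_id : cinf (fun t => t)
| cinf_flat_exp k : cinf (flat_exp k)
| cinf_prim f f' : (forall t : R, is_derive t 1 f (f' t)) -> cinf f' -> cinf f
| cinf_add f g : cinf f -> cinf g -> cinf (fun t => f t + g t)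
| cinf_mul f g : cinf f -> cinf g -> cinf (fun t => f t * g t)
| cinf_inv f : (forall t, f t != 0) -> cinf f -> cinf (fun t => (f t)^-1)
| cinf_comp f g : cinf f -> cinf g -> cinf (fun t => f (g t)).

Lemma cinf_is_derive f : cinf f ->
  exists2 f', cinf f' & forall t : R, is_derive t 1 f (f' t).
Proof.
elim => {f} [c||k|f f' ff' cf' _|f g cf [f' cf' df] cg [g' cg' dg]|
    f g cf [f' cf' df] cg [g' cg' dg]|f f0 cf [f' cf' df]|
    f g cf [f' cf' df] cg [g' cg' dg]].
- by exists (fun=> 0); [exact: cinf_cst|move=> t; exact: is_derive_cst].
- by exists (fun=> 1); [exact: cinf_cst|move=> t; exact: is_derive_id].
- exists (fun t => - k%:R * flat_exp k.+1 t + flat_exp k.+2 t).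
    apply: cinf_add; last exact: cinf_flat_exp.
    by apply: cinf_mul; [exact: cinf_cst|exact: cinf_flat_exp].
  exact: is_derive_flat_exp.
- by exists f'.
- by exists (fun t => f' t + g' t); [exact: cinf_add|move=> t; exact: is_deriveD].
- exists (fun t => f t * g' t + g t * f' t).
    by apply: cinf_add; exact: cinf_mul.
  by move=> t; exact: is_deriveM.
- exists (fun t => - 1 * (((f t)^-1 * (f t)^-1) * f' t)).
    apply: cinf_mul; first exact: cinf_cst.
    by apply: cinf_mul => //; apply: cinf_mul; exact: cinf_inv.
  move=> t; apply: (is_derive_eq (is_deriveV (f0 t) (df t))).
  by rewrite /GRing.scale/= -exprVn expr2; ring.
- exists (fun t => f' (g t) * g' t).
    by apply: cinf_mul => //; exact: cinf_comp.
  by move=> t; exact: is_derive1_comp.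
Qed.

Lemma is_derive1_continuous f (f' : R -> R) : (forall t : R, is_derive t 1 f (f' t)) ->
  continuous f.
Proof.
move=> df t; apply: differentiable_continuous; apply/derivable1_diffP.
by have [] := df t.
Qed.

Lemma cinf_continuous f : cinf f -> continuous f.
Proof. by move=> /cinf_is_derive[f' _]; exact: is_derive1_continuous. Qed.

(** The same for functions of the plane: closure under the two partial
    derivatives yields smoothness in the sense of iterated partial derivatives. *)
Inductive cinf2 : (R * R -> R) -> Prop :=
| cinf2_fst f : cinf f -> cinf2 (fun x => f x.1)
| cinf2_snd f : cinf f -> cinf2 (fun x => f x.2)
| cinf2_add F G : cinf2 F -> cinf2 G -> cinf2 (fun x => F x + G x)
| cinf2_mul F G : cinf2 F -> cinf2 G -> cinf2 (fun x => F x * G x)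
| cinf2_comp f F : cinf f -> cinf2 F -> cinf2 (fun x => f (F x)).

Lemma cinf2_continuous F : cinf2 F -> continuous F.
Proof.
elim => {F} [f /cinf_continuous cf|f /cinf_continuous cf|F G _ cF _ cG|
    F G _ cF _ cG|f F /cinf_continuous cf _ cF] x.
- by apply: (@continuous_comp _ _ _ fst f); [exact: cvg_fst|exact: cf].
- by apply: (@continuous_comp _ _ _ snd f); [exact: cvg_snd|exact: cf].
- by apply: continuousD; [exact: cF|exact: cG].
- by apply: continuousM; [exact: cF|exact: cG].
- by apply: (@continuous_comp _ _ _ F f); [exact: cF|exact: cf].
Qed.

Lemma is_derive2_comp f (f' : R) F (x : R * R) (j : 'I_2) (l : R) :
  is_derive (F x) 1 f f' -> is_derive x (unit_vec R j) F l ->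
  is_derive x (unit_vec R j) (fun x => f (F x)) (f' * l).
Proof.
case: x j => a b [[|[|//]] ij] df.
- have -> : Ordinal ij = 0 by exact: val_inj.
  move=> /is_derive_slice1 dF; apply/is_derive_slice1.
  exact: (@is_derive1_comp _ f (fun s => F (s, b))).
- have -> : Ordinal ij = 1 by exact: val_inj.
  move=> /is_derive_slice2 dF; apply/is_derive_slice2.
  exact: (@is_derive1_comp _ f (fun s => F (a, s))).
Qed.

Lemma cinf2_is_derive F : cinf2 F -> forall j : 'I_2,
  exists2 F', cinf2 F' & forall x, is_derive x (unit_vec R j) F (F' x).
Proof.
elim => {F} [f /cinf_is_derive [f' cf' df]|f /cinf_is_derive [f' cf' df]|
    F G cF iF cG iG|F G cF iF cG iG|f F cf cF iF] j.
- exists (fun x => f' x.1 * (j == 0)%:R).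
    apply: cinf2_mul; first exact: cinf2_fst.
    by apply: (@cinf2_fst (fun=> _)); exact: cinf_cst.
  move=> [a b]; case: j => -[|[|//]] ij.
  + have -> : Ordinal ij = 0 by exact: val_inj.
    by apply/is_derive_slice1; rewrite mulr1/=; exact: df.
  + have -> : Ordinal ij = 1 by exact: val_inj.
    by apply/is_derive_slice2; rewrite mulr0/=; exact: is_derive_cst.
- exists (fun x => f' x.2 * (j == 1)%:R).
    apply: cinf2_mul; first exact: cinf2_snd.
    by apply: (@cinf2_fst (fun=> _)); exact: cinf_cst.
  move=> [a b]; case: j => -[|[|//]] ij.
  + have -> : Ordinal ij = 0 by exact: val_inj.
    by apply/is_derive_slice1; rewrite mulr0/=; exact: is_derive_cst.
  + have -> : Ordinal ij = 1 by exact: val_inj.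
    by apply/is_derive_slice2; rewrite mulr1/=; exact: df.
- have [F' cF' dF] := iF j; have [G' cG' dG] := iG j.
  exists (fun x => F' x + G' x); first exact: cinf2_add.
  by move=> x; exact: is_deriveD.
- have [F' cF' dF] := iF j; have [G' cG' dG] := iG j.
  exists (fun x => F x * G' x + G x * F' x).
    by apply: cinf2_add; exact: cinf2_mul.
  by move=> x; exact: is_deriveM.
- have [f' cf' df] := cinf_is_derive cf; have [F' cF' dF] := iF j.
  exists (fun x => f' (F x) * F' x).
    by apply: cinf2_mul => //; exact: cinf2_comp.
  by move=> x; apply: is_derive2_comp.
Qed.

Lemma cinf2_smooth F : cinf2 F -> smooth F.
Proof.
move=> cF s; have cs : cinf2 (iter_partial s F).
  elim: s => //= j s /cinf2_is_derive/(_ j)[F' cF' dF].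
  suff -> : partial j (iter_partial s F) = F' by [].
  by apply/funext => x; by have [] := dF x.
split; first exact: cinf2_continuous.
by move=> j x; have [F' _ /(_ x)[]] := cinf2_is_derive cs j.
Qed.

End smooth_functions.

(** * Continuous functions and boxes in the plane *)

Section plane_integrals.
Variable R : realType.
Implicit Types (F G : R * R -> R) (L : R).
Local Notation mu := (@lebesgue_measure R).
Local Notation mu2 := (@mu2 R).

(** The plane has a countable base of squares with rational centres and radii. *)
Lemma open_measurable_plane (U : set (R * R)) : open U -> measurable U.
Proof.
move=> oU.
pose B (q : rat * rat * rat) : set (R * R) :=
  ball (ratr q.1.1 : R) (ratr q.2 : R) `*` ball (ratr q.1.2 : R) (ratr q.2 : R).
have -> : U = \bigcup_(q in [set: rat * rat * rat])
    (if `[< B q `<=` U >] then B q else set0).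
  apply/seteqP; split => [[x y] Uxy|x [q _]]; last first.
    by case: ifPn => // /asboolP; exact.
  have : nbhs (x, y) U by exact: open_nbhs_nbhs.
  rewrite -nbhs_ballE => -[e /= e0 eU].
  have [r /andP[r0 re]] : exists r : rat, 0 < (ratr r : R) < e / 2.
    have [q] := @rat_in_itvoo R 0 (e / 2) (divr_gt0 e0 (ltr0Sn _ 1)).
    by rewrite in_itv/=; exists q.
  have near (z : R) : exists q : rat, `|ratr q - z| < ratr r.
    have [q] := @rat_in_itvoo R (z - ratr r) (z + ratr r) (ltac:(lra)).
    by rewrite in_itv/= => zq; exists q; rewrite ltr_distl.
  have [a ax] := near x; have [b bY] := near y.
  exists ((a, b), r) => //.
  have -> : `[< B (a, b, r) `<=` U >].
    apply/asboolP => -[s t] [/= sa tb]; apply: eU; split => /=.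
    - apply: (@le_ball _ _ _ (ratr r + ratr r)); first by lra.
      by apply: (ball_triangle _ sa); rewrite /ball/= distrC.
    - apply: (@le_ball _ _ _ (ratr r + ratr r)); first by lra.
      by apply: (ball_triangle _ tb); rewrite /ball/= distrC.
  by split.
apply: countable_bigcupT_measurable; first exact: countableP.
move=> q; case: ifP => // _; apply: measurableX;
  by apply: open_measurable; exact: ball_open.
Qed.

Lemma continuous_measurable_plane F : continuous F -> measurable_fun setT F.
Proof.
move=> /continuousP cF; apply: (measurability _ (RGenOpens.measurableE R)).
move=> _ [_ [a [b ->] <-]]; rewrite setTI; apply: open_measurable_plane.
exact/cF/interval_open.
Qed.

Definition box L : set (R * R) := `[-L, L]%classic `*` `[-L, L]%classic.

Lemma measurable_box L : measurable (box L).
Proof. by apply: measurableX. Qed.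

Lemma compact_box L : compact (box L).
Proof. by apply: compact_setX; exact: segment_compact. Qed.

Lemma mu2_rect (a b c e : R) : a <= b -> c <= e ->
  mu2 (`[a, b]%classic `*` `[c, e]%classic) = ((b - a) * (e - c))%:E.
Proof.
move=> ab ce; rewrite /Defs.mu2 product_measure1E//= !lebesgue_measure_itv/= !lte_fin.
move: ab ce; rewrite !le_eqVlt => /predU1P[->|ab] /predU1P[->|ce];
  by rewrite ?ltxx ?ab ?ce ?subrr ?mulr0 ?mul0r ?mule0 ?mul0e.
Qed.

Lemma mu2_box_lty L : (mu2 (box L) < +oo)%E.
Proof.
have [L0|L0] := leP 0 L; first by rewrite mu2_rect ?ltry// -subr_ge0; lra.
have -> : box L = set0; last by rewrite /Defs.mu2 measure0 ltry.
apply/seteqP; split => // -[x y] [/= + _].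
by rewrite in_itv/= => /andP[]; lra.
Qed.

Definition box_supported L F := forall x, ~ box L x -> F x = 0.

Lemma compact_support_bounded F L : continuous F -> box_supported L F ->
  exists2 M : R, 0 <= M & forall x, `|F x| <= M.
Proof.
move=> cF bF.
have : compact (F @` box L).
  by apply: continuous_compact; [exact: continuous_subspaceT|exact: compact_box].
move=> /compact_bounded[M [_ HM]].
exists (`|M| + 1) => [|x]; first by rewrite addr_ge0.
have [bx|/bF ->] := pselect (box L x); last by rewrite normr0 addr_ge0.
by apply: HM; [rewrite (le_lt_trans (ler_norm M))// ltrDl|exists x].
Qed.

Lemma sqint_box_supported D F L (M : R) : measurable D -> measurable_fun D F ->
  box_supported L F -> (forall x, `|F x| <= M) -> sqint mu2 D F.
Proof.
move=> mD mF bF FM.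
have s : sqint mu2 (D `&` box L) F.
  apply: (@bounded_sqint _ _ _ _ _ _ M) => //.
  - by apply: measurableI => //; exact: measurable_box.
  - apply: le_lt_trans (mu2_box_lty L); apply: le_measure; rewrite ?inE//.
    + by apply: measurableI => //; exact: measurable_box.
    + exact: measurable_box.
  - by apply: measurable_funS mF.
split => //; have [_] := s; rewrite integral_mkcondr.
congr (_ < _)%E; apply: eq_integral => x _; rewrite /patch.
by case: ifPn => // /negP; rewrite inE => /bF ->; rewrite expr0n.
Qed.

Lemma integrable_box_supported D F L (M : R) : measurable D -> measurable_fun D F ->
  box_supported L F -> (forall x, `|F x| <= M) ->
  mu2.-integrable D (fun x => (F x)%:E).
Proof.
move=> mD mF bF FM.
pose b : R * R -> R := \1_(box L).
have sb : sqint mu2 D b.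
  apply: (@sqint_box_supported _ _ L 1) => //.
  - by apply: measurable_indic; exact: measurable_box.
  - by move=> x nx; rewrite /b indicE memNset.
  - by move=> x; rewrite /b indicE; case: (_ \in _); rewrite ?normr1 ?normr0.
have := @sqint_integrable_mul _ _ _ mu2 _ _ _ mD (sqint_box_supported mD mF bF FM) sb.
apply: eq_integrable => // x _; rewrite /b indicE.
have [bx|bx] := pselect (box L x); first by rewrite mem_set// mulr1.
by rewrite bF// mul0r.
Qed.

End plane_integrals.

(** * Calculus of smooth functions in the plane *)

Section plane_calculus.
Variable R : realType.
Implicit Types (F G phi psi : R * R -> R) (L s t : R).
Local Notation mu := (@lebesgue_measure R).
Local Notation mu2 := (@mu2 R).

Lemma FTC_is_derive (g g' : R -> R) (a b : R) : a <= b ->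
  (forall t : R, is_derive t 1 g (g' t)) -> continuous g' ->
  (\int[mu]_(t in `[a, b]) (g' t)%:E)%E = (g b - g a)%:E.
Proof.
rewrite le_eqVlt => /predU1P[->|ab] dg cg'.
  by rewrite set_itv1 integral_set1 subrr.
have cg := is_derive1_continuous dg.
rewrite (@continuous_FTC2 _ g' g)//.
- exact: continuous_subspaceT.
- split.
  + by move=> x _; have [] := dg x.
  + exact: cvg_at_right_filter (cg a).
  + exact: cvg_at_left_filter (cg b).
- by move=> x _; rewrite derive1E; have [] := dg x.
Qed.

Lemma FTC_compact_support (g g' : R -> R) L :
  (forall t : R, is_derive t 1 g (g' t)) -> continuous g' ->
  (forall t : R, ~ (- L <= t <= L) -> g t = 0) ->
  (\int[mu]_t (g' t)%:E)%E = 0%E.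
Proof.
move=> dg cg' g0.
have g'0 (t : R) : ~ (- L <= t <= L) -> g' t = 0.
  move=> nt; have [_ <-] := dg t.
  rewrite (@near_eq_derive _ _ _ g (cst 0)) ?derive_cst//.
  have /open_nbhs_nbhs : open_nbhs t (~` `[-L, L]%classic).
    split; first by apply: closed_openC; exact: interval_closed.
    by rewrite /= in_itv.
  by apply: filterS => s /=; rewrite in_itv/= => ns; rewrite g0.
transitivity (\int[mu]_(t in `[(- (`|L| + 1))%R, (`|L| + 1)%R]) (g' t)%:E)%E.
  rewrite [RHS]integral_mkcond; apply: eq_integral => t _; rewrite /patch.
  case: ifPn => // /negP; rewrite inE/= in_itv/= => nt; rewrite g'0// => Lt.
  apply: nt; have := ler_norm L; have := ler_norm (- L); rewrite normrN.
  by move: Lt => /andP[? ?]; lra.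
rewrite (FTC_is_derive _ dg cg'); last by have := normr_ge0 L; lra.
by rewrite !g0 ?subrr// => /andP[]; have := ler_norm L; lra.
Qed.

Lemma Rintegral_plane_slice1_eq0 F : mu2.-integrable setT (fun x => (F x)%:E) ->
  (forall t, (\int[mu]_s (F (s, t))%:E)%E = 0%E) -> \int[mu2]_x F x = 0.
Proof.
move=> iF F0; rewrite /Rintegral -integral21_prod_meas1//.
by rewrite integral0_eq// => t _; rewrite /fubini_G F0.
Qed.

Lemma Rintegral_plane_slice2_eq0 F : mu2.-integrable setT (fun x => (F x)%:E) ->
  (forall s, (\int[mu]_t (F (s, t))%:E)%E = 0%E) -> \int[mu2]_x F x = 0.
Proof.
move=> iF F0; rewrite /Rintegral -integral12_prod_meas1//.
by rewrite integral0_eq// => s _; rewrite /fubini_F F0.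
Qed.

Lemma box_not1 L (s t : R) : ~ (- L <= s <= L) -> ~ box L (s, t).
Proof. by move=> nt [/=]; rewrite in_itv/= => /nt. Qed.

Lemma box_not2 L (s t : R) : ~ (- L <= t <= L) -> ~ box L (s, t).
Proof. by move=> nt [_]/=; rewrite in_itv/= => /nt. Qed.

Lemma continuous_slice1 F (t : R) : continuous F -> continuous (fun s => F (s, t)).
Proof.
move=> cF s; apply: (@cvg_comp _ _ _ (fun s : R => (s, t)) F _ (nbhs (s, t))) (cF _).
by apply: (@cvg_pair _ _ _ _ (nbhs s) (nbhs t)); [exact: cvg_id|exact: cvg_cst].
Qed.

Lemma continuous_slice2 F (s : R) : continuous F -> continuous (fun t => F (s, t)).
Proof.
move=> cF t; apply: (@cvg_comp _ _ _ (fun t : R => (s, t)) F _ (nbhs (s, t))) (cF _).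
by apply: (@cvg_pair _ _ _ _ (nbhs s) (nbhs t)); [exact: cvg_cst|exact: cvg_id].
Qed.

Lemma partial_box_supported L F (j : 'I_2) :
  box_supported L F -> box_supported L (partial j F).
Proof.
move=> bF x nx; rewrite /partial (@near_eq_derive _ _ _ F (cst 0)) ?derive_cst//.
have /open_nbhs_nbhs : open_nbhs x (~` box L).
  split => //; apply: closed_openC; apply: compact_closed; last exact: compact_box.
  exact: norm_hausdorff.
by apply: filterS => y /bF ->.
Qed.

Lemma integral_partial1_strip F L (A : set R) : measurable A ->
  (forall x, derivable F x (unit_vec R 0)) -> continuous (partial 0 F) ->
  box_supported L F -> \int[mu2]_(x in [set x | A x.2]) partial 0 F x = 0.
Proof.
move=> mA dF cF' bF; have bF' := partial_box_supported 0 bF.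
have mS : measurable [set x : R * R | A x.2].
  by rewrite (_ : [set x | A x.2] = setT `*` A); [exact: measurableX|
     apply/seteqP; split => [x|x []]].
have [M M0 FM] := compact_support_bounded cF' bF'.
rewrite Rintegral_mkcond; apply: Rintegral_plane_slice1_eq0 => [|t].
  rewrite (_ : (fun _ => _) = (EFin \o partial 0 F) \_ [set x | A x.2]); last first.
    by rewrite restrict_EFin.
  apply: (@integrable_mkcond _ _ _ mu2 _ _ mS).1; apply: (integrable_box_supported mS _ bF' FM).
  by apply: (measurable_funS measurableT) => //; exact: continuous_measurable_plane.
rewrite /patch; have [At|At] := pselect (A t); last first.
  by rewrite integral0_eq// => s _; rewrite memNset.
under eq_integral do rewrite mem_set//.
apply: (@FTC_compact_support (fun s => F (s, t)) _ L).
- by move=> s; apply/is_derive_slice1; exact/derivableP.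
- exact: (@continuous_slice1 (partial 0 F)).
- by move=> s ns; apply: bF; exact: box_not1.
Qed.

Lemma integral_partial_plane F L (j : 'I_2) :
  (forall x, derivable F x (unit_vec R j)) -> continuous (partial j F) ->
  box_supported L F -> \int[mu2]_x partial j F x = 0.
Proof.
case: j => -[|[|//]] ij.
  have -> : Ordinal ij = 0 by exact: val_inj.
  exact: (@integral_partial1_strip F L setT).
have -> : Ordinal ij = 1 by exact: val_inj.
move=> dF cF' bF; have bF' := partial_box_supported 1 bF.
have [M M0 FM] := compact_support_bounded cF' bF'.
apply: Rintegral_plane_slice2_eq0 => [|s].
  apply: (integrable_box_supported _ _ bF' FM) => //.
  exact: continuous_measurable_plane.
apply: (@FTC_compact_support (fun t => F (s, t)) _ L).
- by move=> t; apply/is_derive_slice2; exact/derivableP.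
- exact: (@continuous_slice2 (partial 1 F)).
- by move=> t nt; apply: bF; exact: box_not2.
Qed.

Lemma test_fun_box_supported (U : set (R * R)) phi :
  test_fun U phi -> exists2 L, 0 < L & box_supported L phi.
Proof.
move=> [_ /compact_bounded[M [_ HM]] _].
exists (`|M| + 1); first by rewrite ltr_wpDl.
move=> x nx; apply/eqP; apply: contrapT => px; apply: nx.
have : `|x| <= `|M| + 1.
  apply: HM; first by rewrite (le_lt_trans (ler_norm M))// ltrDl.
  by apply: subset_closure => /=; apply/negP.
rewrite /box => h; have := h; rewrite prod_normE ge_max => /andP[h1 h2].
by split; rewrite /= in_itv/= -ler_norml.
Qed.

Lemma smooth_continuous F : smooth F -> continuous F.
Proof. by move=> /(_ [::])[]. Qed.

Lemma smooth_derivable F (j : 'I_2) x : smooth F -> derivable F x (unit_vec R j).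
Proof. by move=> /(_ [::])[_]; exact. Qed.

Lemma smooth_partial F (j : 'I_2) : smooth F -> smooth (partial j F).
Proof.
move=> sF s; have := sF (rcons s j).
by rewrite /iter_partial foldr_rcons.
Qed.

(** The second difference over an e-square is e^2 times a mixed derivative at
    a nearby point, by the mean value theorem used once in each direction. *)
Lemma second_difference (f f1 f12 : R -> R -> R) (a b e : R) : 0 < e ->
  (forall s t, is_derive s 1 (f^~ t) (f1 s t)) ->
  (forall s t, is_derive t 1 (f1 s) (f12 s t)) ->
  exists s t, [/\ `|a - s| < e, `|b - t| < e &
  f (a + e) (b + e) - f (a + e) b - (f a (b + e) - f a b) = f12 s t * e * e].
Proof.
move=> e0 d1 d2.
have dg s : is_derive s 1 (fun s => f s (b + e) - f s b) (f1 s (b + e) - f1 s b).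
  exact: is_deriveB.
have [||s] := @MVT _ _ _ a (a + e) _ (fun s _ => dg s).
- by rewrite ltrDl.
- by apply: continuous_subspaceT; exact: is_derive1_continuous dg.
rewrite in_itv/= => /andP[as1 as2] ->.
have [||t] := @MVT _ _ _ b (b + e) _ (fun t _ => d2 s t).
- by rewrite ltrDl.
- by apply: continuous_subspaceT; exact: is_derive1_continuous (d2 s).
rewrite in_itv/= => /andP[bt1 bt2] ->.
exists s, t; split; last by congr (_ * _ * _); ring.
  by rewrite ltr_norml; apply/andP; split; lra.
by rewrite ltr_norml; apply/andP; split; lra.
Qed.

(** Both mixed derivatives are limits of the same second difference. *)
Lemma partial_comm F : smooth F -> partial 0 (partial 1 F) = partial 1 (partial 0 F).
Proof.
move=> sF; apply/funext => -[a b].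
set H := partial 0 (partial 1 F); set G := partial 1 (partial 0 F).
have dF (K : R * R -> R) j x : smooth K -> is_derive x (unit_vec R j) K (partial j K x).
  by move=> sK; apply/derivableP; exact: smooth_derivable.
have cH : continuous H by apply: smooth_continuous; do 2 apply: smooth_partial.
have cG : continuous G by apply: smooth_continuous; do 2 apply: smooth_partial.
apply/eqP; rewrite -subr_eq0 -normr_le0; apply/ler_addgt0Pr => e e0; rewrite add0r.
have e20 : 0 < e / 2 by rewrite divr_gt0.
have /cvgrPdist_lt/(_ _ e20) nH := cH (a, b).
have /cvgrPdist_lt/(_ _ e20) nG := cG (a, b).
have /nbhs_ballP[r1 /= r10 h1] := nH; have /nbhs_ballP[r2 /= r20 h2] := nG.
pose r := Num.min r1 r2; have r0 : 0 < r by rewrite lt_min r10.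
have [s [t [sa tb e1]]] := @second_difference (fun s t => F (s, t))
  (fun s t => partial 0 F (s, t)) (fun s t => G (s, t)) a b r r0
  (fun s t => (is_derive_slice1 _ _ _ _).1 (dF _ _ _ sF))
  (fun s t => (is_derive_slice2 _ _ _ _).1 (dF _ _ _ (smooth_partial 0 sF))).
have [t' [s' [tb' sa' e2]]] := @second_difference (fun t s => F (s, t))
  (fun t s => partial 1 F (s, t)) (fun t s => H (s, t)) b a r r0
  (fun t s => (is_derive_slice2 _ _ _ _).1 (dF _ _ _ sF))
  (fun t s => (is_derive_slice1 _ _ _ _).1 (dF _ _ _ (smooth_partial 1 sF))).
have Gd : `|G (a, b) - G (s, t)| < e / 2.
  by apply: h2; split; rewrite /ball/=;
    [apply: (lt_le_trans sa)|apply: (lt_le_trans tb)]; rewrite ge_min lexx orbT.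
have Hd : `|H (a, b) - H (s', t')| < e / 2.
  by apply: h1; split; rewrite /ball/=;
    [apply: (lt_le_trans sa')|apply: (lt_le_trans tb')]; rewrite ge_min lexx.
have E : G (s, t) = H (s', t').
  have rn0 : r != 0 by rewrite gt_eqF.
  apply: (mulIf rn0); apply: (mulIf rn0).
  transitivity (F (a + r, b + r) - F (a + r, b) - (F (a, b + r) - F (a, b))).
    exact: esym e1.
  apply: etrans e2 => /=.
  by move: (F (_, _)) (F (_, _)) (F (_, _)) (F (_, _)) => x y z u; ring.
move: (H (a, b)) (G (a, b)) (G (s, t)) (H (s', t')) Gd Hd E => h g g' h'.
rewrite !ltr_norml ler_norml => /andP[? ?] /andP[? ?] ?.
by apply/andP; split; lra.
Qed.

Lemma continuous_plane_add F G : continuous F -> continuous G ->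
  continuous (fun x => F x + G x).
Proof. by move=> cF cG x; apply: continuousD; [exact: cF|exact: cG]. Qed.

Lemma continuous_plane_mul F G : continuous F -> continuous G ->
  continuous (fun x => F x * G x).
Proof. by move=> cF cG x; apply: continuousM; [exact: cF|exact: cG]. Qed.

Lemma sqint_smooth F L D : smooth F -> box_supported L F -> measurable D ->
  sqint mu2 D F.
Proof.
move=> /smooth_continuous cF bF mD.
have [M M0 FM] := compact_support_bounded cF bF.
apply: (sqint_box_supported mD _ bF FM).
exact: measurable_funS (continuous_measurable_plane cF).
Qed.

Lemma integrable_smooth F L D : smooth F -> box_supported L F -> measurable D ->
  mu2.-integrable D (fun x => (F x)%:E).
Proof.
move=> /smooth_continuous cF bF mD.
have [M M0 FM] := compact_support_bounded cF bF.
apply: (integrable_box_supported mD _ bF FM).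
exact: measurable_funS (continuous_measurable_plane cF).
Qed.

(** d0 phi d1 psi - d1 phi d0 psi = d0 (phi d1 psi) - d1 (phi d0 psi): the mixed
    derivatives of psi cancel. *)
Lemma curl_free_gradient phi (U : set (R * R)) : test_fun U phi ->
  curl_free setT (fun j => partial j phi).
Proof.
move=> tphi psi tpsi.
have [L L0 bphi] := test_fun_box_supported tphi.
have [sphi _ _] := tphi; have [spsi _ _] := tpsi.
have dF (K : R * R -> R) j x : smooth K -> is_derive x (unit_vec R j) K (partial j K x).
  by move=> sK; apply/derivableP; exact: smooth_derivable.
have dprod (i j : 'I_2) x : is_derive x (unit_vec R j) (phi * partial i psi)
    (phi x * partial j (partial i psi) x + partial i psi x * partial j phi x).
  apply: is_deriveM; first exact: dF.
  by apply: dF; exact: smooth_partial.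
have vprod (i j : 'I_2) : partial j (phi * partial i psi) = (fun x =>
    phi x * partial j (partial i psi) x + partial i psi x * partial j phi x).
  by apply/funext => x; have [] := dprod i j x.
have cprod (i j : 'I_2) : continuous (partial j (phi * partial i psi)).
  rewrite vprod; apply: continuous_plane_add; apply: continuous_plane_mul.
  - exact: smooth_continuous.
  - by apply: smooth_continuous; do 2 apply: smooth_partial.
  - by apply: smooth_continuous; exact: smooth_partial.
  - by apply: smooth_continuous; exact: smooth_partial.
have bprod (i : 'I_2) : box_supported L (phi * partial i psi).
  by move=> x nx; rewrite /GRing.mul/= bphi// mul0r.
have int0 (i j : 'I_2) : \int[mu2]_x partial j (phi * partial i psi) x = 0.
  apply: (integral_partial_plane _ (cprod i j) (bprod i)).
  by move=> x; have [] := dprod i j x.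
have integ (i j : 'I_2) : mu2.-integrable setT
    (fun x => (partial j (phi * partial i psi) x)%:E).
  have bp := partial_box_supported j (bprod i).
  have [M M0 FM] := compact_support_bounded (cprod i j) bp.
  apply: (integrable_box_supported _ _ bp FM) => //.
  exact: continuous_measurable_plane.
transitivity (\int[mu2]_x (partial 0 (phi * partial 1 psi) x -
    partial 1 (phi * partial 0 psi) x)).
  by apply: eq_Rintegral => x _; rewrite !vprod (partial_comm spsi); ring.
have i10 := integ 1 0.
have i01 := integ 0 1.
have e10 := int0 1 0.
have e01 := int0 0 1.
move: i10 i01 e10 e01.
move: (partial 0 (phi * partial 1 psi)) (partial 1 (phi * partial 0 psi)).
move=> A B iA iB A0 B0.
have h := (@RintegralB _ _ _ mu2 setT A B measurableT iA iB).
apply: (etrans h).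
by rewrite A0 B0 subrr.
Qed.

End plane_calculus.

(** * Completeness of the space of square-integrable functions *)

Section L2_completeness.
Context d (T : measurableType d) (R : realType).
Context (mu : {measure set T -> \bar R}).

Lemma cvgn_geometric_increments (u : R^nat) (K : R) :
  (forall n, `|u n.+1 - u n| <= K * 2^-1 ^+ n) -> cvgn u.
Proof.
move=> uK.
have K0 : 0 <= K by have := le_trans (normr_ge0 _) (uK 0%N); rewrite expr0 mulr1.
have -> : u = (fun n => u 0%N + series (telescope u) n).
  by apply/funext => n; rewrite -eq_sum_telescope.
apply: is_cvgD; first exact: is_cvg_cst.
apply: normed_cvg; apply: (@series_le_cvg _ _ (geometric K 2^-1)).
- by move=> n; rewrite /= normr_ge0.
- by move=> n /=; rewrite mulr_ge0// exprn_ge0// invr_ge0.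
- exact: uK.
- by apply: is_cvg_geometric_series; rewrite ger0_norm ?invr_ge0// invf_lt1// ltr1n.
Qed.

(** Fast Cauchy sequences: the weighted sum S of the squared increments is
    integrable, so the sequence converges geometrically wherever S is finite,
    and Fatou's lemma bounds the distance to the limit. *)
Lemma sqint_complete (D : set T) (f : nat -> T -> R) : measurable D ->
  (forall n, sqint mu D (f n)) ->
  (forall n k, \int[mu]_(x in D) (f n x - f (n + k)%N x) ^+ 2 <= 16^-1 ^+ n) ->
  exists2 g, sqint mu D g &
    forall n, \int[mu]_(x in D) (f n x - g x) ^+ 2 <= 16^-1 ^+ n.
Proof.
move=> mD sf fC.
pose S x := (\sum_(0 <= n <oo) (4 ^+ n * (f n.+1 x - f n x) ^+ 2)%:E)%E.
have S0 n x : (0 <= (4 ^+ n * (f n.+1 x - f n x) ^+ 2)%:E)%E.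
  by rewrite lee_fin mulr_ge0 ?sqr_ge0// exprn_ge0.
have sinc n k : sqint mu D (fun x => f n x - f k x) by exact: sqintB.
have minc n : measurable_fun D (fun x => (4 ^+ n * (f n.+1 x - f n x) ^+ 2)%:E).
  apply/measurable_EFinP; apply: measurable_funM => //.
  by apply: measurable_funX; exact: (sinc _ _).1.
have mS : measurable_fun D S by apply: ge0_emeasurable_sum => // *; exact: S0.
have intS : (\int[mu]_(x in D) S x < +oo)%E.
  rewrite integral_nneseries//; apply: (@le_lt_trans _ _ 2%:E); last exact: ltry.
  apply: lime_le; first by apply: is_cvg_nneseries => n _ _; exact: integral_ge0.
  apply: nearW => n.
  apply: (@le_trans _ _ (\sum_(0 <= i < n) (geometric 1 4^-1 i)%:E)%E).
    apply: lee_sum => i _; under eq_integral do rewrite EFinM.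
    rewrite ge0_integralZl_EFin//; last 2 first.
    - by move=> x _; rewrite lee_fin sqr_ge0.
    - by apply/measurable_EFinP; apply: measurable_funX; exact: (sinc _ _).1.
    rewrite sqint_int_sqr// -EFinM lee_fin /= mul1r.
    have := fC i 1%N; rewrite addn1 => h.
    have -> : 4^-1 ^+ i = 4 ^+ i * 16^-1 ^+ i :> R.
      by rewrite -exprMn; congr (_ ^+ _); lra.
    rewrite ler_pM2l ?exprn_gt0//; apply: le_trans h.
    rewrite le_eqVlt; apply/orP; left; apply/eqP.
    by apply: eq_Rintegral => x _; ring.
  have z1 : 4^-1 != 1 :> R by rewrite lt_eqF// invf_lt1// ltr1n.
  rewrite sumEFin lee_fin.
  have -> : \sum_(0 <= i < n) geometric 1 4^-1 i = series (geometric 1 4^-1) n :> R by [].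
  rewrite geometric_seriesE//= mul1r ler_pdivrMr; last by lra.
  have : 0 <= 4^-1 ^+ n :> R by rewrite exprn_ge0// invr_ge0.
  lra.
have Sfin : {ae mu, forall x, D x -> S x \is a fin_num}.
  apply: integrable_ae => //; apply/integrableP; split => //.
  under eq_integral do rewrite gee0_abs ?nneseries_ge0//.
  exact: intS.
have fcvg : {ae mu, forall x, D x -> cvgn (f ^~ x)}.
  apply: filterS Sfin => x Sx Dx; have /fineK eS := Sx Dx.
  apply: (@cvgn_geometric_increments _ (1 + fine (S x))) => n.
  have : ((4 ^+ n * (f n.+1 x - f n x) ^+ 2)%:E <= (fine (S x))%:E)%E.
    rewrite eS; have := @nneseries_lim_ge R (fun n => (4 ^+ n * (f n.+1 x - f n x) ^+ 2)%:E)
      xpredT 0 n.+1 (fun n _ _ => S0 n x).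
    apply: le_trans; rewrite big_nat_recr//= leeDr// sume_ge0//.
  rewrite lee_fin (_ : 4 ^+ n = (2 ^+ n) ^+ 2); last first.
    by rewrite -exprM mulnC exprM; congr (_ ^+ _); rewrite expr2 -natrM.
  rewrite -exprMn -(real_normK (num_real (2 ^+ n * _))) normrM ger0_norm ?exprn_ge0//.
  set z := 2 ^+ n * _ => hz.
  rewrite exprVn ler_pdivlMr ?exprn_gt0// mulrC -/z.
  have z0 : 0 <= z by rewrite mulr_ge0 ?exprn_ge0.
  nra.
pose g x := fine (limn_esup (fun n => (f n x)%:E)).
have mg : measurable_fun D g.
  apply: measurableT_comp => //; apply: measurable_fun_limn_esup => n.
  by apply/measurable_EFinP; exact: (sf n).1.
have fg : {ae mu, forall x, D x -> f ^~ x @ \oo --> g x}.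
  apply: filterS fcvg => x fx Dx; have /cvg_ex[l fl] := fx Dx.
  rewrite (_ : g x = l)// /g (_ : limn_esup _ = l%:E)//.
  by apply: (cvg_limn_einf_sup _).2; apply: cvg_EFin => //; exact: nearW.
have dist n : (\int[mu]_(x in D) ((f n x - g x) ^+ 2)%:E <= (16^-1 ^+ n)%:E)%E.
  pose h k x := ((f n x - f (n + k)%N x) ^+ 2)%:E.
  have mh k : measurable_fun D (h k).
    by apply/measurable_EFinP; apply: measurable_funX; exact: (sinc _ _).1.
  have h0 k x : D x -> (0 <= h k x)%E by move=> _; rewrite lee_fin sqr_ge0.
  have mfg : measurable_fun D (fun x => f n x - g x).
    by apply: measurable_funB => //; exact: (sf n).1.
  rewrite (@ge0_ae_eq_integral _ _ _ mu _ _ (fun x => limn_einf (h ^~ x)))//.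
  - apply: le_trans (fatou mu mD mh h0) _; rewrite limn_einf_lim.
    apply: lime_le; first exact: is_cvg_einfs.
    apply: nearW => k; apply: (@le_trans _ _ (\int[mu]_(x in D) h k x)%E).
      by apply: ereal_inf_lbound; exists k => /=.
    by rewrite sqint_int_sqr// lee_fin.
  - by apply/measurable_EFinP; exact: measurable_funX.
  - rewrite (_ : (fun x => _) = (fun x => - limn_esup (fun k => - h k x))%E); last first.
      by apply/funext => x; rewrite -[LHS]oppeK -limn_esupN.
    apply: measurableT_comp => //; apply: measurable_fun_limn_esup => k.
    exact: measurableT_comp.
  - by move=> x _; rewrite lee_fin sqr_ge0.
  - move=> x Dx; rewrite limn_einf_lim; apply: lime_ge; first exact: is_cvg_einfs.
    by apply: nearW => k; apply: le_ereal_inf_tmp => _ [j _ <-]; exact: h0.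
  - apply: filterS fg => x fgx Dx; have {}fgx := fgx Dx.
    apply/esym/(fun H => (cvg_limn_einf_sup H).1).
    apply: cvg_EFin; first exact: nearW.
    rewrite /comp /h /=; under eq_fun do rewrite addnC expr2.
    have cf : (fun k => f n x - f (k + n)%N x) @ \oo --> f n x - g x.
      by apply: cvgB; [exact: cvg_cst|move: fgx; rewrite -(cvg_shiftn n)].
    by rewrite expr2; exact: cvgM.
have sng n : sqint mu D (fun x => f n x - g x).
  split; last exact: le_lt_trans (dist n) (ltry _).
  by apply: measurable_funB => //; exact: (sf n).1.
exists g => [|n].
  have := sqintB mD (sf 0%N) (sng 0%N).
  by under eq_fun do rewrite subKr.
by rewrite -lee_fin -sqint_int_sqr.
Qed.

End L2_completeness.

(** * Projection in the space of square-integrable fields *)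

Section projection.
Context d (T : measurableType d) (R : realType).
Context (mu : {measure set T -> \bar R}) (D : set T) (mD : measurable D).
Variable N : nat.
Implicit Types u v w z F : 'I_N -> T -> R.

Definition sqfield u := forall j, sqint mu D (u j).

Definition inner u v : R := \sum_(j < N) \int[mu]_(x in D) (u j x * v j x).

Definition lincomb (a : R) u (b : R) v : 'I_N -> T -> R :=
  fun j x => a * u j x + b * v j x.

Lemma sqfield_lincomb a u b v : sqfield u -> sqfield v -> sqfield (lincomb a u b v).
Proof. by move=> su sv j; apply: sqintD => //; exact: sqintZ. Qed.

Lemma innerC u v : inner u v = inner v u.
Proof. by apply: eq_bigr => j _; apply: eq_Rintegral => x _; rewrite mulrC. Qed.

Lemma inner_lincombl a u b v w : sqfield u -> sqfield v -> sqfield w ->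
  inner (lincomb a u b v) w = a * inner u w + b * inner v w.
Proof.
move=> su sv sw; rewrite /inner !big_distrr -big_split/=; apply: eq_bigr => j _.
have iu := sqint_integrable_mul mD (su j) (sw j).
have iv := sqint_integrable_mul mD (sv j) (sw j).
have iau := sqint_integrable_mul mD (sqintZ a mD (su j)) (sw j).
have ibv := sqint_integrable_mul mD (sqintZ b mD (sv j)) (sw j).
rewrite -!RintegralZl// -RintegralD//.
- by apply: eq_Rintegral => x _; rewrite /lincomb; ring.
- by apply: eq_integrable iau => // x _; rewrite /= mulrA.
- by apply: eq_integrable ibv => // x _; rewrite /= mulrA.
Qed.

Lemma inner_lincombr a u b v w : sqfield u -> sqfield v -> sqfield w ->
  inner w (lincomb a u b v) = a * inner w u + b * inner w v.
Proof. by move=> *; rewrite innerC inner_lincombl// !(innerC w). Qed.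

Lemma inner_ge0 u : 0 <= inner u u.
Proof.
by apply: sumr_ge0 => j _; apply: Rintegral_ge0 => x _; rewrite -expr2 sqr_ge0.
Qed.

Lemma cvg_integral_mul (I : Type) (FF : set_system I) {Ff : Filter FF}
    (f : I -> T -> R) (g h : T -> R) :
  (\forall i \near FF, sqint mu D (f i)) -> sqint mu D g -> sqint mu D h ->
  \int[mu]_(x in D) (f i x - g x) ^+ 2 @[i --> FF] --> 0 ->
  \int[mu]_(x in D) (f i x * h x) @[i --> FF] --> \int[mu]_(x in D) (g x * h x).
Proof.
move=> sf sg sh fg.
set C := \int[mu]_(x in D) (h x ^+ 2).
have C0 : 0 <= C by apply: Rintegral_ge0 => x _; rewrite sqr_ge0.
apply/cvgrPdist_lt => e e0.
have e1 : 0 < e ^+ 2 / (C + 1) by rewrite divr_gt0 ?exprn_gt0// ltr_wpDl.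
near=> i.
have sfi : sqint mu D (f i) by near: i.
rewrite distrC -RintegralB//; last 2 first.
- exact: sqint_integrable_mul.
- exact: sqint_integrable_mul.
under eq_Rintegral do rewrite -mulrBl.
rewrite -(@ltr_pXn2r _ 2)// ?nnegrE ?ltW// real_normK ?num_real//.
apply: le_lt_trans (cauchy_schwarz_integral mD (sqintB mD sfi sg) sh) _.
have : `|0 - \int[mu]_(x in D) (f i x - g x) ^+ 2| < e ^+ 2 / (C + 1).
  by near: i; move/cvgrPdist_lt : fg; exact.
have A0 : 0 <= \int[mu]_(x in D) (f i x - g x) ^+ 2.
  by apply: Rintegral_ge0 => x _; rewrite sqr_ge0.
rewrite sub0r normrN -/C ger0_norm// ltr_pdivlMr ?ltr_wpDl//.
by apply: le_lt_trans; rewrite mulrDr mulr1 lerDl.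
Unshelve. all: by end_near. Qed.

(** The minimising sequence of the distance from F to V is Cauchy by the
    parallelogram law, and its limit is the projection. The second
    conclusion, weak approximation by elements of V, passes linear constraints on
    to the projection. *)
Lemma projection (V : set ('I_N -> T -> R)) F :
  V (fun _ _ => 0) ->
  (forall a u b v, V u -> V v -> V (lincomb a u b v)) ->
  V `<=` sqfield -> sqfield F ->
  exists P, [/\ sqfield P,
    exists v : nat -> 'I_N -> T -> R, (forall n, V (v n)) /\
      forall w, sqfield w -> inner (v n) w @[n --> \oo] --> inner P w &
    forall w, V w -> inner (lincomb 1 F (- 1) P) w = 0].
Proof.
move=> V0 Vlin Vsq sF.
pose dist v := inner (lincomb 1 F (- 1) v) (lincomb 1 F (- 1) v).
pose S : set R := [set dist v | v in V].
have lbS : lbound S 0 by move=> _ [v _ <-]; exact: inner_ge0.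
have infS : has_inf S by split; [exists (dist (fun _ _ => 0)); exists (fun _ _ => 0)|exists 0].
pose del := inf S.
have delP v : V v -> del <= dist v.
  by move=> Vv; apply: ge_inf => //; [exists 0|exists v].
(* the defect 16^-n / 4 makes the squared distances between later terms at most
   16^-n, fast enough for almost everywhere convergence *)
have [v vP] : {v : nat -> 'I_N -> T -> R &
    forall n, V (v n) /\ dist (v n) < del + 16^-1 ^+ n / 4}.
  apply: (@choice _ _ (fun n v => V v /\ dist v < del + 16^-1 ^+ n / 4)) => n.
  have [|_ [v Vv <-] h] := @inf_adherent _ S (16^-1 ^+ n / 4) _ infS.
    by rewrite divr_gt0// exprn_gt0// invr_gt0.
  by exists v.
have Vv n : V (v n) := (vP n).1.
have sv n : sqfield (v n) := Vsq _ (Vv n).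
have distE u : sqfield u -> dist u = inner F F - 2 * inner F u + inner u u.
  move=> su; rewrite /dist inner_lincombl ?inner_lincombr//;
    [|exact: sqfield_lincomb].
  by rewrite (innerC u F); ring.
have lin2 a u b w z : sqfield u -> sqfield w -> sqfield z ->
    inner (lincomb a u b w) (lincomb a u b w) =
    a ^+ 2 * inner u u + 2 * a * b * inner u w + b ^+ 2 * inner w w.
  move=> su sw sz; rewrite inner_lincombl ?inner_lincombr//;
    [|exact: sqfield_lincomb].
  by rewrite (innerC w u); ring.
have e16 n : 0 < 16^-1 ^+ n :> R by rewrite exprn_gt0// invr_gt0.
have cauchy n k j : \int[mu]_(x in D) (v n j x - v (n + k)%N j x) ^+ 2 <= 16^-1 ^+ n.
  set u := v n; set w := v (n + k)%N.
  have su : sqfield u by exact: sv.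
  have sw : sqfield w by exact: sv.
  apply: (@le_trans _ _ (inner (lincomb 1 u (- 1) w) (lincomb 1 u (- 1) w))).
    rewrite /inner (bigD1 j)//= -[leLHS]addr0; apply: lerD; last first.
      by apply: sumr_ge0 => i _; apply: Rintegral_ge0 => x _; rewrite -expr2 sqr_ge0.
    rewrite le_eqVlt; apply/orP; left; apply/eqP; apply: eq_Rintegral => x _.
    by rewrite /lincomb; ring.
  have := delP _ (Vlin 2^-1 u 2^-1 w (Vv _) (Vv _)).
  have du : dist u < del + 16^-1 ^+ n / 4 := (vP n).2.
  have dw : dist w < del + 16^-1 ^+ (n + k) / 4 := (vP _).2.
  have ek : 16^-1 ^+ (n + k) <= 16^-1 ^+ n :> R.
    by rewrite exprD ler_piMr ?(ltW (e16 _))// exprn_ile1// ?invr_ge0// invf_le1// ler1n.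
  rewrite (lin2 1 u _ w F)//.
  move: du dw; rewrite !distE//; last exact: sqfield_lincomb.
  rewrite inner_lincombr// (lin2 _ u _ w F)//.
  by move: (e16 n); nra.
have [P PP] : {P : 'I_N -> T -> R & forall j, sqint mu D (P j) /\
    forall n, \int[mu]_(x in D) (v n j x - P j x) ^+ 2 <= 16^-1 ^+ n}.
  apply: (@choice _ _ (fun j g => sqint mu D g /\
    forall n, \int[mu]_(x in D) (v n j x - g x) ^+ 2 <= 16^-1 ^+ n)) => j.
  have [g sg gP] := sqint_complete mD (fun n => sv n j) (fun n k => cauchy n k j).
  by exists g.
have sP : sqfield P by move=> j; exact: (PP j).1.
have z16 : (16^-1 ^+ n : R) @[n --> \oo] --> (0 : R).
  by apply: cvg_expr; rewrite ger0_norm ?invr_ge0// invf_lt1// ltr1n.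
have cvgP j : \int[mu]_(x in D) (v n j x - P j x) ^+ 2 @[n --> \oo] --> 0.
  apply: (@squeeze_cvgr _ _ _ _ (cst 0) (fun n => 16^-1 ^+ n)) => //.
    apply: nearW => n; rewrite (PP j).2 andbT.
    by apply: Rintegral_ge0 => x _; rewrite sqr_ge0.
  exact: cvg_cst.
have cvgI w : sqfield w -> inner (v n) w @[n --> \oo] --> inner P w.
  move=> sw; apply: cvg_big => [|j _]; first exact: add_continuous.
  apply: cvg_integral_mul => //.
  by apply: nearW => n; exact: sv.
exists P; split => //; first by exists v.
move=> w Vw; have sw := Vsq _ Vw; have cvgw := cvgI _ sw.
rewrite inner_lincombl// mul1r mulN1r.
set a := inner F w - inner P w; set G := inner w w.
have G0 : 0 <= G by exact: inner_ge0.
(* moving v n along w cannot decrease the distance to F by more than its defect,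
   which vanishes in the limit *)
have quad t : 0 <= - 2 * t * a + t ^+ 2 * G.
  have -> : - 2 * t * a + t ^+ 2 * G =
      - 2 * t * (inner F w - inner P w) + t ^+ 2 * G + 0 / 4.
    by rewrite mul0r addr0.
  have cs : (- 2 * t * (inner F w - inner (v n) w) + t ^+ 2 * G + 16^-1 ^+ n / 4)
      @[n --> \oo] --> - 2 * t * (inner F w - inner P w) + t ^+ 2 * G + 0 / 4.
    apply: cvgD; last exact: cvgMr_tmp.
    apply: cvgD; last exact: cvg_cst.
    by apply: cvgMl_tmp; apply: cvgB => //; exact: cvg_cst.
  rewrite -(cvg_lim _ cs)//; apply: limr_ge; first by apply/cvg_ex; eexists; exact: cs.
  apply: nearW => n.
  have := delP _ (Vlin 1 (v n) t w (Vv _) Vw).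
  have := (vP n).2; rewrite !distE//; last exact: sqfield_lincomb.
  by rewrite inner_lincombr// (lin2 _ _ _ _ F)// -/G; lra.
have := quad (a / (G + 1)).
have G1 : 0 < G + 1 by rewrite ltr_wpDl.
have -> : - 2 * (a / (G + 1)) * a + (a / (G + 1)) ^+ 2 * G =
    - (a ^+ 2 * (G + 2) / (G + 1) ^+ 2) by field; rewrite gt_eqF.
rewrite oppr_ge0 pmulr_lle0 ?invr_gt0 ?exprn_gt0// pmulr_lle0 ?ltr_wpDl//.
by move=> a0; apply/eqP; rewrite -sqrf_eq0 eq_le a0 sqr_ge0.
Qed.


End projection.

(** * Existence of the stray field *)

Section stray_field.
Variable R : realType.
Implicit Types (phi : R * R -> R) (v : 'I_2 -> R * R -> R).
Implicit Types (m : 'I_3 -> R * R -> R).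
Local Notation mu := (@lebesgue_measure R).
Local Notation mu2 := (@mu2 R).
Local Notation sqfieldT := (@sqfield _ _ R mu2 setT 2).
Local Notation innerT := (@inner _ _ R mu2 setT 2).

Lemma measurable_strip : measurable (@Omega R).
Proof.
rewrite (_ : @Omega R = setT `*` `]-1, 1[%classic); first exact: measurableX.
by apply/seteqP; split => -[x y] /=; rewrite /Omega/= in_itv/= => // -[].
Qed.

Lemma H1dot_S2_measurable m i : H1dot_S2 m -> measurable_fun (@Omega R) (m i).
Proof. by move=> [/(_ i 0)[g [[mf _] _ _]] _ _]. Qed.

Lemma limits_at_infty_sqint m (a b : 'I_3 -> R) i : a i = b i ->
  (forall j, measurable_fun (@Omega R) (m j)) -> limits_at_infty m a b ->
  sqint mu2 (@Omega R) (fun x => m i x - a i).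
Proof.
move=> ab mm lim; have mO := measurable_strip.
pose A := @Omega R `&` [set x | 0 <= x.1].
pose B := @Omega R `&` [set x | x.1 <= 0].
have mhalf (J : set R) : measurable J -> measurable [set x : R * R | J x.1].
  move=> mJ; rewrite (_ : [set x | J x.1] = J `*` setT); first exact: measurableX.
  by apply/seteqP; split => [x|x []].
have mA : measurable A.
  apply: measurableI => //; have := mhalf `[0, +oo[%classic (measurable_itv _).
  by rewrite (_ : [set x : R * R | _] = [set x | 0 <= x.1])//;
    apply/seteqP; split => x /=; rewrite in_itv/= andbT.
have mB : measurable B.
  apply: measurableI => //; have := mhalf `]-oo, 0]%classic (measurable_itv _).
  by rewrite (_ : [set x : R * R | _] = [set x | x.1 <= 0])//;
    apply/seteqP; split => x /=; rewrite in_itv/=.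
have msq (c : R) : measurable_fun (@Omega R) (fun x => ((m i x - c) ^+ 2)%:E).
  by apply/measurable_EFinP; apply: measurable_funX; exact: measurable_funB.
have sum_ge (c : 'I_3 -> R) (E : set (R * R)) : measurable E -> E `<=` @Omega R ->
    (\int[mu2]_(x in E) ((m i x - c i) ^+ 2)%:E <=
     \int[mu2]_(x in E) (\sum_(j < 3) (m j x - c j) ^+ 2)%:E)%E.
  move=> mE EO; apply: ge0_le_integral => //.
  - by move=> x _; rewrite lee_fin sqr_ge0.
  - exact: measurable_funS (msq _).
  - apply/measurable_EFinP; apply: measurable_sum => j.
    apply: measurable_funX; apply: measurable_funB => //.
    exact: measurable_funS (mm j).
  - move=> x _; rewrite lee_fin (bigD1 i)//= lerDl sumr_ge0// => j _.
    by rewrite sqr_ge0.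
split; first by apply: measurable_funB; [exact: mm|exact: measurable_cst].
have AO : A `<=` @Omega R by apply: subIsetl.
have UA : A `|` (@Omega R `\` A) = @Omega R by exact: setDUK.
have mD : measurable (@Omega R `\` A) by exact: measurableD.
rewrite -[X in integral _ X]UA ge0_integral_setU//; last 3 first.
- by rewrite UA; exact: msq.
- by move=> x _; rewrite lee_fin sqr_ge0.
- by apply/disj_setPS => x [Ax [_ nA]]; exact: nA.
move: lim; rewrite /limits_at_infty; apply: le_lt_trans; apply: leeD.
  by apply: sum_ge => // x [].
rewrite ab; apply: le_trans (sum_ge b B mB _); last by move=> x [].
apply: ge0_subset_integral => //.
- by apply: measurable_funS (msq _) => // x [].
- by move=> x _; rewrite lee_fin sqr_ge0.
- move=> x [Ox nA]; split => //=; rewrite leNgt; apply/negP => x0; apply: nA.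
  by split => //=; exact: ltW.
Qed.

Lemma X_sqint m (alpha : R) : X alpha m ->
  sqint mu2 (@Omega R) (fun x => m 0 x - cos alpha) /\ sqint mu2 (@Omega R) (m 2).
Proof.
move=> [H1m lim]; have mm i := H1dot_S2_measurable i H1m.
have e0 : m_plus alpha 0 = m_minus alpha 0 by [].
have e2 : m_plus alpha 2 = m_minus alpha 2 by [].
have h0 := limits_at_infty_sqint e0 mm lim; have h2 := limits_at_infty_sqint e2 mm lim.
have p0 : m_plus alpha 0 = cos alpha by [].
have p2 : m_plus alpha 2 = 0 by [].
split; first by rewrite p0 in h0.
by move: h2; rewrite p2; under eq_fun do rewrite subr0.
Qed.

Definition rot phi : 'I_2 -> R * R -> R :=
  fun j => if j == 0 then partial 1 phi else (fun x => - partial 0 phi x).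

Lemma sqfield_gradient phi (U : set (R * R)) : test_fun U phi ->
  sqfieldT (fun j => partial j phi).
Proof.
move=> tphi j; have [L _ bphi] := test_fun_box_supported tphi.
have [sphi _ _] := tphi.
apply: (@sqint_smooth _ _ L) => //; first exact: smooth_partial.
exact: partial_box_supported.
Qed.

Lemma sqfield_rot phi (U : set (R * R)) : test_fun U phi -> sqfieldT (rot phi).
Proof.
move=> /sqfield_gradient sg j; rewrite /rot; case: ifP => _; first exact: sg.
have := sqintZ (-1) measurableT (sg 0).
by under eq_fun do rewrite mulN1r.
Qed.

Lemma inner2E v w : sqfieldT v -> sqfieldT w ->
  innerT v w = \int[mu2]_x (v 0 x * w 0 x + v 1 x * w 1 x).
Proof.
move=> sv sw; rewrite /inner big_ord_recl big_ord1.
have -> : lift ord0 ord0 = 1 :> 'I_2 by exact: val_inj.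
have i0 := sqint_integrable_mul measurableT (sv 0) (sw 0).
have i1 := sqint_integrable_mul measurableT (sv 1) (sw 1).
by rewrite (@RintegralD _ _ _ mu2 setT _ _ measurableT i0 i1).
Qed.

Lemma curl_freeP v : sqfieldT v ->
  curl_free setT v <-> forall phi, test_fun setT phi -> innerT v (rot phi) = 0.
Proof.
move=> sv; suff E phi : test_fun setT phi -> innerT v (rot phi) =
    \int[mu2]_x (v 0 x * partial 1 phi x - v 1 x * partial 0 phi x).
  by split => h phi tphi; have := h _ tphi; rewrite E.
move=> tphi; rewrite inner2E//; last exact: sqfield_rot tphi.
by apply: eq_Rintegral => x _; rewrite /rot/= mulrN.
Qed.

Lemma integral_partial1_Omega phi : test_fun setT phi ->
  \int[mu2]_(x in @Omega R) partial 0 phi x = 0.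
Proof.
move=> tphi; have [L _ bphi] := test_fun_box_supported tphi; have [sphi _ _] := tphi.
have mI : measurable [set t : R | -1 < t < 1].
  rewrite (_ : [set t : R | -1 < t < 1] = `]-1, 1[%classic); first exact: measurable_itv.
  by apply/seteqP; split => t; rewrite /= in_itv.
have := @integral_partial1_strip R phi L [set t | -1 < t < 1] mI _ _ bphi.
apply.
- by move=> x; exact: smooth_derivable.
- by apply: smooth_continuous; exact: smooth_partial.
Qed.

(** The stray field is minus the projection, onto the curl-free square-integrable
    fields, of (m' - cos alpha e_1) 1_Omega: subtracting the constant field, which
    is divergence-free in the strip, makes the source square-integrable. *)
Lemma stray_fieldP m (alpha : R) : X alpha m -> is_stray_field m (stray_field m).
Proof.
move=> [H1m lim]; rewrite /stray_field.
apply: (@xgetPex _ (fun _ _ => 0) [set h | is_stray_field m h]).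
have mO := measurable_strip; have mm i := H1dot_S2_measurable i H1m.
pose c (j : 'I_2) : R := if j == 0 then cos alpha else 0.
pose F (j : 'I_2) : R * R -> R := (fun x => prime_part m j x - c j) \_ (@Omega R).
have sF : sqfieldT F.
  move=> j; have [mf fi] : sqint mu2 (@Omega R) (fun x => prime_part m j x - c j).
    have [s0 s2] := X_sqint (conj H1m lim).
    rewrite /prime_part /c; case: ifP => _ //.
    by under eq_fun do rewrite subr0.
  split; first by apply/(measurable_restrictT _ mO).
  move: fi; rewrite integral_mkcond; apply: le_lt_trans.
  rewrite le_eqVlt; apply/orP; left; apply/eqP; apply: eq_integral => x _.
  by rewrite /F /patch; case: ifP => _ //; rewrite expr0n.
pose V := [set v | sqfieldT v /\ curl_free setT v].
have Vlin a u b w : V u -> V w -> V (lincomb a u b w).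
  move=> [su cu] [sw cw]; have sl := sqfield_lincomb measurableT a b su sw.
  split => //; apply/curl_freeP => // phi tphi.
  rewrite inner_lincombl//; last exact: sqfield_rot tphi.
  rewrite ((curl_freeP su).1 cu _ tphi) ((curl_freeP sw).1 cw _ tphi).
  by rewrite !mulr0 addr0.
have V0 : V (fun _ _ => 0).
  split => [j|phi _].
    split; first exact: measurable_cst.
    by rewrite integral0_eq ?ltry// => x _; rewrite expr0n.
  by rewrite /Rintegral integral0_eq// => x _; rewrite !mul0r subrr.
have VsubF : V `<=` sqfieldT by move=> u [].
have [P [sP [v [Vv vP]] orth]] :=
  @projection _ _ R mu2 setT measurableT 2 V F V0 Vlin VsubF sF.
have VP : V P.
  split => //; apply/curl_freeP => // phi tphi.
  have h := vP _ (sqfield_rot tphi).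
  rewrite -(cvg_lim _ h)// (_ : (fun n => _) = cst 0) ?lim_cst//.
  by apply/funext => n; rewrite ((curl_freeP (Vv n).1).1 (Vv n).2 _ tphi).
pose h := lincomb 0 P (- 1) P.
have [sh ch] : V h by exact: Vlin.
exists h; split => //.
move=> phi tphi; have sg := sqfield_gradient tphi.
have [L _ bphi] := test_fun_box_supported tphi; have [sphi _ _] := tphi.
have sl : sqfieldT (lincomb 1 F (- 1) P) by exact: sqfield_lincomb.
have := orth (fun j => partial j phi) (conj sg (curl_free_gradient tphi)).
rewrite inner2E// => orth0.
have i0 := sqint_integrable_mul measurableT (sl 0) (sg 0).
have i1 := sqint_integrable_mul measurableT (sl 1) (sg 1).
have i01 := integrableD measurableT i0 i1.
have strip0 := integral_partial1_Omega tphi.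
have iS1 : mu2.-integrable setT (EFin \o (partial 0 phi \_ (@Omega R))).
  rewrite -restrict_EFin; apply: (@integrable_mkcond _ _ _ mu2 _ _ mO).1.
  apply: (integrable_smooth (L := L)) => //; first exact: smooth_partial.
  exact: partial_box_supported.
have iS : mu2.-integrable setT (fun x => (cos alpha * (partial 0 phi \_ (@Omega R)) x)%:E).
  exact: (@integrableZl _ _ _ mu2 _ measurableT (cos alpha) _ iS1).
transitivity (\int[mu2]_x ((lincomb 1 F (- 1) P 0 x * partial 0 phi x +
    lincomb 1 F (- 1) P 1 x * partial 1 phi x) +
    cos alpha * (partial 0 phi \_ (@Omega R)) x)).
  have c0 : c 0 = cos alpha by []. have c1 : c 1 = 0 by [].
  apply: eq_Rintegral => x _; rewrite /h /lincomb /F c0 c1 /patch; cbv beta.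
  move: (partial 0 phi x) (partial 1 phi x) (P 0 x) (P 1 x) (prime_part m 0 x).
  move: (prime_part m 1 x) => a1 p0 p1 q0 q1 a0.
  have z0 : (point : R) = 0 by [].
  by case: ifP => _; rewrite ?z0; ring.
rewrite (@RintegralD _ _ _ mu2 setT _ _ measurableT i01 iS) orth0 add0r.
rewrite (@RintegralZl _ _ _ mu2 _ _ _ measurableT iS1).
by rewrite -Rintegral_mkcond strip0 mulr0.
Qed.

End stray_field.

(** * Smooth cutoffs *)

Section cutoffs.
Variable R : realType.
Implicit Types (a b k t : R).

(** A smooth transition from 1 on t <= 0 to 0 on t >= 2: there e^(-1/t) exceeds
    1/2, so that the argument of the outer function is negative. *)
Definition step_down t : R := expR 1 * flat_exp 0 (1 - 2 * flat_exp 0 t).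

Definition step_down' t : R :=
  - (2 * expR 1 * flat_exp 2 (1 - 2 * flat_exp 0 t) * flat_exp 2 t).

Lemma is_derive_flat_exp0 t : is_derive t 1 (flat_exp 0) (flat_exp 2 t : R).
Proof.
by have := is_derive_flat_exp 0 t; rewrite oppr0 mul0r add0r.
Qed.

Lemma is_derive_step_down t : is_derive t 1 step_down (step_down' t).
Proof.
have d1 : is_derive t 1 (fun t => 1 - 2 * flat_exp 0 t) (- (2 * flat_exp 2 t)).
  have d0 := is_deriveM (is_derive_cst (2 : R) t 1) (is_derive_flat_exp0 t).
  have := is_deriveB (is_derive_cst (1 : R) t 1) d0.
  by move=> dd; apply: (is_derive_eq dd); rewrite /GRing.scale/= mulr0 addr0 sub0r.
have d2 := @is_derive1_comp _ _ _ _ _ _ (is_derive_flat_exp0 _) d1.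
have := is_deriveM (is_derive_cst (expR 1 : R) t 1) d2.
by move=> dd; apply: (is_derive_eq dd); rewrite /GRing.scale/= mulr0 addr0 /step_down'; ring.
Qed.

Lemma cinf_step_down : cinf step_down.
Proof.
apply: (cinf_mul (cinf_cst _)); apply: (cinf_comp (cinf_flat_exp _ _)).
apply: (cinf_add (cinf_cst _)).
have := cinf_mul (cinf_cst (- 2)) (cinf_flat_exp R 0).
by under eq_fun do rewrite mulNr.
Qed.

Lemma cinf_step_down' : cinf step_down'.
Proof.
have c2 : cinf (fun t => flat_exp 2 (1 - 2 * flat_exp 0 t) : R).
  apply: (cinf_comp (cinf_flat_exp _ _)); apply: (cinf_add (cinf_cst _)).
  have := cinf_mul (cinf_cst (- 2)) (cinf_flat_exp R 0).
  by under eq_fun do rewrite mulNr.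
have := cinf_mul (cinf_mul (cinf_cst (- (2 * expR 1))) c2) (cinf_flat_exp R 2).
by under eq_fun do rewrite !mulNr.
Qed.

Lemma step_down1 t : t <= 0 -> step_down t = 1.
Proof.
move=> t0; rewrite /step_down (flat_exp0 _ t0) mulr0 subr0 flat_expE// expr0 mulr1.
by rewrite invr1 -expRD subrr expR0.
Qed.

Lemma flat_exp_2_ge t : 2 <= t -> 1 <= 2 * flat_exp 0 t.
Proof.
move=> t2; rewrite flat_expE ?expr0 ?mulr1; last by lra.
have := expR_ge1Dx (- t^-1).
have : t^-1 <= 2^-1 by rewrite lef_pV2// posrE; lra.
lra.
Qed.

Lemma step_down0 t : 2 <= t -> step_down t = 0.
Proof.
by move=> /flat_exp_2_ge h; rewrite /step_down flat_exp0 ?mulr0// subr_le0.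
Qed.

Lemma step_down_ge0 t : 0 <= step_down t.
Proof. by rewrite mulr_ge0 ?expR_ge0 ?flat_exp_ge0. Qed.

Lemma step_down_le1 t : step_down t <= 1.
Proof.
rewrite /step_down; set s := 1 - _.
have s1 : s <= 1 by rewrite /s lerBlDr lerDl mulr_ge0 ?flat_exp_ge0.
have [s0|s0] := leP s 0; first by rewrite flat_exp0// mulr0.
rewrite flat_expE// expr0 mulr1 -expRD -[leRHS]expR0 ler_expR subr_le0.
by rewrite invf_ge1.
Qed.

Lemma step_down'0 t : t <= 0 \/ 2 <= t -> step_down' t = 0.
Proof.
move=> [t0|/flat_exp_2_ge h]; first by rewrite /step_down' (@flat_exp0 _ 2 t t0) mulr0 oppr0.
by rewrite /step_down' (@flat_exp0 _ 2 (1 - _)) ?mulr0 ?mul0r ?oppr0// subr_le0.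
Qed.

(** A bound for the derivative of step_down; each factor flat_exp 2 is at most 2. *)
Definition slope : R := 8 * expR 1.

Lemma step_down'_le t : `|step_down' t| <= slope.
Proof.
rewrite /step_down' normrN ger0_norm; last by rewrite !mulr_ge0 ?flat_exp_ge0 ?expR_ge0.
have h s : flat_exp 2 s <= 2 :> R by apply: le_trans (flat_exp_le _ _) _; rewrite lexx.
apply: (@le_trans _ _ (2 * expR 1 * 2 * 2)); last by rewrite /slope; lra.
have p0 s : 0 <= flat_exp 2 s :> R by exact: flat_exp_ge0.
have e0 : 0 < expR 1 :> R by exact: expR_gt0.
apply: ler_pM => //; first by rewrite !mulr_ge0// ltW.
by rewrite ler_wpM2l// mulr_ge0// ltW.
Qed.

(** Equal to 1 on [a, b], with two flanks of width 2 / k. *)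
Definition plateau a b k t := step_down (k * (t - b)) * step_down (k * (a - t)).

Definition plateau' a b k t := k * step_down' (k * (t - b)) - k * step_down' (k * (a - t)).

Lemma is_derive_affine c k t : is_derive t 1 (fun s => k * (s - c)) k.
Proof.
have := is_deriveM (is_derive_cst (k : R) t 1)
  (is_deriveB (is_derive_id t 1) (is_derive_cst (c : R) t 1)).
by move=> dd; apply: (is_derive_eq dd); rewrite /GRing.scale/= subr0 mulr0 addr0 mulr1.
Qed.

Lemma is_derive_plateau a b k t : a <= b -> 0 < k ->
  is_derive t 1 (plateau a b k) (plateau' a b k t).
Proof.
move=> ab k0.
have d1 := @is_derive1_comp _ step_down _ t _ _ (is_derive_step_down _) (is_derive_affine b k t).
have d2 := @is_derive1_comp _ step_down _ t _ _ (is_derive_step_down _) (is_derive_affine a (- k) t).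
have := is_deriveM d1 d2.
have -> : (step_down \o (fun s => k * (s - b)) : R -> R) *
    (step_down \o (fun s => - k * (s - a))) = plateau a b k.
  by apply/funext => s; rewrite mulrfctE /plateau/=; congr (_ * step_down _); ring.
move=> dd; apply: (is_derive_eq dd); rewrite /GRing.scale/= /plateau'.
have -> : - k * (t - a) = k * (a - t) by ring.
have [tb|tb] := leP t b.
  have h : k * (t - b) <= 0 by rewrite pmulr_rle0// subr_le0.
  by rewrite (step_down1 h) (step_down'0 (or_introl h)); ring.
have h : k * (a - t) <= 0 by rewrite pmulr_rle0// subr_le0; lra.
by rewrite (step_down1 h) (step_down'0 (or_introl h)); ring.
Qed.

Lemma cinf_affine c k : cinf (fun s : R => k * (s - c)).
Proof. by apply: (cinf_mul (cinf_cst _)); exact: (cinf_add (cinf_id _) (cinf_cst _)). Qed.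

Lemma cinf_plateau a b k : cinf (plateau a b k).
Proof.
apply: cinf_mul; first exact: (cinf_comp cinf_step_down (cinf_affine _ _)).
have := cinf_comp cinf_step_down (cinf_affine a (- k)).
by congr cinf; apply/funext => s; congr step_down; ring.
Qed.

Lemma cinf_plateau' a b k : cinf (plateau' a b k).
Proof.
have c1 := cinf_mul (cinf_cst k) (cinf_comp cinf_step_down' (cinf_affine b k)).
have c2 := cinf_mul (cinf_cst (- k)) (cinf_comp cinf_step_down' (cinf_affine a (- k))).
have := cinf_add c1 c2; congr cinf; apply/funext => s; rewrite /plateau' mulNr.
by congr (_ - _ * step_down' _); ring.
Qed.

Lemma plateau_ge0 a b k t : 0 <= plateau a b k t.
Proof. by rewrite mulr_ge0 ?step_down_ge0. Qed.

Lemma plateau_le1 a b k t : plateau a b k t <= 1.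
Proof. by rewrite mulr_ile1 ?step_down_ge0 ?step_down_le1. Qed.

Lemma plateau1 a b k t : 0 < k -> a <= t <= b -> plateau a b k t = 1.
Proof.
move=> k0 /andP[at_ tb]; rewrite /plateau !step_down1 ?mulr1//.
  by rewrite pmulr_rle0// subr_le0.
by rewrite pmulr_rle0// subr_le0.
Qed.

Lemma plateau0 a b k t : 0 < k -> ~ (a - 2 / k <= t <= b + 2 / k) -> plateau a b k t = 0.
Proof.
move=> k0 /negP; rewrite negb_and -!ltNge => /orP[h|h]; rewrite /plateau.
  by rewrite (@step_down0 (_ * (a - t))) ?mulr0// mulrC -ler_pdivrMr//; lra.
by rewrite step_down0 ?mul0r// mulrC -ler_pdivrMr//; lra.
Qed.

Lemma plateau'0 a b k t : 0 < k ->
  (a <= t <= b) \/ ~ (a - 2 / k <= t <= b + 2 / k) -> a <= b -> plateau' a b k t = 0.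
Proof.
move=> k0 h ab; rewrite /plateau' !step_down'0 ?mulr0 ?subrr//.
- have [ta|ta] := leP a t; first by left; rewrite pmulr_rle0// subr_le0.
  right; case: h => [|/negP]; first by lra.
  rewrite negb_and -!ltNge => /orP[h|h]; first by rewrite mulrC -ler_pdivrMr//; lra.
  have : 0 < 2 / k by rewrite divr_gt0.
  by move=> ?; lra.
- have [ta|ta] := leP t b; first by left; rewrite pmulr_rle0// subr_le0.
  right; case: h => [|/negP]; first by lra.
  rewrite negb_and -!ltNge => /orP[h|h]; last by rewrite mulrC -ler_pdivrMr//; lra.
  have : 0 < 2 / k by rewrite divr_gt0.
  by move=> ?; lra.
Qed.

Lemma plateau'_le a b k t : 0 < k -> a <= b -> `|plateau' a b k t| <= slope * k.
Proof.
move=> k0 ab; rewrite /plateau'.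
have s0 : 0 <= slope by rewrite /slope mulr_ge0 ?expR_ge0.
have [tb|tb] := leP t b.
  rewrite (@step_down'0 (k * (t - b))); last by left; rewrite pmulr_rle0// subr_le0.
  by rewrite mulr0 sub0r normrN normrM gtr0_norm// mulrC ler_wpM2r ?step_down'_le// ltW.
rewrite (@step_down'0 (k * (a - t))); last by left; rewrite pmulr_rle0// subr_le0; lra.
by rewrite mulr0 subr0 normrM gtr0_norm// mulrC ler_wpM2r ?step_down'_le// ltW.
Qed.

Lemma test_fun_support (U K : set (R * R)) (phi : R * R -> R) : smooth phi ->
  compact K -> K `<=` U -> (forall x, ~ K x -> phi x = 0) -> test_fun U phi.
Proof.
move=> sphi cK KU K0.
have clK : closed K by apply: compact_closed => //; exact: norm_hausdorff.
have sub : closure [set x | phi x != 0] `<=` K.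
  rewrite [X in _ `<=` X](closure_id K).1//; apply: closureS => x /= px.
  by apply: contrapT => /K0 e; rewrite e eqxx in px.
split => //; last exact: subset_trans sub KU.
by apply: subclosed_compact cK sub; exact: closed_closure.
Qed.

End cutoffs.
Arguments slope {R}.

(** * Vertical slices of the strip *)

Section slices.
Variable R : realType.
Implicit Types (g : R -> R) (m : 'I_3 -> R * R -> R) (s t : R).
Local Notation mu := (@lebesgue_measure R).
Local Notation mu2 := (@mu2 R).

Lemma measurable_fun_fst_comp g : measurable_fun setT g ->
  measurable_fun setT (fun x : R * R => g x.1).
Proof. by move=> mg; apply: (@measurableT_comp _ _ _ _ _ _ g). Qed.

Lemma mu_unit_interval : mu `]-1, 1[%classic = 2%:E.
Proof.
rewrite lebesgue_measure_itv/= lte_fin ifT; last by lra.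
by congr EFin; lra.
Qed.

(** By Tonelli's theorem, since the vertical slices of the strip have length 2. *)
Lemma integrable_strip_mul g (f : R * R -> R) (C : R) :
  mu.-integrable setT (fun t => (g t)%:E) -> measurable_fun setT f ->
  (forall x, `|f x| <= C) -> (forall x, ~ @Omega R x -> f x = 0) ->
  mu2.-integrable setT (fun x => (f x * g x.1)%:E).
Proof.
move=> ig mf fC f0.
have mg : measurable_fun setT g by apply/measurable_EFinP; exact: measurable_int ig.
have mfg : measurable_fun setT (fun x : R * R => (f x * g x.1)%:E).
  by apply/measurable_EFinP; apply: measurable_funM => //; exact: measurable_fun_fst_comp.
apply: (@integrable12ltyP _ _ _ _ R mu mu _ mfg).2.
have C0 : 0 <= C by apply: le_trans (fC (0, 0)); exact: normr_ge0.
have mg2 : measurable_fun setT (fun t => (2 * C * `|g t|)%:E).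
  apply/measurable_EFinP; apply: measurable_funM => //.
  exact: measurableT_comp.
apply: (@le_lt_trans _ _ (\int[mu]_t (2 * C * `|g t|)%:E)%E); last first.
  have := integrable_lty measurableT (integrableZl measurableT (2 * C) (integrable_norm ig)).
  by [].
apply: ge0_le_integral => //.
- by move=> t _; exact: integral_ge0.
- apply: (@measurable_fun_fubini_tonelli_F _ _ _ _ _ mu
    (fun x => `|(f x * g x.1)%:E|)%E); first exact: measurableT_comp.
  by move=> x.
move=> t _.
have f0t s : ~ (`]-1, 1[%classic s) -> f (t, s) = 0.
  by move=> ns; apply: f0 => Ox; apply: ns; rewrite /= in_itv.
rewrite (_ : (\int[mu]_s `|(f (t, s) * g t)%:E|)%E =
    (\int[mu]_(s in `](-1)%R, 1%R[) `|(f (t, s) * g t)%:E|)%E); last first.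
  rewrite [RHS]integral_mkcond; apply: eq_integral => s _; rewrite /patch.
  by case: ifPn => // /negP; rewrite inE => /f0t ->; rewrite mul0r abse0.
apply: le_trans (@integral_le_bound _ _ _ mu _ _ (C * `|g t|)%:E _ _ _ _) _ => //.
- apply/measurable_EFinP; apply: measurable_funTS; apply: measurable_funM => //.
  exact: measurable_fun_pair2.
- by rewrite lee_fin mulr_ge0.
- by apply: aeW => s _; rewrite /= lee_fin normrM ler_wpM2r.
set M := (X in (_ * X)%E); have -> : M = 2%:E by exact: mu_unit_interval.
by rewrite -EFinM lee_fin; lra.
Qed.

(** The truncation is harmless almost everywhere, and makes every vertical slice
    integrable, so that slice_integral below is a bounded function on the line. *)
Definition strip_clip m : R * R -> R :=
  (fun x => Num.max (- 1) (Num.min 1 (m 0 x))) \_ (@Omega R).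

Definition slice_integral m t : R :=
  \int[mu]_(s in `]-1, 1[) strip_clip m (t, s).

Lemma measurable_strip_clip m : H1dot_S2 m -> measurable_fun setT (strip_clip m).
Proof.
move=> /(H1dot_S2_measurable 0) mm.
have mO := @measurable_strip R; apply/(measurable_restrictT _ mO).
by apply: measurable_maxr => //; exact: measurable_minr.
Qed.

Lemma strip_clip_le1 m x : `|strip_clip m x| <= 1.
Proof.
rewrite /strip_clip /patch; case: ifP => _; last by rewrite normr0.
rewrite ler_norml ge_max le_max lexx/= ge_min lexx/= andbT; lra.
Qed.

Lemma strip_clip0 m x : ~ @Omega R x -> strip_clip m x = 0.
Proof. by move=> nx; rewrite /strip_clip /patch memNset. Qed.

Lemma ae_plane_mono (P Q : R * R -> Prop) : (forall x, P x -> Q x) ->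
  {ae mu2, forall x, P x} -> {ae mu2, forall x, Q x}.
Proof.
move=> PQ [N [mN N0 sub]]; exists N; split => //; apply: subset_trans sub.
by move=> x nQ Px; apply: nQ; exact: PQ.
Qed.

Lemma ae_H1dot_S2_le1 m : H1dot_S2 m ->
  {ae mu2, forall x, @Omega R x -> forall i, `|m i x| <= 1}.
Proof.
move=> [_ + _]; apply: ae_plane_mono => x h Ox i.
rewrite -[leRHS]ger0_norm// -(@ler_pXn2r _ 2)// ?nnegrE// !real_normK ?num_real//.
by rewrite expr1n -(h Ox) (bigD1 i)//= lerDl sumr_ge0// => j _; exact: sqr_ge0.
Qed.

Lemma ae_strip_clip m : H1dot_S2 m ->
  {ae mu2, forall x, @Omega R x -> strip_clip m x = m 0 x}.
Proof.
move=> /ae_H1dot_S2_le1; apply: ae_plane_mono => x h Ox; have := h Ox 0.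
rewrite /strip_clip /patch mem_set// ler_norml => /andP[h1 h2].
by rewrite (min_idPr h2) (max_idPr h1).
Qed.

Lemma measurable_unit_interval : measurable (`](-1)%R, 1%R[%classic : set R).
Proof. exact: measurable_itv. Qed.

Lemma mu_unit_interval_lty : (mu `](-1)%R, 1%R[%classic < +oo)%E.
Proof. by rewrite mu_unit_interval ltry. Qed.

Lemma integrable_strip_clip_slice m t : H1dot_S2 m ->
  mu.-integrable `](-1)%R, 1%R[%classic (fun s => (strip_clip m (t, s))%:E).
Proof.
move=> H1m; apply: (@bounded_integrable _ _ _ mu _ _ 1 measurable_unit_interval) => //.
- exact: mu_unit_interval_lty.
- apply: measurable_funTS; exact: (measurable_fun_pair2 _ (measurable_strip_clip H1m)).
- by move=> s _; exact: strip_clip_le1.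
Qed.

Lemma slice_integral_le2 m t : H1dot_S2 m -> `|slice_integral m t| <= 2.
Proof.
move=> H1m; have iS := integrable_strip_clip_slice t H1m.
have h := @le_normr_Rintegral _ _ _ mu _ _ measurable_unit_interval iS.
apply: (le_trans h).
apply: (@le_trans _ _ (\int[mu]_(s in `](-1)%R, 1%R[) 1)).
  apply: le_Rintegral => //.
  - exact: integrable_norm.
  - apply: (@bounded_integrable _ _ _ mu _ _ 1 measurable_unit_interval) => //.
      exact: mu_unit_interval_lty.
    by move=> s _; rewrite normr1.
  - by move=> s _; exact: strip_clip_le1.
rewrite Rintegral_cst// mul1r.
by set M := (X in fine X); have -> : M = 2%:E by exact: mu_unit_interval.
Qed.

Lemma measurable_slice_integral m : H1dot_S2 m -> measurable_fun setT (slice_integral m).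
Proof.
move=> H1m; have mO := @measurable_strip R.
(* Tonelli's theorem wants a nonnegative function *)
pose q x := strip_clip m x + \1_(@Omega R) x.
have mq : measurable_fun setT q.
  apply: measurable_funD; first exact: measurable_strip_clip.
  exact: measurable_indic.
have q0 x : (0 <= (q x)%:E)%E.
  rewrite lee_fin /q indicE; have [Ox|Ox] := pselect (@Omega R x).
    rewrite mem_set//; have := strip_clip_le1 m x; rewrite ler_norml => /andP[].
    by rewrite -lerBlDr sub0r.
  by rewrite strip_clip0// memNset// addr0.
have mF := @measurable_fun_fubini_tonelli_F _ _ _ _ R mu (EFin \o q)
  ((@measurable_EFinP _ _ _ _ q).2 mq) q0.
suff -> : slice_integral m = (fun t => fine (\int[mu]_s (q (t, s))%:E)%E - 2).
  by apply: measurable_funB => //; exact: measurableT_comp mF.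
apply/funext => t.
have i1 : mu.-integrable `](-1)%R, 1%R[%classic (fun s : R => 1%:E).
  apply: (@bounded_integrable _ _ _ mu _ _ 1 measurable_unit_interval) => //.
    exact: mu_unit_interval_lty.
  by move=> s _; rewrite normr1.
have -> : (\int[mu]_s (q (t, s))%:E)%E =
    (\int[mu]_(s in `](-1)%R, 1%R[) ((strip_clip m (t, s))%:E + 1%:E))%E.
  rewrite [RHS]integral_mkcond; apply: eq_integral => s _; rewrite /patch /q indicE.
  have [Is|Is] := pselect (`](-1)%R, 1%R[%classic s).
    by rewrite (mem_set Is) mem_set//; move: Is; rewrite /= in_itv.
  have nO : ~ @Omega R (t, s) by move=> Ox; apply: Is; rewrite /= in_itv.
  by rewrite (memNset Is) memNset// strip_clip0// addr0.
rewrite integralD//; last exact: integrable_strip_clip_slice.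
rewrite fineD; [|exact: integrable_fin_num (integrable_strip_clip_slice t H1m)|
  exact: integrable_fin_num i1].
rewrite (_ : fine (\int[mu]_(s in `](-1)%R, 1%R[) 1%:E)%E = 2).
  by rewrite -addrA subrr addr0.
rewrite integral_cst// mul1e.
by set M := (X in fine X); have -> : M = 2%:E by exact: mu_unit_interval.
Qed.

Lemma ae_slice_integral m : H1dot_S2 m ->
  {ae mu, forall t, \int[mu]_(s in `](-1)%R, 1%R[) m 0 (t, s) = slice_integral m t}.
Proof.
move=> H1m; have [N [mN N0 subN]] := ae_strip_clip H1m.
have mO := @measurable_strip R; have mm := H1dot_S2_measurable 0 H1m.
have mX : measurable_fun setT (fun t => mu (xsection N t)).
  exact: measurable_fun_xsection.
have : (\int[mu]_t `|mu (xsection N t)| = 0)%E.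
  by under eq_integral do rewrite gee0_abs//.
move=> /(@ae_eq_integral_abs _ _ _ mu _ measurableT _ mX).
apply: filterS => t /(_ I)/= N0t; rewrite /slice_integral /Rintegral; congr fine.
have mrestr : measurable_fun setT (m 0 \_ (@Omega R)).
  by apply/(measurable_restrictT _ mO).
apply: (@ae_eq_integral _ _ _ mu _ _ _ measurable_unit_interval).
- apply/measurable_EFinP.
  apply: (@eq_measurable_fun _ _ _ _ _ (fun s => (m 0 \_ (@Omega R)) (t, s))).
    move=> s; rewrite inE/= in_itv/= => Is.
    by rewrite /patch (@mem_set _ (@Omega R) (t, s) Is).
  by apply: measurable_funTS; exact: (measurable_fun_pair2 _ mrestr).
- apply/measurable_EFinP; apply: measurable_funTS.
  exact: (measurable_fun_pair2 _ (measurable_strip_clip H1m)).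
- exists (xsection N t); split => //; first exact: measurable_xsection.
  move=> s /= ns; apply/xsectionP; apply: subN => /= h; apply: ns => Is.
  by rewrite h//; move: Is; rewrite /= in_itv.
Qed.

(** Fubini's theorem on the strip; m_1 is first replaced by its clipping to
    [-1, 1], which is bounded everywhere and not only almost everywhere. *)
Lemma integral_slice m g : H1dot_S2 m -> mu.-integrable setT (fun t => (g t)%:E) ->
  mu2.-integrable (@Omega R) (fun x => (m 0 x * g x.1)%:E) /\
  \int[mu2]_(x in @Omega R) (m 0 x * g x.1) = \int[mu]_t (slice_integral m t * g t).
Proof.
move=> H1m ig; have mO := @measurable_strip R.
have mm := H1dot_S2_measurable 0 H1m; have mc := measurable_strip_clip H1m.
have mg : measurable_fun setT g by apply/measurable_EFinP; exact: measurable_int ig.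
have iT := integrable_strip_mul ig mc (strip_clip_le1 m) (@strip_clip0 m).
have iO := @integrableS _ _ _ mu2 _ _ _ measurableT mO (@subsetT _ _) iT.
have mmg : measurable_fun (@Omega R) (fun x => (m 0 x * g x.1)%:E).
  apply/measurable_EFinP; apply: measurable_funM => //.
  by apply: measurable_funTS; exact: measurable_fun_fst_comp.
have mcg : measurable_fun (@Omega R) (fun x => (strip_clip m x * g x.1)%:E).
  exact: measurable_int iO.
have aeq : ae_eq mu2 (@Omega R) (fun x => (m 0 x * g x.1)%:E)
    (fun x => (strip_clip m x * g x.1)%:E).
  by have := ae_strip_clip H1m; apply: ae_plane_mono => x h Ox; rewrite h.
split.
  apply/integrableP; split => //; move/integrableP : iO => [_]; congr (_ < _)%E.
  apply: (@ae_eq_integral _ _ _ mu2 _ _ _ mO); [exact: measurableT_comp..|].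
  by move: aeq; apply: ae_plane_mono => x h Ox; rewrite h.
transitivity (\int[mu2]_x (strip_clip m x * g x.1)).
  rewrite /Rintegral; congr fine.
  rewrite (@ae_eq_integral _ _ _ mu2 _ _ _ mO mmg mcg aeq) integral_mkcond.
  apply: eq_integral => x _; rewrite /patch; case: ifPn => // /negP.
  by rewrite inE => nO; rewrite strip_clip0// mul0r.
rewrite /Rintegral -(@integral12_prod_meas1 _ _ _ _ R mu mu _ iT); congr fine.
apply: eq_integral => t _; rewrite /fubini_F/=.
have iS := integrable_strip_clip_slice t H1m.
transitivity (\int[mu]_(s in `](-1)%R, 1%R[) (strip_clip m (t, s) * g t)%:E)%E.
  rewrite [RHS]integral_mkcond; apply: eq_integral => s _; rewrite /patch.
  case: ifPn => // /negP ns; rewrite strip_clip0 ?mul0r// => Ox; apply: ns.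
  by rewrite inE/= in_itv.
under eq_integral do rewrite EFinM.
rewrite (@integralZr _ _ _ mu _ measurable_unit_interval _ iS) EFinM.
by rewrite /slice_integral /Rintegral fineK//; exact: integrable_fin_num iS.
Qed.

End slices.

(** * Weak derivatives and vertical integration *)

Section vertical_flux.
Variable R : realType.
Implicit Types (g zeta : R -> R) (m : 'I_3 -> R * R -> R) (psi : R * R -> R) (s t L : R).
Local Notation mu := (@lebesgue_measure R).
Local Notation mu2 := (@mu2 R).

Lemma sqint_strip_compact g L : continuous g ->
  (forall t, ~ (- L <= t <= L) -> g t = 0) -> sqint mu2 (@Omega R) (fun x => g x.1).
Proof.
move=> cg g0; have mO := @measurable_strip R.
have cp : continuous (fun x : R * R => g x.1 * plateau (-1) 1 1 x.2).
  apply: continuous_plane_mul => x.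
    by apply: (@continuous_comp _ _ _ fst g); [exact: cvg_fst|exact: cg].
  apply: (@continuous_comp _ _ _ snd (plateau (-1) 1 1)); first exact: cvg_snd.
  exact: (cinf_continuous (cinf_plateau _ _ _)).
pose L' := Num.max L 3.
have bp : box_supported L' (fun x : R * R => g x.1 * plateau (-1) 1 1 x.2).
  move=> [s t] nb; have [hs|hs] := pselect (- L <= s <= L); last by rewrite /= g0// mul0r.
  rewrite /= plateau0 ?mulr0// divr1 => ht; apply: nb.
  have h1 : L <= L' by rewrite le_max lexx.
  have h2 : 3 <= L' by rewrite le_max lexx orbT.
  by split => /=; rewrite in_itv/=; apply/andP; split; lra.
have [M M0 FM] := compact_support_bounded cp bp.
have sp := @sqint_box_supported _ (@Omega R) _ L' M mO
   (measurable_funTS (continuous_measurable_plane cp)) bp FM.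
apply: (@le_sqint _ _ _ mu2 _ _ (fun x => g x.1 * plateau (-1) 1 1 x.2) mO) => //.
  apply: measurable_funTS; apply: measurable_fun_fst_comp.
  exact: continuous_measurable_fun.
by move=> [s t] /andP[/= h1 h2]; rewrite plateau1 ?mulr1// !ltW.
Qed.

Lemma integrable_compact g L : continuous g ->
  (forall t, ~ (- L <= t <= L) -> g t = 0) -> mu.-integrable setT (fun t => (g t)%:E).
Proof.
move=> cg g0.
have i1 : mu.-integrable `[(- L)%R, L%R]%classic (fun t => (g t)%:E).
  apply: continuous_compact_integrable; first exact: segment_compact.
  exact: continuous_subspaceT.
have := (@integrable_mkcond _ _ _ mu _ (fun t => (g t)%:E) (measurable_itv `[(- L)%R, L%R])).1 i1.
apply: eq_integrable => // t _; rewrite /patch; case: ifPn => // /negP.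
by rewrite inE/= in_itv/= => /g0 ->.
Qed.

Lemma weak_partial_sqint m i j : H1dot_S2 m ->
  is_weak_partial (@Omega R) j (m i) (weak_partial j (m i)) /\
  sqint mu2 (@Omega R) (weak_partial j (m i)).
Proof.
move=> [ex _ dir]; have mO := @measurable_strip R.
have wp a b : is_weak_partial (@Omega R) b (m a) (weak_partial b (m a)).
  by apply: (@xgetPex _ (fun=> 0) [set g | is_weak_partial (@Omega R) b (m a) g]); exact: ex.
have mwp a b : measurable_fun (@Omega R) (weak_partial b (m a)).
  by have [_ []] := wp a b.
split; first exact: wp.
split; first exact: mwp.
apply: le_lt_trans dir; apply: ge0_le_integral => //.
- by move=> x _; rewrite lee_fin sqr_ge0.
- by apply/measurable_EFinP; apply: measurable_funX; exact: mwp.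
- apply/measurable_EFinP; apply: measurable_sum => a; apply: measurable_sum => b.
  by apply: measurable_funX; exact: mwp.
- move=> x _; rewrite lee_fin /sq_grad (bigD1 i)//= (bigD1 j)//= -addrA lerDl.
  by rewrite addr_ge0// sumr_ge0// => a _; [exact: sqr_ge0|
    apply: sumr_ge0 => b _; exact: sqr_ge0].
Qed.

Lemma strip_bounded_mul m i (c : R) (f : R * R -> R) : H1dot_S2 m -> `|c| <= 1 ->
  mu2.-integrable (@Omega R) (fun x => (f x)%:E) ->
  mu2.-integrable (@Omega R) (fun x => ((m i x - c) * f x)%:E) /\
  `|\int[mu2]_(x in @Omega R) ((m i x - c) * f x)| <=
     2 * \int[mu2]_(x in @Omega R) `|f x|.
Proof.
move=> H1m c1 fi; have mO := @measurable_strip R.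
have mm := H1dot_S2_measurable i H1m.
have mf : measurable_fun (@Omega R) f by apply/measurable_EFinP; exact: measurable_int fi.
have mmf : measurable_fun (@Omega R) (fun x => (m i x - c) * f x).
  by apply: measurable_funM => //; exact: measurable_funB.
have ia := @integrable_norm _ _ _ mu2 _ _ fi.
have ia2 := @integrableZl _ _ _ mu2 _ mO 2 _ ia.
have le2 : (\int[mu2]_(x in @Omega R) `|((m i x - c) * f x)%:E| <=
    \int[mu2]_(x in @Omega R) (2 * `|f x|)%:E)%E.
  apply: (@ae_ge0_le_integral _ _ _ mu2) => //.
  - by apply: measurableT_comp => //; exact/measurable_EFinP.
  - exact: measurable_int ia2.
  - have := ae_H1dot_S2_le1 H1m; apply: ae_plane_mono => x h Ox.
    rewrite /= lee_fin normrM ler_wpM2r//.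
    apply: le_trans (ler_normB _ _) _; rewrite -[2]/(1 + 1); apply: lerD => //.
    exact: h.
have im : mu2.-integrable (@Omega R) (fun x => ((m i x - c) * f x)%:E).
  apply/integrableP; split; first exact/measurable_EFinP.
  by apply: le_lt_trans le2 _; exact: (@integrable_lty _ _ _ mu2 _ mO _ ia2).
split => //.
apply: le_trans (@le_normr_Rintegral _ _ _ mu2 _ _ mO im) _.
rewrite -(@RintegralZl _ _ _ mu2 _ _ _ mO ia).
rewrite -lee_fin /Rintegral fineK; last first.
  exact: (@integrable_fin_num _ _ _ mu2 _ mO _ (@integrable_norm _ _ _ mu2 _ _ im)).
by rewrite fineK//; exact: (@integrable_fin_num _ _ _ mu2 _ mO _ ia2).
Qed.

Lemma integrable_strip_H1dot_S2 m i (f : R * R -> R) : H1dot_S2 m ->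
  mu2.-integrable (@Omega R) (fun x => (f x)%:E) ->
  mu2.-integrable (@Omega R) (fun x => (m i x * f x)%:E).
Proof.
move=> H1m fi; have c0 : `|0 : R| <= 1 by rewrite normr0.
have [im _] := strip_bounded_mul i H1m c0 fi.
by apply: eq_integrable im => //; [exact: measurable_strip|move=> x _; rewrite subr0].
Qed.

(** Fubini's theorem, and the fundamental theorem of calculus on each vertical
    segment. *)
Lemma integral_partial3_strip psi zeta L : smooth psi -> continuous zeta ->
  (forall t, ~ (- L <= t <= L) -> zeta t = 0) ->
  \int[mu2]_(x in @Omega R) (partial 1 psi x * zeta x.1) =
  \int[mu]_t ((psi (t, 1) - psi (t, -1)) * zeta t).
Proof.
move=> spsi czeta z0; have mO := @measurable_strip R.
have cd : continuous (partial 1 psi) by apply: smooth_continuous; exact: smooth_partial.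
have cF : continuous (fun x => partial 1 psi x * zeta x.1).
  apply: continuous_plane_mul => // x.
  by apply: (@continuous_comp _ _ _ fst zeta); [exact: cvg_fst|exact: czeta].
pose f := (fun x => partial 1 psi x * zeta x.1) \_ (@Omega R).
have iO : mu2.-integrable (@Omega R) (fun x => (partial 1 psi x * zeta x.1)%:E).
  pose L' := Num.max L 3.
  pose G x := partial 1 psi x * zeta x.1 * plateau (-1) 1 1 x.2.
  have cG : continuous G.
    apply: continuous_plane_mul => // x.
    apply: (@continuous_comp _ _ _ snd (plateau (-1) 1 1)); first exact: cvg_snd.
    exact: (cinf_continuous (cinf_plateau _ _ _)).
  have bG : box_supported L' G.
    move=> [s t] nb; rewrite /G/=.
    have [hs|hs] := pselect (- L <= s <= L); last by rewrite z0// mulr0 mul0r.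
    rewrite plateau0 ?mulr0// divr1 => ht; apply: nb.
    have h1 : L <= L' by rewrite le_max lexx.
    have h2 : 3 <= L' by rewrite le_max lexx orbT.
    by split => /=; rewrite in_itv/=; apply/andP; split; lra.
  have [M M0 FM] := compact_support_bounded cG bG.
  have := @integrable_box_supported _ (@Omega R) _ L' M mO
     (measurable_funTS (continuous_measurable_plane cG)) bG FM.
  apply: eq_integrable => // -[s t]; rewrite inE => /andP[/= h1 h2].
  by rewrite /G/= plateau1 ?mulr1// !ltW.
have iT : mu2.-integrable setT (EFin \o f).
  by rewrite /f -restrict_EFin; exact: (@integrable_mkcond _ _ _ mu2 _ _ mO).1 iO.
rewrite Rintegral_mkcond /Rintegral -(@integral12_prod_meas1 _ _ _ _ R mu mu _ iT).
congr fine; apply: eq_integral => t _; rewrite /fubini_F.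
transitivity (\int[mu]_(s in `](-1)%R, 1%R[) (partial 1 psi (t, s) * zeta t)%:E)%E.
  rewrite [RHS]integral_mkcond; apply: eq_integral => s _; rewrite /f /patch/=.
  have e : ((t, s) \in @Omega R) = (s \in `](-1)%R, 1%R[%classic).
    by apply/idP/idP; rewrite !inE /Omega/= ?in_itv.
  by rewrite e; case: ifP.
have dh s : is_derive s 1 (fun s => psi (t, s) * zeta t) (partial 1 psi (t, s) * zeta t).
  have d0 : is_derive s 1 (fun s => psi (t, s)) (partial 1 psi (t, s)).
    by apply/is_derive_slice2; apply/derivableP; exact: smooth_derivable.
  have dd := is_deriveM d0 (is_derive_cst (zeta t) s 1).
  by apply: (is_derive_eq dd); rewrite /GRing.scale/= mulr0 add0r mulrC.
have ch : continuous (fun s => partial 1 psi (t, s) * zeta t).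
  have := @continuous_slice2 _ (fun x => partial 1 psi x * zeta x.1) t cF.
  by [].
rewrite -(@integral_itv_bndoo _ _ _ _ true false); last first.
  by apply/measurable_EFinP; apply: measurable_funTS; exact: continuous_measurable_fun.
rewrite (FTC_is_derive _ dh ch); last by lra.
by congr EFin; ring.
Qed.

End vertical_flux.

(** * Flux through vertical segments *)

Section mean_angle.
Variable R : realType.
Implicit Types (g zeta : R -> R) (m : 'I_3 -> R * R -> R) (f psi : R * R -> R) (s t L : R).
Local Notation mu := (@lebesgue_measure R).
Local Notation mu2 := (@mu2 R).

(** Cutoffs in x_3, exhausting the strip as n grows. With k = n + 4, the flanks of
    width 2 / k end at height 1 - 1 / k, hence inside the strip. *)
Definition strip_cutoff (n : nat) t : R :=
  plateau (- (1 - 3 / n.+4%:R)) (1 - 3 / n.+4%:R) n.+4%:R t.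

Lemma strip_cutoff_cvg t : -1 < t < 1 -> strip_cutoff n t @[n --> \oo] --> (1 : R).
Proof.
move=> /andP[t1 t2]; apply: cvg_near_cst.
pose e := Num.min (1 - t) (1 + t).
have e0 : 0 < e by rewrite lt_min; apply/andP; split; lra.
have [e1 e2] : e <= 1 - t /\ e <= 1 + t by rewrite !ge_min !lexx ?orbT.
near=> n; rewrite /strip_cutoff plateau1//.
have h : 3 / n.+4%:R <= e.
  rewrite ler_pdivrMr// -ler_pdivrMl// mulrC.
  apply: (@le_trans _ _ n%:R); last by rewrite ler_nat -addn4 leq_addr.
  by near: n; exact: nbhs_infty_ger.
by move: h; set q := 3 / _ => h; apply/andP; split; lra.
Unshelve. all: by end_near. Qed.

Lemma cvg_exhaustion (rho : nat -> R * R -> R) (f : R * R -> R) :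
  mu2.-integrable (@Omega R) (fun x => (f x)%:E) ->
  (forall n, measurable_fun (@Omega R) (rho n)) -> (forall n x, 0 <= rho n x <= 1) ->
  (forall x, @Omega R x -> rho n x @[n --> \oo] --> (1 : R)) ->
  \int[mu2]_(x in @Omega R) (f x * rho n x) @[n --> \oo] --> \int[mu2]_(x in @Omega R) f x.
Proof.
move=> fi mrho rho01 crho; have mO := @measurable_strip R.
have mf : measurable_fun (@Omega R) f by apply/measurable_EFinP; exact: measurable_int fi.
have mfn n : measurable_fun (@Omega R) (fun x => (f x * rho n x)%:E).
  by apply/measurable_EFinP; exact: measurable_funM.
have in_ : mu2.-integrable (@Omega R) (abse \o (fun x => (f x)%:E)).
  exact: integrable_abse.
have := @dominated_cvg _ _ R mu2 _ mO (fun n x => (f x * rho n x)%:E)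
  (fun x => (f x)%:E) _ mfn _ _ in_ _.
move=> h; have {}h : (\int[mu2]_(x in @Omega R) (f x * rho n x)%:E)%E
    @[n --> \oo] --> (\int[mu2]_(x in @Omega R) (f x)%:E)%E.
  apply: h => //.
  - move=> x Ox; apply: cvg_EFin; first exact: nearW.
    by rewrite -[X in _ --> X]mulr1; apply: cvgMl_tmp; exact: crho.
  - move=> n x Ox; rewrite /= lee_fin normrM ler_piMr//.
    by have /andP[r0 r1] := rho01 n x; rewrite ger0_norm.
have fin : (\int[mu2]_(x in @Omega R) (f x)%:E)%E \is a fin_num.
  exact: integrable_fin_num fi.
apply: (fine_cvg (a := \int[mu2]_(x in @Omega R) f x)).
by rewrite /Rintegral fineK.
Qed.

Lemma measurable_strip_cutoff n (E : set (R * R)) :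
  measurable_fun E (fun x : R * R => strip_cutoff n x.2).
Proof.
apply: measurable_funTS; apply: (@measurableT_comp _ _ _ _ _ _ (strip_cutoff n)) => //.
exact: continuous_measurable_fun (cinf_continuous (cinf_plateau _ _ _)).
Qed.

Lemma cvg_strip_cutoff (f : R * R -> R) : mu2.-integrable (@Omega R) (fun x => (f x)%:E) ->
  \int[mu2]_(x in @Omega R) (f x * strip_cutoff n x.2) @[n --> \oo] -->
  \int[mu2]_(x in @Omega R) f x.
Proof.
move=> fi; apply: (cvg_exhaustion (rho := fun n x => strip_cutoff n x.2)) => //.
- by move=> n; exact: measurable_strip_cutoff.
- by move=> n x; rewrite plateau_ge0 plateau_le1.
- by move=> x Ox; exact: strip_cutoff_cvg.
Qed.

Lemma continuous_sqint_box (F : R * R -> R) L (E : set (R * R)) : continuous F ->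
  measurable E -> E `<=` box L -> sqint mu2 E F.
Proof.
move=> cF mE EL.
have : compact (F @` box L).
  by apply: continuous_compact; [exact: continuous_subspaceT|exact: compact_box].
move=> /compact_bounded[M [_ HM]].
apply: (@bounded_sqint _ _ _ mu2 _ _ (`|M| + 1) mE).
- apply: le_lt_trans (mu2_box_lty L); apply: le_measure; rewrite ?inE//.
  exact: measurable_box.
- by apply: measurable_funTS; exact: continuous_measurable_plane.
- move=> x /EL bx; apply: HM; first by rewrite (le_lt_trans (ler_norm M))// ltrDl.
  by exists x.
Qed.

Lemma mu_interval_lty L : (mu `](- L)%R, L%R[%classic < +oo)%E.
Proof. by rewrite lebesgue_measure_itv/=; case: ifP => _; rewrite ltry. Qed.

Lemma continuous_sqint_line g L : continuous g ->
  sqint mu (`]- L, L[%classic : set R) g.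
Proof.
move=> cg; have mJ : measurable (`]- L, L[%classic : set R) by exact: measurable_itv.
have : compact (g @` `[- L, L]%classic).
  by apply: continuous_compact; [exact: continuous_subspaceT|exact: segment_compact].
move=> /compact_bounded[M [_ HM]].
apply: (@bounded_sqint _ _ _ mu _ _ (`|M| + 1) mJ).
- exact: mu_interval_lty.
- by apply: measurable_funTS; exact: continuous_measurable_fun.
- move=> x /= Jx; apply: HM; first by rewrite (le_lt_trans (ler_norm M))// ltrDl.
  by exists x => //=; exact: subset_itv_oo_cc Jx.
Qed.

Lemma Rintegral_subset_eq (E F : set (R * R)) (f : R * R -> R) : E `<=` F ->
  (forall x, F x -> ~ E x -> f x = 0) ->
  \int[mu2]_(x in E) f x = \int[mu2]_(x in F) f x.
Proof.
move=> EF f0; rewrite Rintegral_mkcond [RHS]Rintegral_mkcond.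
apply: eq_Rintegral => x _; rewrite /patch.
have [Ex|nE] := pselect (E x); first by rewrite !mem_set//; exact: EF.
rewrite (memNset nE); have [Fx|nF] := pselect (F x); last by rewrite memNset.
by rewrite mem_set// f0.
Qed.

Lemma strip_box s t L : -1 < t < 1 -> - L <= s <= L -> box (Num.max L 1) (s, t).
Proof.
move=> /andP[t1 t2] /andP[s1 s2].
have g1 : L <= Num.max L 1 by rewrite le_max lexx.
have g2 : 1 <= Num.max L 1 by rewrite le_max lexx orbT.
by split => /=; rewrite in_itv/=; apply/andP; split; lra.
Qed.

(** Approximating f by smooth functions reduces the vertical integral of its weak
    derivative to boundary values, which tend to the zero trace. *)
Lemma trace0_integral f zeta L : sqint mu2 (@Omega R) (weak_partial 1 f) ->
  is_trace f (fun=> 0) -> continuous zeta ->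
  (forall t, ~ (- L <= t <= L) -> zeta t = 0) ->
  \int[mu2]_(x in @Omega R) (weak_partial 1 f x * zeta x.1) = 0.
Proof.
move=> sD trm czc z0; have mO := @measurable_strip R.
set D := weak_partial 1 f in sD *.
have sz := sqint_strip_compact czc z0.
have [_ [psi [spsi trL]]] := trm.
pose L1 := `|L| + 1; have L10 : 0 < L1 by rewrite ltr_wpDl.
have [_ /(_ 1) dpsi bpsi] := trL _ L10.
pose J : set R := `](- L1)%R, L1%R[%classic.
have mJ : measurable J by exact: measurable_itv.
have JE : [set t : R | `|t| < L1] = J.
  by apply/seteqP; split => t /=; rewrite /J/= in_itv/= ltr_norml.
have zJ t : ~ J t -> zeta t = 0.
  move=> nJ; apply: z0 => hL; apply: nJ; rewrite /J/= in_itv/= -ltr_norml /L1.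
  have : `|t| <= `|L|.
    rewrite ler_norml; have := ler_norm L; move: hL; clear; move=> /andP[? ?] ?.
    by apply/andP; split; lra.
  by move=> h; rewrite (le_lt_trans h)// ltrDl.
pose B := @Omega R `&` [set x | `|x.1| < L1].
have BO : B `<=` @Omega R by move=> x [].
have BL : B `<=` box (Num.max L1 1).
  move=> [s t] [Ost /=]; rewrite ltr_norml => /andP[h3 h4].
  by apply: strip_box => //; rewrite !ltW.
have mB : measurable B.
  apply: measurableI => //; rewrite (_ : [set x : R * R | `|x.1| < L1] = J `*` setT).
    exact: measurableX.
  by apply/seteqP; split => -[s t] /=; rewrite /J/= in_itv/= ltr_norml// => -[].
have BE (F : R * R -> R) :
    \int[mu2]_(x in B) (F x * zeta x.1) = \int[mu2]_(x in @Omega R) (F x * zeta x.1).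
  apply: Rintegral_subset_eq => // x Ox nB; rewrite zJ ?mulr0// => Jx; apply: nB.
  by split => //=; move: Jx; rewrite /J/= in_itv/= ltr_norml.
have sDB := @sqintS _ _ _ mu2 _ _ _ mO mB BO sD.
have szB := @sqintS _ _ _ mu2 _ _ _ mO mB BO sz.
have spsiB n : sqint mu2 B (partial 1 (psi n)).
  apply: (@continuous_sqint_box _ (Num.max L1 1)) => //.
  by apply: smooth_continuous; apply: smooth_partial; exact: spsi.
have cD : \int[mu2]_(x in @Omega R) (partial 1 (psi n) x * zeta x.1) @[n --> \oo] -->
    \int[mu2]_(x in @Omega R) (D x * zeta x.1).
  rewrite -(BE D); under eq_fun do rewrite -BE.
  apply: (@cvg_integral_mul _ _ _ mu2 _ mB _ _ _ _ _ _ _ sDB szB).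
    exact: nearW.
  exact: (fine_cvg dpsi).
have cpsi n (c : R) : continuous (fun t => psi n (t, c)).
  by apply: continuous_slice1; exact: smooth_continuous.
have szJ : sqint mu J zeta by exact: continuous_sqint_line.
have s0J : sqint mu J (fun=> 0).
  by apply: (@continuous_sqint_line (fun=> 0)) => t; exact: cvg_cst.
have cb (b : bool) : \int[mu]_(t in J) (psi n (t, (-1) ^+ b) * zeta t) @[n --> \oo] --> (0 : R).
  have := @cvg_integral_mul _ _ _ mu _ mJ _ _ _
    (fun n t => psi n (t, (-1) ^+ b)) (fun=> 0) zeta _ s0J szJ.
  rewrite (_ : \int[mu]_(t in J) (0 * zeta t) = 0); last first.
    by rewrite /Rintegral integral0_eq// => t _; rewrite mul0r.
  apply.
    by apply: nearW => n; exact: continuous_sqint_line.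
  have h := fine_cvg (bpsi b); rewrite JE in h; exact: h.
have cbb : (\int[mu]_(t in J) (psi n (t, (-1) ^+ false) * zeta t) -
    \int[mu]_(t in J) (psi n (t, (-1) ^+ true) * zeta t)) @[n --> \oo] --> (0 : R).
  rewrite -[X in _ --> X](subr0 (0 : R)).
  by apply: cvgB; [exact: (cb false)|exact: (cb true)].
have E n : \int[mu2]_(x in @Omega R) (partial 1 (psi n) x * zeta x.1) =
    \int[mu]_(t in J) (psi n (t, (-1) ^+ false) * zeta t) -
    \int[mu]_(t in J) (psi n (t, (-1) ^+ true) * zeta t).
  rewrite (integral_partial3_strip (spsi n) czc z0).
  have ib (b : bool) := @sqint_integrable_mul _ _ _ mu _ _ _ mJ
    (@continuous_sqint_line _ L1 (cpsi n ((-1) ^+ b))) szJ.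
  rewrite -(@RintegralB _ _ _ mu _ _ _ mJ (ib false) (ib true)) [RHS]Rintegral_mkcond.
  apply: eq_Rintegral => t _; rewrite /patch expr0 expr1 -mulrBl.
  case: ifPn => // /negP; rewrite inE => /zJ ->; rewrite mulr0//.
move/funext : E => E; rewrite E in cD.
exact: norm_cvg_unique cD cbb.
Qed.

(** As m_3 vanishes on the boundary of the strip, the divergence-free field m' has
    the same flux through all vertical segments: tested against zeta(x_1), the flux
    has derivative zero. *)
Lemma X0_flux m zeta (zeta' : R -> R) L : X0 m -> cinf zeta ->
  (forall t, is_derive t 1 zeta (zeta' t)) -> continuous zeta' ->
  (forall t, ~ (- L <= t <= L) -> zeta t = 0) ->
  (forall t, ~ (- L <= t <= L) -> zeta' t = 0) ->
  \int[mu2]_(x in @Omega R) (m 0 x * zeta' x.1) = 0.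
Proof.
move=> [H1m divm trm _] cz dz cz' z0 z'0; have mO := @measurable_strip R.
have [wD sD] := weak_partial_sqint 2 1 H1m.
set D := weak_partial 1 (m 2) in wD sD.
have czc := cinf_continuous cz.
have sz := sqint_strip_compact czc z0.
have iDz := @sqint_integrable_mul _ _ _ mu2 _ _ _ mO sD sz.
have [im0 _] := integral_slice H1m (integrable_compact cz' z'0).
(* the test function zeta(x_1) is not supported in the strip: cut it off in x_3;
   the integration by parts that defines the weak derivative of m_3 undoes the
   cutoff *)
have cut n : \int[mu2]_(x in @Omega R) (m 0 x * zeta' x.1 * strip_cutoff n x.2) =
    \int[mu2]_(x in @Omega R) (D x * zeta x.1 * strip_cutoff n x.2).
  set k : R := n.+4%:R; set r := 1 - 3 / k.
  have k0 : 0 < k by rewrite ltr0n.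
  have kq : 3 / k <= 3 / 4 by rewrite ler_wpM2l// lef_pV2// ?posrE// ler_nat.
  have r0 : - r <= r by rewrite /r; move: (3 / k) kq => q; lra.
  have k1 : 0 < k^-1 by rewrite invr_gt0.
  pose chi' t := plateau' (- r) r k t.
  pose phi (x : R * R) := zeta x.1 * strip_cutoff n x.2.
  have cphi : cinf2 phi.
    apply: cinf2_mul; first exact: cinf2_fst.
    by apply: cinf2_snd; exact: cinf_plateau.
  have sphi := cinf2_smooth cphi.
  have zero x : ~ (`[- L, L]%classic `*` `[- (1 - k^-1), 1 - k^-1]%classic) x -> phi x = 0.
    case: x => s t nK; rewrite /phi/=.
    have [hs|hs] := pselect (- L <= s <= L); last by rewrite z0// mul0r.
    rewrite /strip_cutoff plateau0 ?mulr0// => ht; apply: nK; split; rewrite /= in_itv//=.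
    have e : 1 - 3 / k + 2 / k = 1 - k^-1 by field; rewrite gt_eqF.
    have e1 : - r - 2 / k = - (1 - k^-1) by rewrite -e [RHS]opprD.
    by move: ht; rewrite -/k -/r e1 [r + _]e.
  have tphi : test_fun (@Omega R) phi.
    apply: (test_fun_support sphi _ _ zero).
      by apply: compact_setX; exact: segment_compact.
    by move=> [s t] [_ /=]; rewrite in_itv/= => ht; rewrite /Omega/=; move: k1 ht; move: (k^-1) => q; lra.
  have d0 : partial 0 phi = fun x => zeta' x.1 * strip_cutoff n x.2.
    apply/funext => -[s t].
    have dd : is_derive s 1 (fun s => phi (s, t)) (zeta' s * strip_cutoff n t).
      have dd := is_deriveM (dz s) (is_derive_cst (strip_cutoff n t) s 1).
      by apply: (is_derive_eq dd); rewrite /GRing.scale/= mulr0 add0r mulrC.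
    by have [_ ] := (is_derive_slice1 phi s t _).2 dd.
  have d1 : partial 1 phi = fun x => zeta x.1 * chi' x.2.
    apply/funext => -[s t].
    have dd : is_derive t 1 (fun t => phi (s, t)) (zeta s * chi' t).
      have dd := is_deriveM (is_derive_cst (zeta s) t 1) (is_derive_plateau t r0 k0).
      by apply: (is_derive_eq dd); rewrite /GRing.scale/= mulr0 addr0.
    by have [_ ] := (is_derive_slice2 phi s t _).2 dd.
  have [_ _ /(_ _ tphi)] := wD; rewrite d1 => ibp.
  have [L' _ bphi] := test_fun_box_supported tphi.
  have im i j := integrable_strip_H1dot_S2 i H1m
    (integrable_smooth (smooth_partial j sphi) (partial_box_supported j bphi) mO).
  have i0 := im 0 0; have i2 := im 2 1; rewrite d0 in i0; rewrite d1 in i2.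
  have := divm _ tphi; rewrite d0 d1.
  have -> : prime_part m 0 = m 0 by [].
  have -> : prime_part m 1 = m 2 by [].
  rewrite (@RintegralD _ _ _ mu2 _ _ _ mO i0 i2) ibp => /eqP.
  rewrite subr_eq0 => /eqP e.
  transitivity (\int[mu2]_(x in @Omega R) (m 0 x * (zeta' x.1 * strip_cutoff n x.2))).
    by apply: eq_Rintegral => x _; rewrite mulrA.
  by rewrite e; apply: eq_Rintegral => x _; rewrite /phi mulrA.
have trace0 := trace0_integral sD trm czc z0.
have c1 := cvg_strip_cutoff im0; have c2 := cvg_strip_cutoff iDz.
move/funext : cut => cut; rewrite cut in c1.
by rewrite -trace0; exact: norm_cvg_unique c1 c2.
Qed.

End mean_angle.

(** * Existence of the mean angle *)

Section lebesgue_points.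
Variable R : realType.
Implicit Types (S u g : R -> R) (m : 'I_3 -> R * R -> R) (s t a b c r : R).
Local Notation mu := (@lebesgue_measure R).
Local Notation mu2 := (@mu2 R).

Lemma ae_line_mono2 (P Q P' : R -> Prop) : (forall t, P t -> Q t -> P' t) ->
  {ae mu, forall t, P t} -> {ae mu, forall t, Q t} -> {ae mu, forall t, P' t}.
Proof.
move=> PQ [N [mN N0 subN]] [K [mK K0 subK]]; exists (N `|` K); split.
- exact: measurableU.
- exact: etrans (@measureU0 _ _ _ mu N K mN mK K0) N0.
- move=> t nP'; have [nt|nt] := pselect (N t); [by left|right].
  apply: subK => /= Qt; apply: nP' => /=; apply: PQ => //.
  by apply: contrapT => nP; apply: nt; exact: subN.
Qed.

Lemma ae_line_mono (P Q : R -> Prop) : (forall t, P t -> Q t) ->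
  {ae mu, forall t, P t} -> {ae mu, forall t, Q t}.
Proof. by move=> PQ aP; apply: (ae_line_mono2 _ aP aP) => t Pt _; exact: PQ. Qed.

Lemma integral_derivative_support g u (p q : R) : p <= q ->
  (forall t, is_derive t 1 g (u t)) -> continuous u ->
  (forall t, ~ (p <= t <= q) -> u t = 0) -> \int[mu]_t u t = g q - g p.
Proof.
move=> pq dg cu u0; rewrite /Rintegral.
rewrite (_ : (\int[mu]_t (u t)%:E)%E = (\int[mu]_(t in `[p, q]) (u t)%:E)%E).
  by rewrite (FTC_is_derive pq dg cu).
rewrite [RHS]integral_mkcond; apply: eq_integral => t _; rewrite /patch.
by case: ifPn => // /negP; rewrite inE/= in_itv/= => /u0 ->.
Qed.

Lemma integrable_bounded_compact S u (M L : R) : measurable_fun setT S ->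
  (forall t, `|S t| <= M) -> continuous u -> (forall t, ~ (- L <= t <= L) -> u t = 0) ->
  mu.-integrable setT (fun t => (S t * u t)%:E).
Proof.
move=> mS SM cu u0; have iu := integrable_compact cu u0.
have M0 : 0 <= M by apply: le_trans (SM 0); exact: normr_ge0.
have := @integrableZl _ _ _ mu _ measurableT M _ iu.
apply: le_integrable => //.
  apply/measurable_EFinP; apply: measurable_funM => //.
  exact: continuous_measurable_fun.
by move=> t _; rewrite /= lee_fin !normrM (ger0_norm M0) ler_wpM2r.
Qed.

(** The kernel u has mass w, so that only S - S c matters, with weight at most
    C / r on an interval of length 2 r. *)
Lemma kernel_average S u (M C c r e w L : R) : 0 < r -> measurable_fun setT S ->
  (forall t, `|S t| <= M) -> continuous u -> (forall t, `|u t| <= C / r) ->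
  (forall t, ~ ball c r t -> u t = 0) -> (forall t, ~ (- L <= t <= L) -> u t = 0) ->
  \int[mu]_t u t = w -> (davg S c r < e%:E)%E ->
  `|\int[mu]_t (S t * u t) - w * S c| <= 2 * C * e.
Proof.
move=> r0 mS SM cu uC u0 uL uw dS.
have iSu := integrable_bounded_compact mS SM cu uL.
have iu := integrable_compact cu uL.
have icu := @integrableZl _ _ _ mu _ measurableT (S c) _ iu.
have C0 : 0 <= C.
  have := le_trans (normr_ge0 _) (uC 0); rewrite pmulr_lge0// invr_gt0//.
have mB : measurable (ball c r) by exact: measurable_ball.
have muB : mu (ball c r) = (2 * r)%:E.
  by rewrite lebesgue_measure_ball ?(ltW r0)// mulr_natl.
have mSc : measurable_fun (ball c r) (fun t => S t - S c).
  by apply: measurable_funTS; exact: measurable_funB.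
have iSc : mu.-integrable (ball c r) (fun t => (S t - S c)%:E).
  apply: (@bounded_integrable _ _ _ mu _ _ (M + M) mB) => //.
    by apply: (@le_lt_trans _ _ (2 * r)%:E); [rewrite -muB|exact: ltry].
  by move=> t _; apply: le_trans (ler_normB _ _) _; exact: lerD.
have iaSc := integrable_norm iSc.
pose I := \int[mu]_(t in ball c r) `|S t - S c|.
have Ie : I <= 2 * r * e.
  have : (davg S c r = ((2 * r)^-1 * I)%:E)%E.
    rewrite /davg /iavg.
    set A := (X in (X^-1 * _)%E); have -> : A = (2 * r)%:E by exact: muB.
    have r2 : 2 * r != 0 by rewrite gt_eqF// mulr_gt0.
    rewrite [in RHS]EFinM inver (negPf r2); congr (_ * _)%E.
    by rewrite /I /Rintegral fineK//; exact: integrable_fin_num iaSc.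
  move=> E; move: dS; rewrite E lte_fin => /ltW.
  by rewrite ler_pdivrMl// mulr_gt0.
have -> : \int[mu]_t (S t * u t) - w * S c =
    \int[mu]_(t in ball c r) ((S t - S c) * u t).
  rewrite -uw mulrC -(@RintegralZl _ _ _ mu _ _ (S c) measurableT iu).
  rewrite -(@RintegralB _ _ _ mu _ _ _ measurableT iSu icu) [RHS]Rintegral_mkcond.
  apply: eq_Rintegral => t _; rewrite /patch -mulrBl; case: ifPn => // /negP.
  by rewrite inE => /u0 ->; rewrite mulr0.
have iScu : mu.-integrable (ball c r) (fun t => ((S t - S c) * u t)%:E).
  have := @integrableZl _ _ _ mu _ mB (C / r) _ iSc.
  apply: le_integrable => //.
    apply/measurable_EFinP; apply: measurable_funM => //.
    by apply: measurable_funTS; exact: continuous_measurable_fun.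
  move=> t _; rewrite /= lee_fin normrM [leRHS]normrM mulrC ler_wpM2r//.
  by apply: le_trans (uC t) _; exact: ler_norm.
apply: le_trans (@le_normr_Rintegral _ _ _ mu _ _ mB iScu) _.
apply: (@le_trans _ _ (\int[mu]_(t in ball c r) (C / r * `|S t - S c|))).
  apply: le_Rintegral => //.
  - exact: integrable_norm.
  - exact: (@integrableZl _ _ _ mu _ mB (C / r) _ iaSc).
  - by move=> t _; rewrite normrM mulrC ler_wpM2r.
rewrite (@RintegralZl _ _ _ mu _ _ _ mB iaSc) -/I.
apply: le_trans (ler_wpM2l _ Ie) _; first by rewrite divr_ge0// ltW.
by rewrite le_eqVlt; apply/orP; left; apply/eqP; field; rewrite gt_eqF.
Qed.

(** The derivative of a plateau over [a, b] is the difference of two kernels that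
    concentrate at a and b as the flanks steepen. *)
Lemma lebesgue_pts_eq S (M a b : R) : measurable_fun setT S -> (forall t, `|S t| <= M) ->
  (forall k, 0 < k -> \int[mu]_t (S t * plateau' a b k t) = 0) ->
  a < b -> lebesgue_pt S a -> lebesgue_pt S b -> S a = S b.
Proof.
move=> mS SM flux ab La Lb.
apply/eqP; rewrite eq_sym -subr_eq0 -normr_le0; apply/ler_addgt0Pr => e e0; rewrite add0r.
pose C : R := 3 * slope.
have C0 : 0 < C by rewrite /C /slope mulr_gt0// mulr_gt0// expR_gt0.
pose d := e / (4 * C).
have d0 : 0 < d by rewrite divr_gt0// mulr_gt0.
have near_d c : lebesgue_pt S c -> \forall r \near 0^'+, (davg S c r < d%:E)%E.
  move=> Lc; have : nbhs (0%E : \bar R) [set x | (x < d%:E)%E].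
    by apply: open_ereal_lt'; rewrite lte_fin.
  by move=> /Lc.
have [r [r0 da db]] : exists r, [/\ 0 < r, (davg S a r < d%:E)%E & (davg S b r < d%:E)%E].
  near ((0 : R)^'+) => r.
  exists r; split; [by []|by near: r; exact: near_d|by near: r; exact: near_d].
(* flanks of width 2 / k fit into the balls of radius r *)
pose k := 3 / r; have k0 : 0 < k by rewrite divr_gt0.
have kr : 2 / k = 2 / 3 * r by rewrite /k; field; rewrite gt_eqF.
pose u t := k * step_down' (k * (t - b)).
pose v t := - (k * step_down' (k * (a - t))).
have cu : continuous u.
  apply: cinf_continuous; apply: (cinf_mul (cinf_cst _)).
  exact: (cinf_comp (cinf_step_down' R) (cinf_affine _ _)).
have cv : continuous v.
  apply: cinf_continuous; have := cinf_mul (cinf_cst (- k))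
    (cinf_comp (cinf_step_down' R) (cinf_affine a (- k))).
  by congr cinf; apply/funext => s; rewrite /v mulNr; congr (- (_ * step_down' _)); ring.
have du t : is_derive t 1 (fun t => step_down (k * (t - b))) (u t).
  have := @is_derive1_comp _ (@step_down R) _ t _ _ (is_derive_step_down _) (is_derive_affine b k t).
  by rewrite mulrC.
have dv t : is_derive t 1 (fun t => step_down (- k * (t - a))) (v t).
  have := @is_derive1_comp _ (@step_down R) _ t _ _ (is_derive_step_down _) (is_derive_affine a (- k) t).
  by rewrite mulrC mulNr (_ : - k * (t - a) = k * (a - t)) //; ring.
have u0 t : ~ (b <= t <= b + 2 / k) -> u t = 0.
  move=> /negP; rewrite negb_and -!ltNge => h; rewrite /u step_down'0 ?mulr0//.
  case/orP: h => h; first by left; rewrite pmulr_rle0// subr_le0 ltW.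
  by right; rewrite mulrC -ler_pdivrMr//; lra.
have v0 t : ~ (a - 2 / k <= t <= a) -> v t = 0.
  move=> /negP; rewrite negb_and -!ltNge => h; rewrite /v step_down'0 ?mulr0 ?oppr0//.
  case/orP: h => h; last by left; rewrite pmulr_rle0// subr_le0 ltW.
  by right; rewrite mulrC -ler_pdivrMr//; lra.
have k20 : 0 < 2 / k by rewrite divr_gt0.
have iu : \int[mu]_t u t = -1.
  rewrite (integral_derivative_support _ du cu u0); last by lra.
  have k2 : k * (b + 2 / k - b) = 2 by field; rewrite gt_eqF.
  have kb : k * (b - b) = 0 by rewrite subrr mulr0.
  by rewrite k2 kb (step_down1 (lexx 0)) (step_down0 (lexx 2)) sub0r.
have iv : \int[mu]_t v t = 1.
  rewrite (integral_derivative_support _ dv cv v0); last by lra.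
  have k2 : - k * (a - 2 / k - a) = 2 by field; rewrite gt_eqF.
  have ka : - k * (a - a) = 0 by rewrite subrr mulr0.
  by rewrite k2 ka (step_down1 (lexx 0)) (step_down0 (lexx 2)) subr0.
pose L := `|a| + `|b| + r.
have [aL bL] : `|a| + r <= L /\ `|b| + r <= L.
  by rewrite /L; have := normr_ge0 a; have := normr_ge0 b; split; lra.
have uL t : ~ (- L <= t <= L) -> u t = 0.
  move=> nL; apply: u0 => /andP[h1 h2]; apply: nL; move: h2; rewrite kr.
  have := ler_norm b; have := ler_norm (- b); rewrite normrN => ? ? ?.
  by apply/andP; split; lra.
have vL t : ~ (- L <= t <= L) -> v t = 0.
  move=> nL; apply: v0 => /andP[h1 h2]; apply: nL; move: h1; rewrite kr.
  have := ler_norm a; have := ler_norm (- a); rewrite normrN => ? ? ?.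
  by apply/andP; split; lra.
have uC t : `|u t| <= C / r.
  rewrite /u normrM gtr0_norm// (_ : C / r = k * slope); last by rewrite /C /k; ring.
  by rewrite ler_wpM2l ?step_down'_le// ltW.
have vC t : `|v t| <= C / r.
  rewrite /v normrN normrM gtr0_norm// (_ : C / r = k * slope); last by rewrite /C /k; ring.
  by rewrite ler_wpM2l ?step_down'_le// ltW.
have uB t : ~ ball b r t -> u t = 0.
  move=> nB; apply: u0; rewrite kr => /andP[h1 h2]; apply: nB.
  by rewrite /ball/= ltr_norml; apply/andP; split; lra.
have vB t : ~ ball a r t -> v t = 0.
  move=> nB; apply: v0; rewrite kr => /andP[h1 h2]; apply: nB.
  by rewrite /ball/= ltr_norml; apply/andP; split; lra.
have Hu := kernel_average r0 mS SM cu uC uB uL iu db.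
have Hv := kernel_average r0 mS SM cv vC vB vL iv da.
have iSu := integrable_bounded_compact mS SM cu uL.
have iSv := integrable_bounded_compact mS SM cv vL.
have sum0 : \int[mu]_t (S t * u t) + \int[mu]_t (S t * v t) = 0.
  rewrite -(@RintegralD _ _ _ mu _ _ _ measurableT iSu iSv) -(flux k k0).
  by apply: eq_Rintegral => t _; rewrite /u /v /plateau'; ring.
have Ce : 2 * C * d = e / 2 by rewrite /d; field; rewrite gt_eqF.
move: Hu Hv sum0; rewrite Ce; move: (\int[mu]_t _) (\int[mu]_t _) => I1 I2.
rewrite !ler_norml => /andP[? ?] /andP[? ?] ?.
by apply/andP; split; lra.
Unshelve. all: by end_near. Qed.

(** The mean over vertical slices takes the same value at all its Lebesgue points,
    and this value lies in [-1, 1]. *)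
Lemma X0_is_mean_angle m : X0 m -> exists theta, is_mean_angle m theta.
Proof.
move=> hm; have [H1m _ _ _] := hm.
pose S := slice_integral m.
have mS : measurable_fun setT S := measurable_slice_integral H1m.
have S2 t : `|S t| <= 2 := slice_integral_le2 t H1m.
have flux a b k : a <= b -> 0 < k -> \int[mu]_t (S t * plateau' a b k t) = 0.
  move=> ab k0; have cp' := cinf_continuous (cinf_plateau' a b k).
  pose L := `|a| + `|b| + 2 / k.
  have k2 : 0 < 2 / k by rewrite divr_gt0.
  have sub t : a - 2 / k <= t <= b + 2 / k -> - L <= t <= L.
    have := ler_norm b; have := ler_norm (- a); rewrite normrN.
    have := normr_ge0 a; have := normr_ge0 b; rewrite /L.
    move: (`|a|) (`|b|) (2 / k) k2 => x y z; clear.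
    by move=> ? ? ? ? ? /andP[? ?]; apply/andP; split; lra.
  have z0 t : ~ (- L <= t <= L) -> plateau a b k t = 0.
    by move=> nL; rewrite plateau0// => /sub.
  have z'0 t : ~ (- L <= t <= L) -> plateau' a b k t = 0.
    by move=> nL; rewrite plateau'0//; right => /sub.
  have dp t := is_derive_plateau t ab k0.
  have := X0_flux hm (cinf_plateau a b k) dp cp' z0 z'0.
  by have [_ ->] := integral_slice H1m (integrable_compact cp' z'0).
have loc : locally_integrable setT S.
  split => //; first exact: openT.
  move=> K _ cK; have [M [_ HM]] := compact_bounded cK.
  have mK : measurable K by exact: compact_measurable.
  apply: (@le_lt_trans _ _ (2%:E * mu K)%E).
    apply: (@integral_le_bound _ _ _ mu _ (fun t => (S t)%:E)) => //.
    - by apply/measurable_EFinP; exact: measurable_funTS.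
    - by apply: aeW => t _; rewrite /= lee_fin.
  by apply: lte_mul_pinfty; rewrite ?lee_fin//; exact: compact_finite_measure.
have ae_leb := lebesgue_differentiation loc.
have [a0 La0] : exists a0, lebesgue_pt S a0.
  apply: contrapT => /forallNP none; have [N [mN N0 subN]] := ae_leb.
  have NT : `](-1)%R, 1%R[%classic `<=` N by move=> t _; apply: subN; exact: none.
  have : (mu `](-1)%R, 1%R[%classic <= mu N)%E.
    by apply: le_measure; rewrite ?inE//; exact: measurable_itv.
  have -> : mu N = 0%E by exact: N0.
  by rewrite mu_unit_interval lee_fin; lra.
have ae_const : {ae mu, forall t, S t = S a0}.
  move: ae_leb; apply: ae_line_mono => t Lt; have [ta|ta|->//] := ltgtP t a0.
    exact: (lebesgue_pts_eq mS S2 (fun k => flux _ _ k (ltW ta)) ta Lt La0).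
  exact/esym/(lebesgue_pts_eq mS S2 (fun k => flux _ _ k (ltW ta)) ta La0 Lt).
have c1 : -1 <= S a0 / 2 <= 1.
  by have := S2 a0; rewrite ler_norml => /andP[? ?]; apply/andP; split; lra.
exists (acos (S a0 / 2)); split; first by rewrite acos_ge0// acos_lepi.
apply: ae_line_mono2 ae_const (ae_slice_integral H1m) => t e1 e2.
by rewrite acosK ?in_itv//= e2 -/S e1 mulrC mul1r.
Qed.

Lemma X0_mean m g : X0 m -> mu.-integrable setT (fun t => (g t)%:E) ->
  \int[mu2]_(x in @Omega R) (m 0 x * g x.1) = 2 * cos (mean_angle m) * \int[mu]_t g t.
Proof.
move=> hm ig; have [H1m _ _ _] := hm.
have [_ ang] : is_mean_angle m (mean_angle m).
  exact: (@xgetPex _ 0 [set theta | is_mean_angle m theta]) (X0_is_mean_angle hm).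
have [_ ->] := integral_slice H1m ig.
rewrite -(@RintegralZl _ _ _ mu _ _ _ measurableT ig) /Rintegral; congr fine.
have mg : measurable_fun setT g by apply/measurable_EFinP; exact: measurable_int ig.
apply: (@ae_eq_integral _ _ _ mu) => //.
- apply/measurable_EFinP; apply: measurable_funM => //.
  exact: measurable_slice_integral.
- by apply/measurable_EFinP; exact: measurable_funM.
- apply: ae_line_mono2 ang (ae_slice_integral H1m) => t e1 e2 _.
  by rewrite -e2 -e1; congr (_ * _)%:E; lra.
Qed.

End lebesgue_points.

(** * The angle profile *)

Section profile.
Variable R : realType.
Implicit Types (s t M e : R) (x : R * R).
Local Notation mu := (@lebesgue_measure R).
Local Notation mu2 := (@mu2 R).

Definition ramp t : R := t * flat_exp 0 t.
Definition ramp' t : R := flat_exp 0 t + flat_exp 1 t.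

Lemma is_derive_ramp t : is_derive t 1 ramp (ramp' t).
Proof.
have dd := is_deriveM (is_derive_id t 1) (is_derive_flat_exp0 t).
apply: (is_derive_eq dd); rewrite /ramp' /GRing.scale/= mulr1 addrC; congr (_ + _).
have [t0|t0] := ltP 0 t; last by rewrite !flat_exp0// mulr0.
by rewrite !flat_expE//; field; rewrite gt_eqF.
Qed.

Lemma ramp0 t : t <= 0 -> ramp t = 0.
Proof. by move=> t0; rewrite /ramp flat_exp0// mulr0. Qed.

Lemma ramp'0 t : t <= 0 -> ramp' t = 0.
Proof. by move=> t0; rewrite /ramp' !flat_exp0// addr0. Qed.

Lemma ramp_ge0 t : 0 <= ramp t.
Proof.
have [t0|t0] := leP t 0; first by rewrite ramp0.
by rewrite mulr_ge0 ?flat_exp_ge0// ltW.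
Qed.

Lemma ramp_ge t : t - 1 <= ramp t.
Proof.
have [t0|t0] := leP t 0; first by rewrite ramp0//; lra.
rewrite /ramp flat_expE// expr0 mulr1.
have h := expR_ge1Dx (- t^-1).
apply: le_trans (ler_wpM2l (ltW t0) h).
by rewrite mulrDr mulr1 mulrN mulfV// gt_eqF.
Qed.

Lemma ramp'_ge0 t : 0 <= ramp' t.
Proof. by rewrite addr_ge0 ?flat_exp_ge0. Qed.

Lemma ramp'_le1 t : ramp' t <= 1.
Proof.
have [t0|t0] := leP t 0; first by rewrite ramp'0.
rewrite /ramp' !flat_expE// expr0 expr1 mulr1 -[X in X + _]mulr1 -mulrDr expRN mulrC.
by rewrite ler_pdivrMr ?expR_gt0// mul1r expR_ge1Dx.
Qed.

Lemma cinf_ramp : cinf ramp.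
Proof. by apply: (cinf_mul (cinf_id R)); exact: cinf_flat_exp. Qed.

(** The height over which the angle function is spread: constant on [-1, 1], so
    that the profile below does not depend on x_3 inside the strip, and then
    growing like |t| with slope at most 1. The constant makes it at least 1 + |t|. *)
Definition height t : R := 3 + ramp (t - 1) + ramp (- t - 1).
Definition height' t : R := ramp' (t - 1) - ramp' (- t - 1).

Lemma is_derive_height t : is_derive t 1 height (height' t).
Proof.
have d1 : is_derive t 1 (fun t => t - 1 : R) 1.
  have dd := is_deriveB (is_derive_id t 1) (is_derive_cst (1 : R) t 1).
  by apply: (is_derive_eq dd); rewrite subr0.
have d2 : is_derive t 1 (fun t => - t - 1 : R) (-1).
  have dd := is_deriveB (is_deriveN (is_derive_id t 1)) (is_derive_cst (1 : R) t 1).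
  by apply: (is_derive_eq dd); rewrite subr0.
have r1 := @is_derive1_comp _ ramp _ t _ _ (is_derive_ramp _) d1.
have r2 := @is_derive1_comp _ ramp _ t _ _ (is_derive_ramp _) d2.
have dd := is_deriveD (is_deriveD (is_derive_cst (3 : R) t 1) r1) r2.
by apply: (is_derive_eq dd); rewrite add0r mulr1 mulrN1.
Qed.

Lemma height_strip t : -1 <= t <= 1 -> height t = 3.
Proof. by move=> /andP[? ?]; rewrite /height !ramp0 ?addr0//; lra. Qed.

Lemma height'_strip t : -1 <= t <= 1 -> height' t = 0.
Proof. by move=> /andP[? ?]; rewrite /height' !ramp'0 ?subr0//; lra. Qed.

Lemma height_ge t : 1 + `|t| <= height t.
Proof.
have := ramp_ge (t - 1); have := ramp_ge (- t - 1).
have := ramp_ge0 (t - 1); have := ramp_ge0 (- t - 1); rewrite /height.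
by case: (ger0P t) => _; lra.
Qed.

Lemma height_gt0 t : 0 < height t.
Proof. by apply: lt_le_trans (height_ge t); rewrite ltr_wpDr. Qed.

Lemma height'_le1 t : `|height' t| <= 1.
Proof.
have := ramp'_ge0 (t - 1); have := ramp'_ge0 (- t - 1).
have := ramp'_le1 (t - 1); have := ramp'_le1 (- t - 1); rewrite /height' ler_norml.
by move=> *; apply/andP; split; lra.
Qed.

Lemma cinf_opp : cinf (fun t : R => - t - 1).
Proof.
apply: cinf_add; last exact: cinf_cst.
have := cinf_mul (cinf_cst (- 1 : R)) (cinf_id R).
by under eq_fun do rewrite mulN1r.
Qed.

Lemma cinf_height : cinf height.
Proof.
apply: cinf_add; last exact: (cinf_comp cinf_ramp cinf_opp).
apply: cinf_add; first exact: cinf_cst.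
by apply: (cinf_comp cinf_ramp); apply: cinf_add; [exact: cinf_id|exact: cinf_cst].
Qed.

Lemma cinf_atan : cinf (@atan R).
Proof.
apply: (@cinf_prim _ _ (fun t => (1 + t ^+ 2)^-1) (fun t => is_derive1_atan t)).
apply: cinf_inv => [t|]; first by rewrite gt_eqF// ltr_wpDr// sqr_ge0.
apply: cinf_add; first exact: cinf_cst.
under eq_fun do rewrite expr2.
by apply: cinf_mul; exact: cinf_id.
Qed.

(** The angle between (x_1, height x_3) and the vertical. It increases by pi along
    the strip, and away from the core its gradient has size 1 / r, like that of the
    polar angle. *)
Definition angle x : R := atan (x.1 * (height x.2)^-1).

Definition cutoff M t : R := plateau (- M) M M^-1 t.
Definition cutoff' M t : R := plateau' (- M) M M^-1 t.

Definition profile M x : R := angle x * (cutoff M x.1 * cutoff M x.2).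

Definition angle1 x : R := height x.2 / (x.1 ^+ 2 + height x.2 ^+ 2).
Definition angle3 x : R := - (x.1 * height' x.2 / (x.1 ^+ 2 + height x.2 ^+ 2)).

Lemma angle_den x : 0 < x.1 ^+ 2 + height x.2 ^+ 2.
Proof. by rewrite ltr_wpDl ?sqr_ge0// exprn_gt0// height_gt0. Qed.

Lemma is_derive_angle1 s t : is_derive s 1 (fun s => angle (s, t)) (angle1 (s, t)).
Proof.
have d1 : is_derive s 1 (fun s => s * (height t)^-1) (height t)^-1.
  have dd := is_deriveM (is_derive_id s 1) (is_derive_cst (height t)^-1 s 1).
  by apply: (is_derive_eq dd); rewrite /GRing.scale/= mulr0 add0r mulr1.
have dd := @is_derive1_comp _ (@atan R) _ s _ _ (is_derive1_atan _) d1.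
apply: (is_derive_eq dd); rewrite /angle1/=.
have h0 := height_gt0 t; have h1 := angle_den (s, t); rewrite /= in h1.
move: (height t) h0 h1 => h h0 h1; field.
by rewrite !gt_eqF//= addrC.
Qed.

Lemma is_derive_angle3 s t : is_derive t 1 (fun t => angle (s, t)) (angle3 (s, t)).
Proof.
have hn : height t != 0 by rewrite gt_eqF// height_gt0.
have d1 := is_deriveM (is_derive_cst (s : R) t 1) (is_deriveV hn (is_derive_height t)).
have dd := @is_derive1_comp _ (@atan R) _ t _ _ (is_derive1_atan _) d1.
apply: (is_derive_eq dd); rewrite mulrfctE /angle3 /GRing.scale/=.
have h0 := height_gt0 t; have h1 := angle_den (s, t); rewrite /= in h1.
move: (height t) (height' t) h0 h1 => h h' h0 h1; field.
by rewrite !gt_eqF//= addrC.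
Qed.

Lemma cinf2_profile M : cinf2 (profile M).
Proof.
apply: cinf2_mul.
  apply: (cinf2_comp cinf_atan); apply: cinf2_mul; first exact: (cinf2_fst (cinf_id R)).
  apply: (cinf2_snd (f := fun t => (height t)^-1)); apply: cinf_inv; last exact: cinf_height.
  by move=> t; rewrite gt_eqF// height_gt0.
apply: cinf2_mul; [apply: cinf2_fst|apply: cinf2_snd]; exact: cinf_plateau.
Qed.

Lemma is_derive_cutoff M t : 0 < M -> is_derive t 1 (cutoff M) (cutoff' M t).
Proof.
move=> M0; have MM : - M <= M by lra.
have Mi : 0 < M^-1 by rewrite invr_gt0.
exact: (is_derive_plateau t MM Mi).
Qed.

Lemma partial1_profile M x : 0 < M -> partial 0 (profile M) x =
  angle1 x * (cutoff M x.1 * cutoff M x.2) + angle x * (cutoff' M x.1 * cutoff M x.2).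
Proof.
case: x => s t M0.
have dc := is_deriveM (is_derive_cutoff s M0) (is_derive_cst (cutoff M t) s 1).
have dd := is_deriveM (is_derive_angle1 s t) dc.
have dp : is_derive s 1 (fun s => profile M (s, t))
    (angle1 (s, t) * (cutoff M s * cutoff M t) + angle (s, t) * (cutoff' M s * cutoff M t)).
  apply: (is_derive_eq dd); rewrite mulrfctE /GRing.scale/=.
  move: (angle1 _) (angle _) (cutoff M s) (cutoff M t) (cutoff' M s) => *.
  by ring.
by have [_ ] := (is_derive_slice1 (profile M) s t _).2 dp.
Qed.

Lemma partial3_profile M x : 0 < M -> partial 1 (profile M) x =
  angle3 x * (cutoff M x.1 * cutoff M x.2) + angle x * (cutoff M x.1 * cutoff' M x.2).
Proof.
case: x => s t M0.
have dc := is_deriveM (is_derive_cst (cutoff M s) t 1) (is_derive_cutoff t M0).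
have dd := is_deriveM (is_derive_angle3 s t) dc.
have dp : is_derive t 1 (fun t => profile M (s, t))
    (angle3 (s, t) * (cutoff M s * cutoff M t) + angle (s, t) * (cutoff M s * cutoff' M t)).
  apply: (is_derive_eq dd); rewrite mulrfctE /GRing.scale/=.
  move: (angle3 _) (angle _) (cutoff M s) (cutoff M t) (cutoff' M t) => *.
  by ring.
by have [_ ] := (is_derive_slice2 (profile M) s t _).2 dp.
Qed.

Lemma cutoff_out M t : 0 < M -> ~ (- (3 * M) <= t <= 3 * M) -> cutoff M t = 0.
Proof.
move=> M0 nt; rewrite /cutoff plateau0 ?invr_gt0//; rewrite invrK => h; apply: nt.
by move: h => /andP[? ?]; apply/andP; split; lra.
Qed.

Lemma cutoff'_out M t : 0 < M -> ~ (- (3 * M) <= t <= 3 * M) -> cutoff' M t = 0.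
Proof.
move=> M0 nt; rewrite /cutoff' plateau'0 ?invr_gt0//; last by lra.
right; rewrite invrK => h; apply: nt.
by move: h => /andP[? ?]; apply/andP; split; lra.
Qed.

Lemma cutoff_in M t : 0 < M -> - M <= t <= M -> cutoff M t = 1.
Proof. by move=> M0 tM; rewrite /cutoff plateau1 ?invr_gt0. Qed.

Lemma cutoff'_in M t : 0 < M -> - M <= t <= M -> cutoff' M t = 0.
Proof.
move=> M0 tM; rewrite /cutoff' plateau'0 ?invr_gt0//; last by lra.
by left.
Qed.

Lemma cutoff'_le M t : 0 < M -> `|cutoff' M t| <= slope / M.
Proof. by move=> M0; rewrite plateau'_le ?invr_gt0//; lra. Qed.

Lemma cutoff_01 M t : 0 <= cutoff M t <= 1.
Proof. by rewrite plateau_ge0 plateau_le1. Qed.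

Lemma angle_le x : `|angle x| <= 2.
Proof.
rewrite /angle ler_norml.
have := atan_gtNpi2 (x.1 / height x.2); have := atan_ltpi2 (x.1 / height x.2).
have := @pihalf_lt2 R; move: (atan _) (pi / 2) => u p.
by move=> *; apply/andP; split; lra.
Qed.

Lemma profile_box M : 0 < M -> box_supported (3 * M) (profile M).
Proof.
move=> M0 [s t] nb; rewrite /profile/=.
have [hs|hs] := pselect (- (3 * M) <= s <= 3 * M); last first.
  by rewrite cutoff_out// mul0r mulr0.
rewrite (cutoff_out (t := t))// ?mulr0// => ht; apply: nb.
by split; rewrite /= in_itv.
Qed.

Lemma test_fun_profile M : 0 < M -> test_fun setT (profile M).
Proof.
move=> M0; apply: (test_fun_support (cinf2_smooth (cinf2_profile M)) (@compact_box R (3 * M))) => //.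
exact: profile_box.
Qed.

(** Dominates the energy density of the angle function, since height has slope at
    most 1. *)
Definition angle_energy x : R := (x.1 ^+ 2 + height x.2 ^+ 2)^-1.

Lemma angle_gradient x : angle1 x ^+ 2 + angle3 x ^+ 2 <= angle_energy x.
Proof.
rewrite /angle1 /angle3 /angle_energy sqrrN; have D0 := angle_den x.
have := height'_le1 x.2; rewrite ler_norml => /andP[h1 h2].
set D := x.1 ^+ 2 + height x.2 ^+ 2 in D0 *.
rewrite !expr_div_n -mulrDl exprMn ler_pdivrMr ?exprn_gt0//.
have -> : D^-1 * D ^+ 2 = D by field; rewrite gt_eqF.
rewrite /D addrC lerD2r.
by rewrite ler_piMr ?sqr_ge0//; nra.
Qed.

(** Young's inequality separates the angle function from the cutoffs, whose
    gradients are of order 1 / M on a box of size M. *)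
Lemma profile_gradient M e x : 0 < M -> 0 < e ->
  partial 0 (profile M) x ^+ 2 + partial 1 (profile M) x ^+ 2 <=
  (1 + e) * angle_energy x + (1 + e^-1) * (8 * slope ^+ 2 / M ^+ 2).
Proof.
move=> M0 e0; rewrite partial1_profile// partial3_profile//.
have young (a b : R) : (a + b) ^+ 2 <= (1 + e) * a ^+ 2 + (1 + e^-1) * b ^+ 2.
  rewrite -subr_ge0.
  have -> : (1 + e) * a ^+ 2 + (1 + e^-1) * b ^+ 2 - (a + b) ^+ 2 = e^-1 * (e * a - b) ^+ 2.
    by field; rewrite gt_eqF.
  by rewrite mulr_ge0 ?sqr_ge0// invr_ge0 ltW.
have ei : 0 < e^-1 by rewrite invr_gt0.
have /andP[c1 c1'] := cutoff_01 M x.1; have /andP[c3 c3'] := cutoff_01 M x.2.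
have small (a u v : R) : 0 <= u <= 1 -> 0 <= v <= 1 -> (a * (u * v)) ^+ 2 <= a ^+ 2.
  move=> /andP[u0 u1] /andP[v0 v1]; rewrite exprMn ler_piMr ?sqr_ge0//.
  by rewrite exprn_ile1// ?mulr_ge0// mulr_ile1.
have cut (u v : R) : `|u| <= slope / M -> 0 <= v <= 1 ->
    (angle x * (u * v)) ^+ 2 <= 4 * slope ^+ 2 / M ^+ 2.
  move=> uM v01; apply: le_trans (_ : (angle x * u) ^+ 2 <= _).
    have := small (angle x * u) 1 v; rewrite ler01 lexx mul1r mulrA; exact.
  rewrite exprMn (_ : 4 * slope ^+ 2 / M ^+ 2 = 2 ^+ 2 * (slope / M) ^+ 2); last first.
    by rewrite expr_div_n; ring.
  rewrite -(real_normK (num_real (angle x))) -(real_normK (num_real u)).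
  by apply: ler_pM; rewrite ?sqr_ge0// lerXn2r ?nnegrE// ?angle_le// (le_trans _ uM).
have y1 := young (angle1 x * (cutoff M x.1 * cutoff M x.2)) (angle x * (cutoff' M x.1 * cutoff M x.2)).
have y3 := young (angle3 x * (cutoff M x.1 * cutoff M x.2)) (angle x * (cutoff M x.1 * cutoff' M x.2)).
have s1 := small (angle1 x) _ _ (cutoff_01 M x.1) (cutoff_01 M x.2).
have s3 := small (angle3 x) _ _ (cutoff_01 M x.1) (cutoff_01 M x.2).
have k1 := cut _ _ (cutoff'_le x.1 M0) (cutoff_01 M x.2).
have k3 := cut _ _ (cutoff'_le x.2 M0) (cutoff_01 M x.1).
rewrite (mulrC (cutoff' M x.2)) in k3.
have ag := angle_gradient x.
apply: le_trans (lerD y1 y3) _.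
have e1 : 0 <= 1 + e by rewrite addr_ge0// ltW.
have e2 : 0 <= 1 + e^-1 by rewrite addr_ge0// ltW.
have t1 := ler_wpM2l e1 (le_trans (lerD s1 s3) ag).
have t2 := ler_wpM2l e2 (lerD k1 k3).
rewrite mulrDr in t1; rewrite mulrDr in t2.
have -> : 8 * slope ^+ 2 / M ^+ 2 = 4 * slope ^+ 2 / M ^+ 2 + 4 * slope ^+ 2 / M ^+ 2 :> R.
  by rewrite -mulrDl -mulrDl; congr (_ * _ / _); ring.
by apply: le_trans (lerD t1 t2); rewrite addrACA.
Qed.

End profile.

(** * Logarithmic bound for the energy of the profile *)

Section profile_energy.
Variable R : realType.
Implicit Types (s t M L e : R) (x : R * R).
Local Notation mu := (@lebesgue_measure R).
Local Notation mu2 := (@mu2 R).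

Lemma continuous_angle_energy : continuous (@angle_energy R).
Proof.
apply: cinf2_continuous.
have c2 : cinf (fun t : R => t ^+ 2).
  under eq_fun do rewrite expr2.
  by apply: cinf_mul; exact: cinf_id.
have -> : @angle_energy R = (fun x => (height x.2)^-1 * (height x.2)^-1 *
    ((1 + (x.1 * (height x.2)^-1) ^+ 2)^-1)).
  apply/funext => -[s t]; rewrite /angle_energy/=.
  have h0 := height_gt0 t; have h1 := angle_den (s, t); rewrite /= in h1.
  by move: (height t) h0 h1 => h h0 h1; field; rewrite !gt_eqF//= addrC.
have ch : cinf (fun t : R => (height t)^-1).
  by apply: cinf_inv; [move=> t; rewrite gt_eqF// height_gt0|exact: cinf_height].
apply: cinf2_mul; first exact: (cinf2_snd (cinf_mul ch ch)).
apply: (cinf2_comp (f := fun t => (1 + t ^+ 2)^-1)).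
  apply: cinf_inv; first by move=> t; rewrite gt_eqF// ltr_wpDr// sqr_ge0.
  by apply: cinf_add; first exact: cinf_cst.
apply: cinf2_mul; first exact: (cinf2_fst (cinf_id R)).
exact: (cinf2_snd ch).
Qed.

Lemma angle_energy_ge0 x : 0 <= angle_energy x.
Proof. by rewrite invr_ge0 ltW// angle_den. Qed.

Lemma integral_angle_energy_slice t L : 0 < L ->
  (\int[mu]_(s in `[(- L)%R, L]) (angle_energy (s, t))%:E <= (pi / height t)%:E)%E.
Proof.
move=> L0; have h0 := height_gt0 t.
have dd s : is_derive s 1 (fun s => angle (s, t) * (height t)^-1) (angle_energy (s, t)).
  have dd := is_deriveM (is_derive_angle1 s t) (is_derive_cst (height t)^-1 s 1).
  apply: (is_derive_eq dd); rewrite /GRing.scale/= mulr0 add0r /angle1 /angle_energy/=.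
  by rewrite mulrA mulVf ?mul1r// gt_eqF.
have cs : continuous (fun s => angle_energy (s, t)).
  exact: (continuous_slice1 continuous_angle_energy).
rewrite (FTC_is_derive _ dd cs); last by lra.
rewrite lee_fin -mulrBl ler_wpM2r ?invr_ge0 ?(ltW h0)// /angle.
have := atan_ltpi2 (L / height t); have := atan_gtNpi2 (- L / height t).
by rewrite /=; move: (atan _) (atan _) => u v; lra.
Qed.

Lemma sqrt_one_sqr_gt t : `|t| < Num.sqrt (1 + t ^+ 2).
Proof.
rewrite -sqrtr_sqr ltr_sqrt; first by rewrite ltrDr.
by rewrite ltr_wpDr// sqr_ge0.
Qed.

Lemma is_derive_asinh t : is_derive t 1 (fun t => ln (t + Num.sqrt (1 + t ^+ 2)))
  (Num.sqrt (1 + t ^+ 2))^-1.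
Proof.
have q0 : 0 < 1 + t ^+ 2 by rewrite ltr_wpDr// sqr_ge0.
have S0 : 0 < Num.sqrt (1 + t ^+ 2) by rewrite sqrtr_gt0.
have p0 : 0 < t + Num.sqrt (1 + t ^+ 2).
  by have := sqrt_one_sqr_gt t; rewrite ltr_norml => /andP[]; move: (Num.sqrt _) => u; lra.
have d1 : is_derive t 1 (fun t => 1 + t ^+ 2 : R) (2 * t).
  have := is_deriveM (is_derive_id t 1) (is_derive_id t (1 : R)) => d0.
  have dd := is_deriveD (is_derive_cst (1 : R) t 1) d0.
  by apply: (is_derive_eq dd); rewrite /GRing.scale/= mulr1 add0r; lra.
have d2 := @is_derive1_comp _ (@Num.sqrt R) _ t _ _ (is_derive1_sqrt q0) d1.
have d3 := is_deriveD (is_derive_id t 1) d2.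
have dd := @is_derive1_comp _ (@ln R) _ t _ _ (is_derive1_ln p0) d3.
apply: (is_derive_eq dd); rewrite /=.
by move: (Num.sqrt _) S0 p0 => S S0 p0; field; rewrite !gt_eqF.
Qed.

Lemma continuous_inv_sqrt : continuous (fun t : R => (Num.sqrt (1 + t ^+ 2))^-1).
Proof.
move=> t; apply: cvgV; first by rewrite gt_eqF// sqrtr_gt0 ltr_wpDr// sqr_ge0.
apply: (@continuous_comp _ _ _ (fun t : R => 1 + t ^+ 2) Num.sqrt).
  by apply: cvgD; [exact: cvg_cst|exact: exprn_continuous].
exact: sqrt_continuous.
Qed.

Lemma integral_inv_sqrt L : 0 < L ->
  (\int[mu]_(t in `[(- L)%R, L]) ((Num.sqrt (1 + t ^+ 2))^-1)%:E <=
   (2 * ln (1 + 2 * L))%:E)%E.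
Proof.
move=> L0.
rewrite (FTC_is_derive _ is_derive_asinh continuous_inv_sqrt); last by lra.
have q0 : 0 <= 1 + L ^+ 2 by rewrite addr_ge0// sqr_ge0.
have := sqrt_one_sqr_gt L; rewrite sqrrN gtr0_norm//.
have := sqr_sqrtr q0; have : 0 <= Num.sqrt (1 + L ^+ 2) by exact: sqrtr_ge0.
move: (Num.sqrt _) => S S0 SS SL.
have -> : - L + S = (L + S)^-1.
  apply: (mulfI (_ : L + S != 0)); first by rewrite gt_eqF//; lra.
  by rewrite divff ?gt_eqF//; [nra|lra].
rewrite lnV ?posrE; last by lra.
have : ln (L + S) <= ln (1 + 2 * L) by rewrite ler_ln ?posrE; [nra|lra|lra].
by rewrite lee_fin; lra.
Qed.

Lemma inv_height_le t : pi / height t <= pi * (Num.sqrt (1 + t ^+ 2))^-1.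
Proof.
rewrite ler_wpM2l ?pi_ge0// lef_pV2 ?posrE ?height_gt0//; last first.
  by rewrite sqrtr_gt0 ltr_wpDr// sqr_ge0.
apply: le_trans (height_ge t); rewrite -[leRHS]ger0_norm ?addr_ge0//.
rewrite -sqrtr_sqr ler_sqrt ?sqr_ge0// -(real_normK (num_real t)).
by have := normr_ge0 t; move: (`|t|) => u; nra.
Qed.

(** The integral over x_1 is at most pi / height x_3, and height x_3 grows like
    |x_3|: this is where the logarithm comes from. *)
Lemma integral_angle_energy_box L : 0 < L ->
  (\int[mu2]_(x in box L) (angle_energy x)%:E <= (2 * pi * ln (1 + 2 * L))%:E)%E.
Proof.
move=> L0; have mE := continuous_measurable_plane continuous_angle_energy.
pose f : R * R -> \bar R := (fun x => (angle_energy x)%:E) \_ (box L).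
have f0 x : (0 <= f x)%E.
  by rewrite /f /patch; case: ifP => // _; rewrite lee_fin angle_energy_ge0.
have mf : measurable_fun setT f.
  apply/(measurable_restrictT _ (@measurable_box R L)).
  by apply/measurable_EFinP; exact: measurable_funTS.
rewrite integral_mkcond -/f (@fubini_tonelli2 _ _ _ _ R mu mu f mf f0).
apply: (@le_trans _ _ (\int[mu]_(t in `[(- L)%R, L]) (pi * (Num.sqrt (1 + t ^+ 2))^-1)%:E)%E).
  rewrite [leRHS]integral_mkcond; apply: ge0_le_integral => //.
  - by move=> t _; exact: integral_ge0.
  - exact: measurable_fun_fubini_tonelli_G.
  - apply/(measurable_restrictT _ (measurable_itv `[(- L)%R, L])).
    apply: measurable_funTS; apply/measurable_EFinP; apply: measurable_funM => //.
    exact: continuous_measurable_fun continuous_inv_sqrt.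
  - move=> t _; rewrite /fubini_G /patch; case: ifPn => [|/negP]; rewrite inE/= => It.
      apply: (@le_trans _ _ (pi / height t)%:E); last by rewrite lee_fin inv_height_le.
      apply: le_trans (integral_angle_energy_slice t L0).
      rewrite [leRHS]integral_mkcond le_eqVlt; apply/orP; left; apply/eqP.
      apply: eq_integral => s _; rewrite /f /patch.
      have [Is|Is] := pselect (`[(- L)%R, L]%classic s).
        by rewrite (mem_set Is) mem_set//; split.
      by rewrite (memNset Is) memNset// => -[].
    by rewrite integral0_eq// => s _; rewrite /f /patch memNset// => -[_ /= /It].
under eq_integral do rewrite EFinM.
rewrite ge0_integralZl_EFin//; last 2 first.
- apply: measurable_funTS; apply/measurable_EFinP.
  exact: continuous_measurable_fun continuous_inv_sqrt.
- exact: pi_ge0.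
apply: (@le_trans _ _ (pi%:E * (2 * ln (1 + 2 * L))%:E)%E).
  by apply: lee_wpmul2l; [rewrite lee_fin pi_ge0|exact: integral_inv_sqrt].
by rewrite -EFinM lee_fin le_eqVlt; apply/orP; left; apply/eqP; ring.
Qed.

Lemma angle_energy_le1 x : angle_energy x <= 1.
Proof.
rewrite invf_le1 ?angle_den//.
have h : 1 <= height x.2 by apply: le_trans (height_ge x.2); rewrite lerDl.
by rewrite ler_wpDl ?sqr_ge0// expr_ge1// (le_trans _ h).
Qed.

(** The cutoffs contribute a bounded amount, as their gradients have size 1 / M on
    a set of area of order M^2. *)
Lemma profile_energy M e : 0 < M -> 0 < e ->
  \int[mu2]_x (partial 0 (profile M) x ^+ 2 + partial 1 (profile M) x ^+ 2) <=
  (1 + e) * (2 * pi * ln (1 + 6 * M)) + (1 + e^-1) * (288 * slope ^+ 2).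
Proof.
move=> M0 e0; pose B := box (3 * M).
have mB : measurable B by exact: measurable_box.
have M3 : 0 < 3 * M by rewrite mulr_gt0.
have sp := cinf2_smooth (cinf2_profile M).
have bp j := partial_box_supported j (profile_box M0).
have sB j : sqint mu2 B (partial j (profile M)).
  exact: (sqint_smooth (smooth_partial j sp) (bp j) mB).
rewrite -(@Rintegral_subset_eq _ B) => [||x _ nB]; [|by []|]; last first.
  by rewrite (bp 0 _ nB) (bp 1 _ nB) expr0n addr0.
have iP := @integrableD _ _ _ mu2 _ mB _ _ (sqint_integrable_sqr (sB 0)) (sqint_integrable_sqr (sB 1)).
have muB : mu2 B = (36 * M ^+ 2)%:E.
  by rewrite /B /box mu2_rect//; [congr EFin; ring|lra|lra].
have muBoo : (mu2 B < +oo)%E by rewrite muB ltry.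
have iW : mu2.-integrable B (fun x => (angle_energy x)%:E).
  apply: (@bounded_integrable _ _ _ mu2 _ _ 1 mB muBoo).
    by apply: measurable_funTS; exact: continuous_measurable_plane continuous_angle_energy.
  by move=> x _; rewrite ger0_norm ?angle_energy_ge0// angle_energy_le1.
set c := (1 + e^-1) * (8 * slope ^+ 2 / M ^+ 2).
have ic : mu2.-integrable B (fun=> c%:E).
  apply: (@bounded_integrable _ _ _ mu2 _ _ `|c| mB muBoo) => //.
have iW1 := @integrableZl _ _ _ mu2 _ mB (1 + e) _ iW.
have iWc := @integrableD _ _ _ mu2 _ mB _ _ iW1 ic.
apply: (@le_trans _ _ (\int[mu2]_(x in B) ((1 + e) * angle_energy x + c))).
  apply: (@le_Rintegral _ _ _ mu2 _ _ _ mB iP iWc) => x _.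
  exact: profile_gradient.
rewrite (@RintegralD _ _ _ mu2 _ _ _ mB iW1 ic) (@RintegralZl _ _ _ mu2 _ _ _ mB iW).
apply: lerD.
  rewrite ler_wpM2l ?addr_ge0 ?(ltW e0)//.
  have := integral_angle_energy_box M3.
  rewrite -[leLHS](fineK (@integrable_fin_num _ _ _ mu2 _ mB _ iW)) lee_fin.
  by rewrite mulrA (_ : 2 * 3 = 6)//; lra.
rewrite (@Rintegral_cst _ _ _ mu2 _ mB).
set A := (X in fine X); have -> : A = (36 * M ^+ 2)%:E by exact: muB.
rewrite /= /c.
by rewrite le_eqVlt; apply/orP; left; apply/eqP; field; rewrite gt_eqF//= gt_eqF.
Qed.

End profile_energy.

(** * Lower bound for the stray field energy *)

Section stray_lower_bound.
Variable R : realType.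
Implicit Types (s t M c : R) (x : R * R) (m : 'I_3 -> R * R -> R).
Local Notation mu := (@lebesgue_measure R).
Local Notation mu2 := (@mu2 R).
Local Notation sqfieldT := (@sqfield _ _ R mu2 setT 2).
Local Notation innerT := (@inner _ _ R mu2 setT 2).

Lemma sqint_field_energy (h : 'I_2 -> R * R -> R) : sqfieldT h ->
  (\int[mu2]_x (\sum_(j < 2) h j x ^+ 2)%:E)%E = (innerT h h)%:E.
Proof.
move=> sh; rewrite inner2E// /Rintegral fineK.
  apply: eq_integral => x _; rewrite big_ord_recl big_ord1.
  have -> : lift ord0 ord0 = 1 :> 'I_2 by exact: val_inj.
  by rewrite !expr2.
have i0 := sqint_integrable_mul measurableT (sh 0) (sh 0).
have i1 := sqint_integrable_mul measurableT (sh 1) (sh 1).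
exact: (@integrable_fin_num _ _ _ mu2 _ measurableT _
  (@integrableD _ _ _ mu2 _ measurableT _ _ i0 i1)).
Qed.

Lemma profile_strip M x : 1 <= M -> @Omega R x ->
  partial 0 (profile M) x = angle1 (x.1, 0) * cutoff M x.1 + angle (x.1, 0) * cutoff' M x.1
  /\ partial 1 (profile M) x = 0.
Proof.
case: x => s t M1 /andP[/= t1 t2]; have M0 : 0 < M by lra.
have tt : -1 <= t <= 1 by rewrite !ltW.
have tM : - M <= t <= M by apply/andP; split; lra.
have z1 : -1 <= (0 : R) <= 1 by apply/andP; split; lra.
rewrite partial1_profile// partial3_profile//= (cutoff_in M0 tM) (cutoff'_in M0 tM).
rewrite /angle3 /angle1 /angle/= (height'_strip tt) (height_strip tt) (height_strip z1).
by rewrite !mulr0 !mulr1 mul0r oppr0 mul0r addr0.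
Qed.

(** The profile does not depend on x_3 in the strip, so that testing the equation
    of the stray field h with it only involves m_1 - cos alpha; the bound is then
    the nonnegativity of |h + c grad profile|^2. *)
Lemma stray_lower_bound m (alpha c M : R) : X alpha m -> 1 <= M ->
  ((2 * c * \int[mu2]_(x in @Omega R) ((m 0 x - cos alpha) * partial 0 (profile M) x) -
    c ^+ 2 * \int[mu2]_x (partial 0 (profile M) x ^+ 2 + partial 1 (profile M) x ^+ 2))%:E
   <= \int[mu2]_x (\sum_(j < 2) stray_field m j x ^+ 2)%:E)%E.
Proof.
move=> Xm M1; have M0 : 0 < M by lra.
have [sh0 divh _] := stray_fieldP Xm; have [H1m _] := Xm.
set h := stray_field m in sh0 divh *; have sh : sqfieldT h by exact: sh0.
have mO := @measurable_strip R.
have tp := test_fun_profile M0; have sg := sqfield_gradient tp.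
have sp := cinf2_smooth (cinf2_profile M).
have bp := profile_box M0.
have mg : sqfieldT (lincomb 1 h c (fun j => partial j (profile M))).
  exact: sqfield_lincomb.
have GE : innerT (fun j => partial j (profile M)) (fun j => partial j (profile M)) =
  \int[mu2]_x (partial 0 (profile M) x ^+ 2 + partial 1 (profile M) x ^+ 2).
  by rewrite inner2E//; apply: eq_Rintegral => x _; rewrite !expr2.
have TE : innerT h (fun j => partial j (profile M)) =
  - \int[mu2]_(x in @Omega R) ((m 0 x - cos alpha) * partial 0 (profile M) x).
  have ip : mu2.-integrable (@Omega R) (fun x => (partial 0 (profile M) x)%:E).
    apply: (integrable_smooth (L := 3 * M)) => //; first exact: smooth_partial.
    exact: partial_box_supported.
  have c1 : `|cos alpha| <= 1 by rewrite ler_norml cos_geN1 cos_le1.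
  have [iw _] := strip_bounded_mul 0 H1m c1 ip.
  have strip0 := integral_partial1_Omega tp.
  pose u x := (m 0 x - cos alpha) * partial 0 (profile M) x.
  have toT (f : R * R -> R) : mu2.-integrable (@Omega R) (fun x => (f x)%:E) ->
      mu2.-integrable setT (fun x => ((f \_ (@Omega R)) x)%:E).
    move=> fi; have -> : (fun x => ((f \_ (@Omega R)) x)%:E) = (EFin \o (f \_ (@Omega R))) by [].
    by rewrite -restrict_EFin; apply: (@integrable_mkcond _ _ _ mu2 _ _ mO).1.
  have iu := toT u iw; have ip1 := toT _ ip.
  have ipc := @integrableZl _ _ _ mu2 _ measurableT (cos alpha) _ ip1.
  have i0 := @sqint_integrable_mul _ _ _ mu2 _ _ _ measurableT (sh 0) (sg 0).
  have i1 := @sqint_integrable_mul _ _ _ mu2 _ _ _ measurableT (sh 1) (sg 1).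
  have i01 := @integrableD _ _ _ mu2 _ measurableT _ _ i0 i1.
  have i2 := @integrableD _ _ _ mu2 _ measurableT _ _ i01 iu.
  have eq1 : \int[mu2]_x ((h 0 x + (prime_part m 0 \_ (@Omega R)) x) * partial 0 (profile M) x +
        (h 1 x + (prime_part m 1 \_ (@Omega R)) x) * partial 1 (profile M) x) =
      \int[mu2]_x (((h 0 x * partial 0 (profile M) x + h 1 x * partial 1 (profile M) x) +
        (u \_ (@Omega R)) x) + cos alpha * (partial 0 (profile M) \_ (@Omega R)) x).
    apply: eq_Rintegral => x _; rewrite /u /prime_part /patch /=.
    have z0 : (point : R) = 0 by [].
    have p1 := (profile_strip (x := x) M1).
    have q1 : x \in @Omega R -> partial 1 (profile M) x = 0 by rewrite inE => /p1[].
    move: q1; move: (h 0 x) (h 1 x) (m 0 x) (m 2 x) (partial 0 _ x) (partial 1 _ x) (cos alpha).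
    clear -z0; move: (x \in _) => b a0 a1 m0 m2 d0 d1 ca; case: b => [/(_ isT) ->|_].
      by ring.
    by rewrite z0; ring.
  have := divh _ tp; rewrite eq1.
  rewrite (@RintegralD _ _ _ mu2 _ _ _ measurableT i2 ipc).
  rewrite (@RintegralD _ _ _ mu2 _ _ _ measurableT i01 iu).
  rewrite (@RintegralZl _ _ _ mu2 _ _ _ measurableT ip1).
  rewrite -(Rintegral_mkcond mu2 (@Omega R) (partial 0 (profile M))) strip0 mulr0 addr0.
  rewrite -(Rintegral_mkcond mu2 (@Omega R) u) -(inner2E sh sg) => /eqP.
  by rewrite addr_eq0 => /eqP.
rewrite (sqint_field_energy sh) lee_fin -GE.
have := inner_ge0 mu2 setT (lincomb 1 h c (fun j => partial j (profile M))).
rewrite (@inner_lincombl _ _ R mu2 setT measurableT 2 1 h c _ _ sh sg mg).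
rewrite (@inner_lincombr _ _ R mu2 setT measurableT 2 1 h c _ _ sh sg sh).
rewrite (@inner_lincombr _ _ R mu2 setT measurableT 2 1 h c _ _ sh sg sg).
rewrite (@innerC _ _ R mu2 setT 2 (fun j => partial j (profile M)) h) TE.
move: (innerT h h) (\int[mu2]_(x in _) _) (innerT _ _) => A T G.
lra.
Qed.

End stray_lower_bound.

(** * The kernel, and local convergence *)

Section strip_limit.
Variable R : realType.
Implicit Types (s t M c : R) (x : R * R) (m : 'I_3 -> R * R -> R).
Local Notation mu := (@lebesgue_measure R).
Local Notation mu2 := (@mu2 R).

Lemma continuous_angle1_strip : continuous (fun t : R => angle1 (t, 0)).
Proof.
have -> : (fun t : R => angle1 (t, 0)) = (fun t => 3 * angle_energy (t, 0)).
  by apply/funext => t; rewrite /angle1 /angle_energy/= height_strip//; apply/andP; split; lra.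
have ce := continuous_slice1 (t := 0) (@continuous_angle_energy R).
by move=> t; apply: cvgMl_tmp; exact: ce.
Qed.

(** The kernel is the derivative of an angle that increases by pi. *)
Lemma integral_angle1 : mu.-integrable setT (fun t => (angle1 (t, 0))%:E) /\
  \int[mu]_t angle1 (t, 0) = pi.
Proof.
have z1 : -1 <= (0 : R) <= 1 by apply/andP; split; lra.
have aE (t : R) : angle1 (t, 0) = 3 / (t ^+ 2 + 3 ^+ 2) by rewrite /angle1/= height_strip.
have a0 (t : R) : 0 <= angle1 (t, 0).
  by rewrite aE divr_ge0// addr_ge0// ?sqr_ge0// exprn_ge0.
have ca := continuous_angle1_strip.
have E : (\int[mu]_t (angle1 (t, 0))%:E)%E = (pi : R)%:E.
  rewrite (ge0_symfun_integralT (f := fun t : R => angle1 (t, 0)))//; last first.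
    by move=> t; rewrite /= !aE sqrrN.
  rewrite (_ : [set x | (0 <= x)%R] = `[0%R, +oo[%classic); last by rewrite set_itvcy.
  rewrite (@ge0_continuous_FTC2y _ (fun t => angle1 (t, 0)) (fun t => angle (t, 0)) 0 (pi / 2))//.
  - by rewrite /angle/= mul0r atan0 sube0 -EFinM; congr EFin; field.
  - exact: continuous_subspaceT.
  - rewrite /angle/=; apply: cvg_comp; last exact: cvgy_atan.
    rewrite height_strip//; apply/cvgryPge => A; near=> t.
    by rewrite ler_pdivlMr//; near: t; exact: nbhs_pinfty_ge.
  - by move=> t _; have [] := is_derive_angle1 t 0.
  - apply: cvg_at_right_filter.
    exact: (is_derive1_continuous (fun t => is_derive_angle1 t (0 : R))).
  - by move=> t _; rewrite derive1E; have [] := is_derive_angle1 t 0.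
split; last by rewrite /Rintegral E.
apply/integrableP; split; first by apply/measurable_EFinP; exact: continuous_measurable_fun.
under eq_integral do rewrite gee0_abs ?lee_fin//.
by rewrite E ltry.
Unshelve. all: by end_near. Qed.

Lemma H1dot_S2_sqint_finite m i (K : set (R * R)) : H1dot_S2 m -> measurable K ->
  K `<=` @Omega R -> (mu2 K < +oo)%E -> sqint mu2 K (m i).
Proof.
move=> H1m mK KO Koo; have mm := measurable_funS (@measurable_strip R) KO (H1dot_S2_measurable i H1m).
have [m1 i1] : sqint mu2 K (cst 1).
  by apply: (@bounded_sqint _ _ _ mu2 _ _ 1 mK Koo) => // x _; rewrite normr1.
split => //; apply: le_lt_trans i1.
apply: (@ae_ge0_le_integral _ _ _ mu2) => //.
- by move=> x _; rewrite lee_fin sqr_ge0.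
- by apply/measurable_EFinP; exact: measurable_funX.
- by move=> x _; rewrite lee_fin sqr_ge0.
- by apply/measurable_EFinP; exact: measurable_funX.
- have := ae_H1dot_S2_le1 H1m; apply: ae_plane_mono => x h /KO Ox.
  have := h Ox i; rewrite lee_fin ler_norml => /andP[h1 h2].
  by rewrite /cst expr1n; move: (m i x) h1 h2 => y h1 h2; nra.
Qed.

(** Local convergence is enough here, since the test function lives on a compact
    subset of the strip. *)
Lemma cvg_local_test m (m_ : R -> 'I_3 -> R * R -> R) i (K : set (R * R)) (psi : R * R -> R) :
  (forall eta, 0 < eta < 1 -> H1dot_S2 (m_ eta)) -> H1dot_S2 m -> weak_cvg_H1dot m_ m ->
  compact K -> K `<=` @Omega R -> (mu2 K < +oo)%E -> measurable K ->
  sqint mu2 K psi -> (forall x, @Omega R x -> ~ K x -> psi x = 0) ->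
  \int[mu2]_(x in @Omega R) (m_ eta i x * psi x) @[eta --> 0^'+] -->
  \int[mu2]_(x in @Omega R) (m i x * psi x).
Proof.
move=> Hm_ Hm [_ loc] cK KO Koo mK spsi psi0.
have EK (f : R * R -> R) : \int[mu2]_(x in @Omega R) (f x * psi x) = \int[mu2]_(x in K) (f x * psi x).
  by apply/esym; apply: Rintegral_subset_eq => // x Ox nK; rewrite psi0// mulr0.
rewrite EK; under eq_fun do rewrite EK.
have sK m' (H1m : H1dot_S2 m') j : sqint mu2 K (m' j) by exact: H1dot_S2_sqint_finite.
have near_ : \forall eta \near (0 : R)^'+, 0 < eta < 1.
  near=> eta; apply/andP; split; first by near: eta; exact: nbhs_right_gt.
  by near: eta; exact: nbhs_right_lt.
apply: (@cvg_integral_mul _ _ _ mu2 _ mK) => //.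
- by apply: filterS near_ => eta /Hm_ H1; exact: sK.
- exact: sK.
suff h : (\int[mu2]_(x in K) ((m_ eta i x - m i x) ^+ 2)%:E)%E @[eta --> 0^'+] --> 0%:E.
  exact: (fine_cvg h).
apply: (@squeeze_cvge _ _ _ _ (cst 0%E) _ (fun eta => \int[mu2]_(x in K) (\sum_(j < 3) (m_ eta j x - m j x) ^+ 2)%:E)%E).
- apply: filterS near_ => eta /Hm_ H1; apply/andP; split.
    by apply: integral_ge0 => x _; rewrite lee_fin sqr_ge0.
  have mB j : measurable_fun K (fun x => (m_ eta j x - m j x) ^+ 2).
    by apply: measurable_funX; apply: measurable_funB; exact: (sK _ _ j).1.
  apply: ge0_le_integral => //.
  + by move=> x _; rewrite lee_fin sqr_ge0.
  + by apply/measurable_EFinP; exact: (mB i).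
  + by apply/measurable_EFinP; apply: measurable_sum => j; exact: (mB j).
  + move=> x _; rewrite lee_fin (bigD1 i)//= lerDl sumr_ge0// => j _.
    exact: sqr_ge0.
- exact: cvg_cst.
- exact: loc.
Unshelve. all: by end_near. Qed.

End strip_limit.

(** * Limit of the transition term *)

Section transition.
Variable R : realType.
Implicit Types (s t M c : R) (x : R * R) (m : 'I_3 -> R * R -> R).
Local Notation mu := (@lebesgue_measure R).
Local Notation mu2 := (@mu2 R).

Lemma integral_strip_fst (g : R -> R) : mu.-integrable setT (fun t => (g t)%:E) ->
  mu2.-integrable (@Omega R) (fun x => (g x.1)%:E) /\
  \int[mu2]_(x in @Omega R) g x.1 = 2 * \int[mu]_t g t.
Proof.
move=> ig; have mO := @measurable_strip R.
have m1 : measurable_fun setT (\1_(@Omega R) : R * R -> R) by exact: measurable_indic.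
have iT : mu2.-integrable setT (fun x => (\1_(@Omega R) x * g x.1)%:E).
  apply: (integrable_strip_mul (C := 1) ig m1) => x.
    by rewrite indicE; case: (_ \in _); rewrite ?normr1 ?normr0.
  by move=> nx; rewrite indicE memNset.
have iO := @integrableS _ _ _ mu2 _ _ _ measurableT mO (@subsetT _ _) iT.
split.
  by apply: eq_integrable iO => // x xO; rewrite indicE xO mul1r.
transitivity (\int[mu2]_x (\1_(@Omega R) x * g x.1)).
  rewrite Rintegral_mkcond; apply: eq_Rintegral => x _; rewrite /patch indicE.
  by case: ifPn => _; rewrite ?mul1r ?mul0r.
rewrite /Rintegral -(@integral12_prod_meas1 _ _ _ _ R mu mu _ iT).
have -> : 2 * fine (\int[mu]_t (g t)%:E)%E = fine (\int[mu]_t (2%:E * (g t)%:E))%E.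
  by rewrite (@integralZl _ _ _ mu _ measurableT _ ig 2) fineM//; exact: integrable_fin_num ig.
congr fine; apply: eq_integral => t _; rewrite /fubini_F/=.
transitivity (\int[mu]_(s in `](-1)%R, 1%R[) (g t)%:E)%E.
  rewrite [RHS]integral_mkcond; apply: eq_integral => s _; rewrite /patch indicE.
  rewrite (_ : ((t, s) \in @Omega R) = (s \in `](-1)%R, 1%R[%classic)).
    by case: ifPn => _; rewrite ?mul1r ?mul0r.
  by apply/idP/idP; rewrite !inE.
rewrite (@integral_cst _ _ _ mu _ (@measurable_unit_interval R) (g t)%:E) muleC.
by set A := (X in (X * _)%E); have -> : A = 2%:E by exact: mu_unit_interval.
Qed.

(** Cutoffs supported in compact subsets of the strip, where the maps
    converge strongly. *)
Definition exhaust (n : nat) x : R := cutoff n.+1%:R x.1 * strip_cutoff n x.2.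

Lemma exhaust_01 n x : 0 <= exhaust n x <= 1.
Proof.
have /andP[c0 c1] := cutoff_01 n.+1%:R x.1.
have s0 : 0 <= strip_cutoff n x.2 by exact: plateau_ge0.
have s1 : strip_cutoff n x.2 <= 1 by exact: plateau_le1.
by rewrite /exhaust; apply/andP; split; [exact: mulr_ge0 c0 s0|exact: mulr_ile1 c0 s0 c1 s1].
Qed.

Lemma exhaust_le n M x : 3 * n.+1%:R <= M -> exhaust n x <= cutoff M x.1.
Proof.
move=> nM; have n0 : 0 < n.+1%:R :> R by rewrite ltr0n.
have M0 : 0 < M by apply: lt_le_trans nM; rewrite mulr_gt0.
have /andP[c0 c1] := cutoff_01 n.+1%:R x.1; have /andP[d0 d1] := cutoff_01 M x.1.
have [h|h] := pselect (- (3 * n.+1%:R) <= x.1 <= 3 * n.+1%:R); last first.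
  by rewrite /exhaust (cutoff_out n0 h) mul0r.
rewrite (@cutoff_in _ M)//; first by have /andP[] := exhaust_01 n x.
move: h nM; move: x.1 n.+1%:R => t q /andP[h1 h2] h; clear -h h1 h2.
by apply/andP; split; lra.
Qed.

Lemma continuous_exhaust n : continuous (exhaust n).
Proof.
apply: cinf2_continuous; apply: cinf2_mul; [apply: cinf2_fst|apply: cinf2_snd];
  exact: cinf_plateau.
Qed.

Lemma cvg_exhaust x : @Omega R x -> exhaust n x @[n --> \oo] --> (1 : R).
Proof.
move=> Ox; rewrite -[X in _ --> X]mulr1; apply: cvgM; last exact: strip_cutoff_cvg.
apply: cvg_near_cst; near=> n.
have h : `|x.1| <= n.+1%:R.
  apply: (@le_trans _ _ n%:R); last by rewrite ler_nat.
  by near: n; exact: nbhs_infty_ger.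
by rewrite cutoff_in ?ltr0n// -ler_norml.
Unshelve. all: by end_near. Qed.

Definition exhaust_set (n : nat) : set (R * R) :=
  `[- (3 * n.+1%:R), 3 * n.+1%:R]%classic `*`
  `[- (1 - n.+4%:R^-1), 1 - n.+4%:R^-1]%classic.

Lemma exhaust_setP n : [/\ compact (exhaust_set n), measurable (exhaust_set n),
  exhaust_set n `<=` @Omega R, (mu2 (exhaust_set n) < +oo)%E &
  forall x, ~ exhaust_set n x -> exhaust n x = 0].
Proof.
have n0 : 0 < n.+1%:R :> R by rewrite ltr0n.
have k0 : 0 < n.+4%:R :> R by rewrite ltr0n.
have i0 : 0 < n.+4%:R^-1 :> R by rewrite invr_gt0.
have i1 : n.+4%:R^-1 <= 1 :> R by rewrite invf_le1// ler1n.
split.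
- by apply: compact_setX; exact: segment_compact.
- by apply: measurableX.
- move=> [s t] [_] /=; rewrite in_itv/= /Omega/=.
  by move: i0 i1; move: (_^-1) => q *; apply/andP; split; lra.
- by rewrite /exhaust_set mu2_rect ?ltry//; move: i1 n0; move: (_^-1) => q *; lra.
- move=> [s t] nx; rewrite /exhaust/=.
  have [hs|hs] := pselect (- (3 * n.+1%:R) <= s <= 3 * n.+1%:R); last first.
    by rewrite (cutoff_out n0 hs) mul0r.
  rewrite /strip_cutoff plateau0 ?mulr0// => ht; apply: nx; split; rewrite /= in_itv//=.
  rewrite -[_^-1]mul1r; move: ht; rewrite (_ : 3 / n.+4%:R = 1 / n.+4%:R + 2 / n.+4%:R); last by field; rewrite gt_eqF.
  by move: (1 / _) (2 / _) => p q /andP[? ?]; apply/andP; split; lra.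
Qed.

(** As m_1 - cos alpha is bounded and the kernel integrable, local convergence
    suffices; the limit is explicit since the mean of m_1 over vertical slices is
    constant. *)
Lemma cvg_transition_term m (m_ : R -> 'I_3 -> R * R -> R) (alpha L : R) : 0 < L ->
  (forall eta, 0 < eta < 1 -> H1dot_S2 (m_ eta)) -> X0 m -> weak_cvg_H1dot m_ m ->
  \int[mu2]_(x in @Omega R) ((m_ eta 0 x - cos alpha) * (angle1 (x.1, 0) * cutoff (L / eta) x.1))
    @[eta --> 0^'+] --> 2 * pi * (cos (mean_angle m) - cos alpha).
Proof.
move=> L0 Hm_ hm hcvg; have [Hm _ _ _] := hm; have mO := @measurable_strip R.
have [ik piE] := @integral_angle1 R; pose k x : R := angle1 (x.1, 0).
have [ikO kE] := integral_strip_fst ik.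
have c1 : `|cos alpha| <= 1 by rewrite ler_norml cos_geN1 cos_le1.
have k0 x : 0 <= k x by apply: divr_ge0; apply: ltW; [exact: height_gt0|exact: angle_den].
have mk : measurable_fun (@Omega R) k by apply/measurable_EFinP; exact: measurable_int ikO.
have mex n : measurable_fun (@Omega R) (exhaust n).
  have ce := @continuous_exhaust n.
  by apply: measurable_funTS; exact: continuous_measurable_plane ce.
have mcut M : measurable_fun (@Omega R) (fun x => cutoff M x.1).
  apply: measurable_funTS; apply: measurable_fun_fst_comp.
  exact: continuous_measurable_fun (cinf_continuous (cinf_plateau _ _ _)).
have isub (f : R * R -> R) : measurable_fun (@Omega R) f -> (forall x, `|f x| <= k x) ->
    mu2.-integrable (@Omega R) (fun x => (f x)%:E).
  move=> mf fk; apply: (@le_integrable _ _ _ mu2 _ mO _ _ _ _ ikO); first exact/measurable_EFinP.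
  by move=> x _; rewrite /= lee_fin (le_trans (fk x))// ler_norm.
have small (f rho : R * R -> R) : (forall x, 0 <= rho x <= 1) -> f = (fun x => k x * rho x) ->
    forall x, `|f x| <= k x.
  move=> r01 -> x; have /andP[r0 r1] := r01 x.
  by rewrite (ger0_norm (mulr_ge0 (k0 x) r0)); exact: ler_piMr (k0 x) r1.
(* split the kernel into a part with compact support in the strip and a remainder
   with small integral *)
pose kr n x := k x * exhaust n x; pose kc n x := k x * (1 - exhaust n x).
have ikr n : mu2.-integrable (@Omega R) (fun x => (kr n x)%:E).
  apply: isub; first exact: measurable_funM.
  by apply: (small _ (exhaust n)) => // x; exact: exhaust_01.
have comp01 n x : 0 <= 1 - exhaust n x <= 1.
  by have /andP[? ?] := exhaust_01 n x; apply/andP; split; lra.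
have ikc n : mu2.-integrable (@Omega R) (fun x => (kc n x)%:E).
  apply: isub; first by apply: measurable_funM => //; exact: measurable_funB.
  by apply: (small _ (fun x => 1 - exhaust n x)) => // x; exact: comp01.
pose A n := \int[mu2]_(x in @Omega R) kc n x.
have A0 : A n @[n --> \oo] --> 0.
  have := cvg_exhaustion ikO mex exhaust_01 cvg_exhaust.
  move=> h; rewrite -(subrr (\int[mu2]_(x in @Omega R) k x)).
  have AE n : A n = \int[mu2]_(x in @Omega R) k x - \int[mu2]_(x in @Omega R) (k x * exhaust n x).
    rewrite /A /kc -(@RintegralB _ _ _ mu2 _ _ _ mO ikO (ikr n)).
    by apply: eq_Rintegral => x _; rewrite /kr mulrBr mulr1.
  under eq_fun do rewrite AE.
  by apply: cvgB h; exact: cvg_cst.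
have bound m' (f : R * R -> R) n : H1dot_S2 m' -> measurable_fun (@Omega R) f ->
    (forall x, 0 <= f x <= kc n x) ->
    `|\int[mu2]_(x in @Omega R) ((m' 0 x - cos alpha) * f x)| <= 2 * A n.
  move=> H1 mf fk.
  have fi : mu2.-integrable (@Omega R) (fun x => (f x)%:E).
    apply: isub => // x; have /andP[f0 f1] := fk x; rewrite ger0_norm//.
    apply: le_trans f1 _; rewrite /kc ler_piMr//.
    by have /andP[] := comp01 n x.
  have [_ h] := strip_bounded_mul 0 H1 c1 fi; apply: le_trans h _; rewrite ler_wpM2l//.
  apply: (@le_Rintegral _ _ _ mu2 _ _ _ mO _ (ikc n)).
    exact: (@integrable_norm _ _ _ mu2 _ _ fi).
  by move=> x _; have /andP[f0 f1] := fk x; rewrite ger0_norm.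
have limE : 2 * pi * (cos (mean_angle m) - cos alpha) =
    \int[mu2]_(x in @Omega R) ((m 0 x - cos alpha) * k x).
  have [im0 _] := integral_slice Hm ik.
  have ikZ := @integrableZl _ _ _ mu2 _ mO (cos alpha) _ ikO.
  transitivity (\int[mu2]_(x in @Omega R) (m 0 x * k x - cos alpha * k x)); last first.
    by apply: eq_Rintegral => x _; rewrite mulrBl.
  rewrite (@RintegralB _ _ _ mu2 _ _ _ mO im0 ikZ) (X0_mean hm ik).
  rewrite (@RintegralZl _ _ _ mu2 _ _ _ mO ikO) kE piE.
  by move: (cos _) (cos _) => a b; ring.
rewrite limE; apply/cvgrPdist_le => e e0.
have [n An] : exists n, 2 * A n <= e / 3.
  have e6 : 0 < e / 6 by rewrite divr_gt0.
  move/cvgrPdist_lt : A0 => /(_ _ e6)[n _ /(_ n (leqnn n))].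
  rewrite sub0r normrN => An; exists n.
  by move: (le_lt_trans (ler_norm _) An); move: (A n) => a; lra.
have split m' (f : R * R -> R) : H1dot_S2 m' -> mu2.-integrable (@Omega R) (fun x => (f x)%:E) ->
    \int[mu2]_(x in @Omega R) ((m' 0 x - cos alpha) * (kr n x + f x)) =
    \int[mu2]_(x in @Omega R) (m' 0 x * kr n x) -
    cos alpha * \int[mu2]_(x in @Omega R) kr n x +
    \int[mu2]_(x in @Omega R) ((m' 0 x - cos alpha) * f x).
  move=> H1 fi; have [if_ _] := strip_bounded_mul 0 H1 c1 fi.
  have im := integrable_strip_H1dot_S2 0 H1 (ikr n).
  have ic := @integrableZl _ _ _ mu2 _ mO (cos alpha) _ (ikr n).
  have iB := @integrableB _ _ _ mu2 _ mO _ _ im ic.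
  transitivity (\int[mu2]_(x in @Omega R) ((m' 0 x * kr n x - cos alpha * kr n x) +
      (m' 0 x - cos alpha) * f x)).
    by apply: eq_Rintegral => x _; move: (m' 0 x) (kr n x) (f x) (cos _) => *; ring.
  rewrite (@RintegralD _ _ _ mu2 _ _ _ mO iB if_) (@RintegralB _ _ _ mu2 _ _ _ mO im ic).
  by rewrite (@RintegralZl _ _ _ mu2 _ _ _ mO (ikr n)).
have [cK mK KO Koo exK] := exhaust_setP n.
have locE := @cvg_local_test R m m_ 0 (exhaust_set n) (kr n) Hm_ Hm hcvg cK KO Koo mK.
have {}locE : \int[mu2]_(x in @Omega R) (m_ eta 0 x * kr n x) @[eta --> 0^'+] -->
  \int[mu2]_(x in @Omega R) (m 0 x * kr n x).
  apply: locE; last by move=> x _ nK; rewrite /kr exK ?mulr0.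
  have mkr : measurable_fun (exhaust_set n) (kr n).
    by apply: (measurable_funS mO KO); apply/measurable_EFinP; exact: measurable_int (ikr n).
  apply: (@bounded_sqint _ _ _ mu2 _ _ 1 mK Koo mkr) => x _.
  have kx1 : k x <= 1.
    rewrite /k /angle1/= height_strip ?ler_pdivrMr//; last by apply/andP; split; lra.
      by have := sqr_ge0 x.1; lra.
    by rewrite ltr_wpDl ?sqr_ge0// exprn_gt0.
  by apply: le_trans kx1; apply: (small _ (exhaust n)) => // y; exact: exhaust_01.
have e3 : 0 < e / 3 by rewrite divr_gt0.
have cn : 0 < L / (3 * n.+1%:R) by rewrite divr_gt0// mulr_gt0.
near=> eta.
have eta0 : 0 < eta by near: eta; exact: nbhs_right_gt.
have etan : eta <= L / (3 * n.+1%:R) by near: eta; exact: nbhs_right_le.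
have eta1 : eta < 1 by near: eta; exact: nbhs_right_lt.
have nM : 3 * n.+1%:R <= L / eta.
  by rewrite ler_pdivlMr// mulrC -ler_pdivlMr// mulr_gt0.
have H1 : H1dot_S2 (m_ eta) by apply: Hm_; rewrite eta0.
pose f x := k x * cutoff (L / eta) x.1 - kr n x.
have f01 x : 0 <= f x <= kc n x.
  rewrite /f /kr /kc -mulrBr; have := exhaust_le x nM.
  have /andP[_ d1] := cutoff_01 (L / eta) x.1; move: (k0 x) d1.
  by move: (k x) (cutoff _ _) (exhaust _ _) => a b r a0 b1 rb; apply/andP; split; nra.
have mf : measurable_fun (@Omega R) f.
  by apply: measurable_funB; [exact: measurable_funM|apply/measurable_EFinP; exact: measurable_int (ikr n)].
have if_ : mu2.-integrable (@Omega R) (fun x => (f x)%:E).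
  apply: (@le_integrable _ _ _ mu2 _ mO _ _ _ _ (ikc n)); first exact/measurable_EFinP.
  move=> x _; have /andP[f0 f1] := f01 x; rewrite /= lee_fin ger0_norm//.
  by rewrite (le_trans f1)// ler_norm.
have b1 := bound _ f n H1 mf f01.
have b2 : `|\int[mu2]_(x in @Omega R) ((m 0 x - cos alpha) * kc n x)| <= 2 * A n.
  apply: bound => //; first by apply/measurable_EFinP; exact: measurable_int (ikc n).
  move=> x; rewrite lexx andbT; apply: mulr_ge0 => //.
  by have /andP[] := comp01 n x.
have b3 : `|\int[mu2]_(x in @Omega R) (m 0 x * kr n x) -
    \int[mu2]_(x in @Omega R) (m_ eta 0 x * kr n x)| <= e / 3.
  by near: eta; move/cvgrPdist_le : locE; exact.
have -> : \int[mu2]_(x in @Omega R) ((m_ eta 0 x - cos alpha) *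
    (angle1 (x.1, 0) * cutoff (L / eta) x.1)) =
    \int[mu2]_(x in @Omega R) ((m_ eta 0 x - cos alpha) * (kr n x + f x)).
  by apply: eq_Rintegral => x _; rewrite /f [kr n x + _]addrC subrK.
have -> : \int[mu2]_(x in @Omega R) ((m 0 x - cos alpha) * k x) =
    \int[mu2]_(x in @Omega R) ((m 0 x - cos alpha) * (kr n x + kc n x)).
  by apply: eq_Rintegral => x _; rewrite /kr /kc -mulrDr [exhaust _ _ + _]addrC subrK mulr1.
rewrite (split _ _ H1 if_) (split _ _ Hm (ikc n)).
move: b1 b2 b3 An; clear.
move: (\int[mu2]_(x in _) _) (\int[mu2]_(x in _) _) (A n) => u1 u2 a.
move: (\int[mu2]_(x in _) _) (\int[mu2]_(x in _) _) (_ * \int[mu2]_(x in _) _) => v1 v2 w.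
rewrite !ler_norml => /andP[? ?] /andP[? ?] /andP[? ?] ?.
by apply/andP; split; lra.
Unshelve. all: by end_near. Qed.

End transition.

(** * Absorption of the far field by the anisotropy *)

Section core_error.
Variable R : realType.
Implicit Types (s t M c : R) (x : R * R) (m : 'I_3 -> R * R -> R).
Local Notation mu := (@lebesgue_measure R).
Local Notation mu2 := (@mu2 R).

Lemma continuous_cutoff M : continuous (@cutoff R M).
Proof. by apply: cinf_continuous; exact: cinf_plateau. Qed.

Lemma integral_cutoff_error M : 0 < M ->
  mu2.-integrable (@Omega R) (fun x => ((angle (x.1, 0) * cutoff' M x.1) ^+ 2)%:E) /\
  \int[mu2]_(x in @Omega R) (angle (x.1, 0) * cutoff' M x.1) ^+ 2 <= 48 * slope ^+ 2 / M.
Proof.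
move=> M0; pose b t : R := angle (t, 0) * cutoff' M t.
have bb t : b t * b t = b t ^+ 2 by rewrite expr2.
have cb : continuous b.
  move=> t; apply: cvgM; last by apply: cinf_continuous; exact: cinf_plateau'.
  exact: (is_derive1_continuous (fun t => is_derive_angle1 t (0 : R))).
have cb2 : continuous (fun t => b t ^+ 2).
  have -> : (fun t => b t ^+ 2) = (fun t => b t * b t) by apply/funext => t; rewrite bb.
  by move=> t; apply: cvgM; exact: cb.
have b0 t : ~ (- (3 * M) <= t <= 3 * M) -> b t = 0.
  by move=> nt; rewrite /b cutoff'_out// mulr0.
have b20 t : ~ (- (3 * M) <= t <= 3 * M) -> b t ^+ 2 = 0.
  by move=> /b0 ->; rewrite expr0n.
have ib := integrable_compact cb2 b20.
have [iO ->] := integral_strip_fst ib; split => //.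
have bM t : b t ^+ 2 <= 4 * slope ^+ 2 / M ^+ 2.
  have := cutoff'_le t M0; have := angle_le (t, 0); rewrite /b exprMn.
  rewrite -(real_normK (num_real (angle _))) -(real_normK (num_real (cutoff' _ _))).
  move=> h1 h2; rewrite (_ : 4 * slope ^+ 2 / M ^+ 2 = 2 ^+ 2 * (slope / M) ^+ 2); last first.
    by rewrite expr_div_n; ring.
  by apply: ler_pM; rewrite ?sqr_ge0// lerXn2r ?nnegrE// (le_trans _ h2).
pose J : set R := `[- (3 * M), 3 * M]%classic.
have mJ : measurable J by exact: measurable_itv.
have muJ : mu J = (6 * M)%:E.
  rewrite /J lebesgue_measure_itv/= lte_fin ifT; last by lra.
  by rewrite -EFinB; congr EFin; ring.
have muJoo : (mu J < +oo)%E by rewrite muJ ltry.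
have -> : \int[mu]_t (b t ^+ 2) = \int[mu]_(t in J) (b t ^+ 2).
  rewrite [RHS]Rintegral_mkcond; apply: eq_Rintegral => t _; rewrite /patch.
  by case: ifPn => // /negP nt; rewrite b20// => h; apply: nt; rewrite inE /J/= in_itv.
have iJ := @integrableS _ _ _ mu _ _ _ measurableT mJ (@subsetT _ _) ib.
have ic : mu.-integrable J (fun=> (4 * slope ^+ 2 / M ^+ 2)%:E).
  by apply: (@bounded_integrable _ _ _ mu _ _ `|4 * slope ^+ 2 / M ^+ 2| mJ muJoo).
have := @le_Rintegral _ _ _ mu _ _ _ mJ iJ ic (fun t _ => bM t).
rewrite (@Rintegral_cst _ _ _ mu _ mJ) => h.
move: h; set A := (X in fine X); have -> : A = (6 * M)%:E by exact: muJ.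
move=> h; apply: le_trans (_ : _ <= 2 * (4 * slope ^+ 2 / M ^+ 2 * (6 * M))) _.
  by rewrite ler_wpM2l// mulrA.
rewrite le_eqVlt; apply/orP; left; apply/eqP.
by move: slope => q; field; rewrite gt_eqF.
Qed.

(** Where the profile is cut off, at distance M from the core, its gradient is
    paid for by the anisotropy energy of m, up to an error of order
    1 / (M eta). *)
Lemma transition_lower m (alpha a eta M : R) : X alpha m -> 0 < eta -> 1 <= M ->
  2 * a * \int[mu2]_(x in @Omega R) ((m 0 x - cos alpha) * (angle1 (x.1, 0) * cutoff M x.1)) -
  eta * \int[mu2]_(x in @Omega R) ((m 0 x - cos alpha) ^+ 2 + m 2 x ^+ 2) -
  48 * (a * slope) ^+ 2 / (M * eta) <=
  2 * a * \int[mu2]_(x in @Omega R) ((m 0 x - cos alpha) * partial 0 (profile M) x).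
Proof.
move=> Xm eta0 M1; have M0 : 0 < M by lra.
have mO := @measurable_strip R; have [H1 _] := Xm; have [sw s2] := X_sqint Xm.
have c1 : `|cos alpha| <= 1 by rewrite ler_norml cos_geN1 cos_le1.
have [ib bM] := integral_cutoff_error M0.
pose w x := m 0 x - cos alpha; pose b x : R := angle (x.1, 0) * cutoff' M x.1.
pose u x : R := angle1 (x.1, 0) * cutoff M x.1.
have iu : mu2.-integrable (@Omega R) (fun x => (u x)%:E).
  have cu : continuous (fun t => angle1 (t, 0) * cutoff M t).
    by move=> t; apply: cvgM; [exact: continuous_angle1_strip|exact: continuous_cutoff].
  have u0 t : ~ (- (3 * M) <= t <= 3 * M) -> angle1 (t, 0) * cutoff M t = 0.
    by move=> nt; rewrite cutoff_out// mulr0.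
  by have [] := integral_strip_fst (integrable_compact cu u0).
have ip : mu2.-integrable (@Omega R) (fun x => (partial 0 (profile M) x)%:E).
  apply: (integrable_smooth (L := 3 * M)) => //.
    by apply: smooth_partial; exact: cinf2_smooth (cinf2_profile M).
  by apply: partial_box_supported; exact: profile_box.
have [iwu _] := strip_bounded_mul 0 H1 c1 iu.
have [iwp _] := strip_bounded_mul 0 H1 c1 ip.
have iq := @integrableD _ _ _ mu2 _ mO _ _ (sqint_integrable_sqr sw) (sqint_integrable_sqr s2).
have j1 := @integrableZl _ _ _ mu2 _ mO (2 * a) _ iwu.
have j2 := @integrableZl _ _ _ mu2 _ mO eta _ iq.
have j3 := @integrableZl _ _ _ mu2 _ mO (a ^+ 2 / eta) _ ib.
have j4 := @integrableZl _ _ _ mu2 _ mO (2 * a) _ iwp.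
have j12 := @integrableB _ _ _ mu2 _ mO _ _ j1 j2.
have j123 := @integrableB _ _ _ mu2 _ mO _ _ j12 j3.
have : \int[mu2]_(x in @Omega R) (2 * a * (w x * u x) - eta * (w x ^+ 2 + m 2 x ^+ 2) -
    a ^+ 2 / eta * b x ^+ 2) <=
    \int[mu2]_(x in @Omega R) (2 * a * (w x * partial 0 (profile M) x)).
  apply: (@le_Rintegral _ _ _ mu2 _ _ _ mO j123 j4) => x Ox.
  have [-> _] := profile_strip M1 Ox; rewrite -/(u x) -/(b x) -/(w x).
  move: (w x) (u x) (b x) (m 2 x) => W U B V; rewrite -subr_ge0.
  have -> : 2 * a * (W * (U + B)) - (2 * a * (W * U) - eta * (W ^+ 2 + V ^+ 2) -
     a ^+ 2 / eta * B ^+ 2) = eta * V ^+ 2 + eta^-1 * (eta * W + a * B) ^+ 2.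
    by field; rewrite gt_eqF.
  by rewrite addr_ge0// mulr_ge0 ?sqr_ge0 ?invr_ge0// ltW.
rewrite (@RintegralB _ _ _ mu2 _ _ _ mO j12 j3) (@RintegralB _ _ _ mu2 _ _ _ mO j1 j2).
rewrite (@RintegralZl _ _ _ mu2 _ _ _ mO iwu) (@RintegralZl _ _ _ mu2 _ _ _ mO iwp).
rewrite (@RintegralZl _ _ _ mu2 _ _ _ mO iq) (@RintegralZl _ _ _ mu2 _ _ _ mO ib).
apply: le_trans; rewrite lerB//.
have -> : 48 * (a * slope) ^+ 2 / (M * eta) = a ^+ 2 / eta * (48 * slope ^+ 2 / M).
  by move: slope => q; field; rewrite !gt_eqF.
by rewrite ler_wpM2l// divr_ge0 ?sqr_ge0// ltW.
Qed.

End core_error.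

(** * Lower bound at fixed eta *)

Section lower_bound.
Variable R : realType.
Implicit Types (s t M c : R) (x : R * R) (m : 'I_3 -> R * R -> R).
Local Notation mu := (@lebesgue_measure R).
Local Notation mu2 := (@mu2 R).

Definition gradient_product m m' : R := \sum_(i < 3) \sum_(j < 2)
  \int[mu2]_(x in @Omega R) (weak_partial j (m i) x * weak_partial j (m' i) x).

Lemma dirichletE m : H1dot_S2 m -> dirichlet m = (gradient_product m m)%:E.
Proof.
move=> H1; have mO := @measurable_strip R.
have sq i j := (weak_partial_sqint i j H1).2.
have msq i j : measurable_fun (@Omega R) (fun x => (weak_partial j (m i) x ^+ 2)%:E).
  by apply/measurable_EFinP; apply: measurable_funX; exact: (sq i j).1.
rewrite /dirichlet /sq_grad.
under eq_integral do rewrite -sumEFin.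
rewrite (@ge0_integral_sum _ _ _ mu2 _ mO); last 2 first.
- by move=> i; apply/measurable_EFinP; apply: measurable_sum => j; apply: measurable_funX; exact: (sq i j).1.
- by move=> i x _; rewrite lee_fin sumr_ge0// => j _; exact: sqr_ge0.
rewrite /gradient_product -sumEFin; apply: eq_bigr => i _.
under eq_integral do rewrite -sumEFin.
rewrite (@ge0_integral_sum _ _ _ mu2 _ mO); last 2 first.
- by move=> j; exact: msq.
- by move=> j x _; rewrite lee_fin sqr_ge0.
rewrite -sumEFin; apply: eq_bigr => j _.
by rewrite (sqint_int_sqr (sq i j)).
Qed.

(** Weak lower semicontinuity of the Dirichlet integral comes from the tangent
    bound 2 <u, v> - |v|^2 <= |u|^2. *)
Lemma gradient_product_tangent m m' : H1dot_S2 m -> H1dot_S2 m' ->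
  2 * gradient_product m m' - gradient_product m' m' <= gradient_product m m.
Proof.
move=> H1 H1'; have mO := @measurable_strip R.
rewrite /gradient_product mulr_sumr -sumrB; apply: ler_sum => i _.
rewrite mulr_sumr -sumrB; apply: ler_sum => j _.
have s := (weak_partial_sqint i j H1).2; have s' := (weak_partial_sqint i j H1').2.
have i1 := @sqint_integrable_mul _ _ _ mu2 _ _ _ mO s s'.
have i2 := @sqint_integrable_mul _ _ _ mu2 _ _ _ mO s' s'.
have i3 := @sqint_integrable_mul _ _ _ mu2 _ _ _ mO s s.
have i4 := @integrableZl _ _ _ mu2 _ mO 2 _ i1.
have i5 := @integrableB _ _ _ mu2 _ mO _ _ i4 i2.
rewrite -(@RintegralZl _ _ _ mu2 _ _ _ mO i1) -(@RintegralB _ _ _ mu2 _ _ _ mO i4 i2).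
apply: (@le_Rintegral _ _ _ mu2 _ _ _ mO i5 i3) => x _.
move: (weak_partial j (m i) x) (weak_partial j (m' i) x) => u v; rewrite -subr_ge0.
have -> : u * u - (2 * (u * v) - v * v) = (u - v) ^+ 2 by ring.
exact: sqr_ge0.
Qed.

Lemma cvg_gradient_product m (m_ : R -> 'I_3 -> R * R -> R) :
  H1dot_S2 m -> weak_cvg_H1dot m_ m ->
  gradient_product (m_ eta) m @[eta --> 0^'+] --> gradient_product m m.
Proof.
move=> H1 [wk _]; apply: cvg_big => [|i _]; first exact: add_continuous.
apply: cvg_big => [|j _]; first exact: add_continuous.
by apply: wk; exact: (weak_partial_sqint i j H1).2.
Qed.

Lemma ln_inv_cvg : (ln (1 / eta))^-1 @[eta --> (0 : R)^'+] --> (0 : R).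
Proof.
apply/cvgrPdist_le => e e0; near=> eta.
have eta0 : 0 < eta by near: eta; exact: nbhs_right_gt.
have etae : eta <= expR (- e^-1) by near: eta; apply: nbhs_right_le; exact: expR_gt0.
have ei : 0 < e^-1 by rewrite invr_gt0.
have h : e^-1 <= ln (1 / eta).
  rewrite div1r lnV ?posrE// lerNr -[leRHS]expRK.
  by rewrite ler_ln ?posrE ?expR_gt0.
have l0 := lt_le_trans ei h.
rewrite sub0r normrN ger0_norm ?invr_ge0; last exact: ltW.
by rewrite -[leRHS]invrK lef_pV2 ?posrE.
Unshelve. all: by end_near. Qed.

Lemma ln_core (eta L : R) : 0 < eta < 1 -> 0 < L ->
  ln (1 + 6 * (L / eta)) <= ln (1 / eta) + ln (1 + 6 * L).
Proof.
move=> /andP[eta0 eta1] L0.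
have i0 : 0 < 1 / eta by rewrite divr_gt0.
have i1 : 1 < 1 / eta by rewrite ltr_pdivlMr// mul1r.
rewrite -lnM ?posrE//; last lra.
have -> : L / eta = L * (1 / eta) by rewrite mul1r.
move: (1 / eta) i0 i1 => q q0 q1.
have Lq : 0 < L * q by rewrite mulr_gt0.
have p1 : 0 < 1 + 6 * (L * q) by lra.
have p2 : 0 < q * (1 + 6 * L) by apply: mulr_gt0 => //; lra.
by rewrite ler_ln ?posrE//; lra.
Qed.

(** The lower bound at fixed eta, for the amplitude c = d / ln (1 / eta) of the
    profile, which is optimal to leading order, and for the cutoff at distance
    L / eta. *)
Lemma energy_lower m m' (alpha lambda d eta L e : R) : X alpha m -> H1dot_S2 m' ->
  0 < lambda -> 0 < eta < 1 -> 1 <= L -> 0 < e ->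
  ((2 * gradient_product m m' - gradient_product m' m' +
    2 * (lambda * d) * \int[mu2]_(x in @Omega R)
      ((m 0 x - cos alpha) * (angle1 (x.1, 0) * cutoff (L / eta) x.1)) -
    lambda * d ^+ 2 * ((1 + e) * (2 * pi)) -
    lambda * d ^+ 2 * ((1 + e) * (2 * pi * ln (1 + 6 * L)) +
      (1 + e^-1) * (288 * slope ^+ 2)) * (ln (1 / eta))^-1 -
    48 * (lambda * d * slope) ^+ 2 / L)%:E <= E_eta alpha lambda eta m)%E.
Proof.
move=> Xm H1' lam0 eta01 L1 e0; have /andP[eta0 eta1] := eta01.
have [H1 _] := Xm; have [sw s2] := X_sqint Xm; have mO := @measurable_strip R.
have L0 : 0 < L by lra.
have M1 : 1 <= L / eta by rewrite ler_pdivlMr// mul1r; lra.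
have M0 : 0 < L / eta by lra.
have l0 : 0 < ln (1 / eta).
  by rewrite ln_gt0// ltr_pdivlMr// mul1r.
have i2 := @integrableD _ _ _ mu2 _ mO _ _ (sqint_integrable_sqr sw) (sqint_integrable_sqr s2).
have WE : (\int[mu2]_(x in @Omega R) ((m 0 x - cos alpha) ^+ 2 + m 2 x ^+ 2)%:E)%E =
    (\int[mu2]_(x in @Omega R) ((m 0 x - cos alpha) ^+ 2 + m 2 x ^+ 2))%:E.
  by rewrite /Rintegral fineK//; exact: (@integrable_fin_num _ _ _ mu2 _ mO _ i2).
rewrite /E_eta WE (dirichletE H1).
have st := stray_lower_bound (d / ln (1 / eta)) Xm M1.
have ll0 : 0 <= lambda * ln (1 / eta) by rewrite mulr_ge0 ?ltW.
have {}st := lee_wpmul2l (x := (lambda * ln (1 / eta))%:E) ll0 st.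
apply: (le_trans _ (leeD (leeD (le_refl _) st) (le_refl _))).
rewrite -!EFinM -!EFinD lee_fin.
have tr := transition_lower (lambda * d) Xm eta0 M1.
have gt := gradient_product_tangent H1 H1'.
have pe := profile_energy M0 e0.
have lc := ln_core eta01 L0.
have -> : lambda * ln (1 / eta) * (2 * (d / ln (1 / eta)) *
    \int[mu2]_(x in @Omega R) ((m 0 x - cos alpha) * partial 0 (profile (L / eta)) x) -
    (d / ln (1 / eta)) ^+ 2 * \int[mu2]_x (partial 0 (profile (L / eta)) x ^+ 2 +
      partial 1 (profile (L / eta)) x ^+ 2)) =
    2 * (lambda * d) * \int[mu2]_(x in @Omega R) ((m 0 x - cos alpha) * partial 0 (profile (L / eta)) x) -
    lambda * d ^+ 2 * (ln (1 / eta))^-1 * \int[mu2]_x (partial 0 (profile (L / eta)) x ^+ 2 +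
      partial 1 (profile (L / eta)) x ^+ 2).
  move: (\int[mu2]_(x in _) _) (\int[mu2]_x _) (ln (1 / eta)) l0 => T G l l0.
  by field; rewrite gt_eqF.
have me : L / eta * eta = L by rewrite divfK// gt_eqF.
rewrite me in tr.
have big : lambda * d ^+ 2 * (ln (1 / eta))^-1 * \int[mu2]_x (partial 0 (profile (L / eta)) x ^+ 2 +
      partial 1 (profile (L / eta)) x ^+ 2) <=
    lambda * d ^+ 2 * ((1 + e) * (2 * pi)) +
    lambda * d ^+ 2 * ((1 + e) * (2 * pi * ln (1 + 6 * L)) +
      (1 + e^-1) * (288 * slope ^+ 2)) * (ln (1 / eta))^-1.
  have ld0 : 0 <= lambda * d ^+ 2 * (ln (1 / eta))^-1.
    by apply: mulr_ge0; [rewrite mulr_ge0 ?sqr_ge0// ltW|rewrite invr_ge0 ltW].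
  apply: le_trans (ler_wpM2l ld0 pe) _.
  have e1 : 0 <= (1 + e) * (2 * pi).
    by apply: mulr_ge0; [rewrite addr_ge0// ltW|rewrite mulr_ge0// pi_ge0].
  have lc' := ler_wpM2l e1 lc.
  have -> : lambda * d ^+ 2 * ((1 + e) * (2 * pi)) +
    lambda * d ^+ 2 * ((1 + e) * (2 * pi * ln (1 + 6 * L)) +
      (1 + e^-1) * (288 * slope ^+ 2)) * (ln (1 / eta))^-1 =
    lambda * d ^+ 2 * (ln (1 / eta))^-1 * ((1 + e) * (2 * pi) * (ln (1 / eta) + ln (1 + 6 * L)) +
      (1 + e^-1) * (288 * slope ^+ 2)).
    move: (e^-1) (ln (1 / eta)) (ln (1 + _)) (slope) (@pi R) l0 => e' l l' q p l0.
    by field; rewrite gt_eqF.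
  by rewrite ler_wpM2l// lerD2r mulrA.
move: tr gt big; clear.
move: (gradient_product m m') (gradient_product m' m') (gradient_product m m) => a1 a2 a3.
move: (_ * \int[mu2]_x _) => c1.
move: (_ * \int[mu2]_(x in _) ((_ - _) * (_ * cutoff _ _))) => b1.
move: (_ * \int[mu2]_(x in _) (_ * partial _ _ _)) => b2.
move: (_ * \int[mu2]_(x in _) _) => b3.
move: (_ * (ln _)^-1) => c2.
move: (lambda * _ * _) => c3.
move: (_ / L) => c4.
lra.
Qed.

End lower_bound.

(** * The liminf inequality *)

Theorem theorem1 (R : realType) (alpha lambda : R)
  (halpha : 0 < alpha <= pi / 2) (hlambda : 0 < lambda)
  (m : 'I_3 -> R * R -> R) (hm : X0 m)
  (m_ : R -> 'I_3 -> R * R -> R)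
  (hm_ : forall eta : R, 0 < eta < 1 -> X alpha (m_ eta))
  (hcvg : weak_cvg_H1dot m_ m) :
  (limf_einf (fun eta : R => E_eta alpha lambda eta (m_ eta)) 0^'+
     >= E_0 alpha lambda m)%E.
Proof.
have [H1 _ _ _] := hm.
have H1_ eta : 0 < eta < 1 -> H1dot_S2 (m_ eta) by move=> /hm_[].
rewrite /E_0 (dirichletE H1) -EFinD.
apply/lee_subgt0Pr => eps eps0; rewrite -EFinB.
set d := cos (mean_angle m) - cos alpha.
pose B := lambda * d ^+ 2 * (2 * pi); pose C : R := 48 * (lambda * d * slope) ^+ 2.
have B0 : 0 <= B.
  by apply: mulr_ge0; [rewrite mulr_ge0 ?sqr_ge0// ltW|rewrite mulr_ge0// pi_ge0].
have C0 : 0 <= C by rewrite mulr_ge0// sqr_ge0.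
(* each of the two errors that remain in the limit is at most eps / 4 *)
pose e := eps / (4 * (B + 1)); pose L := 1 + 4 * C / eps.
have B1 : 0 < B + 1 by rewrite ltr_wpDl.
have e0 : 0 < e by rewrite divr_gt0// mulr_gt0.
have L1 : 1 <= L by rewrite lerDl; apply: divr_ge0; [exact: mulr_ge0|exact: ltW].
have L0 : 0 < L by rewrite (lt_le_trans _ L1).
have Be : B * e <= eps / 4.
  have -> : B * e = B / (B + 1) * (eps / 4) by rewrite /e; field; rewrite gt_eqF.
  apply: ler_piMl; first by apply: ltW; rewrite divr_gt0.
  by rewrite ler_pdivrMr// mul1r lerDl.
have CL : C / L <= eps / 4.
  rewrite ler_pdivrMr// /L mulrDr mulr1 (_ : eps / 4 * (4 * C / eps) = C).
    by rewrite lerDr divr_ge0// ltW.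
  by field; rewrite gt_eqF.
set D := gradient_product m m.
pose K := lambda * d ^+ 2 * ((1 + e) * (2 * pi * ln (1 + 6 * L)) + (1 + e^-1) * (288 * slope ^+ 2)).
pose T eta := \int[@mu2 R]_(x in @Omega R)
  ((m_ eta 0 x - cos alpha) * (angle1 (x.1, 0) * cutoff (L / eta) x.1)).
pose low eta := 2 * gradient_product (m_ eta) m - D + 2 * (lambda * d) * T eta -
  lambda * d ^+ 2 * ((1 + e) * (2 * pi)) - K * (ln (1 / eta))^-1 - C / L.
have low_cvg : low eta @[eta --> 0^'+] --> 2 * D - D + 2 * (lambda * d) * (2 * pi * d) -
    lambda * d ^+ 2 * ((1 + e) * (2 * pi)) - K * 0 - C / L.
  have cP := cvg_gradient_product H1 hcvg.
  have cT := cvg_transition_term (alpha := alpha) L0 H1_ hm hcvg.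
  apply: cvgB; last exact: cvg_cst.
  apply: cvgB; last by apply: cvgMl_tmp; exact: ln_inv_cvg.
  apply: cvgB; last exact: cvg_cst.
  apply: cvgD; last by apply: cvgMl_tmp; exact: cT.
  by apply: cvgB; [apply: cvgMl_tmp; exact: cP|exact: cvg_cst].
have near_low : \forall eta \near (0 : R)^'+,
    ((D + 2 * pi * lambda * d ^+ 2 - eps)%:E <= E_eta alpha lambda eta (m_ eta))%E.
  move/cvgrPdist_le : low_cvg => /(_ _ (divr_gt0 eps0 (ltr0n R 2))) low_cvg.
  near=> eta.
  have eta01 : 0 < eta < 1.
    apply/andP; split; first by near: eta; exact: nbhs_right_gt.
    by near: eta; exact: nbhs_right_lt.
  have := energy_lower d (hm_ _ eta01) H1 hlambda eta01 L1 e0.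
  apply: le_trans; rewrite lee_fin.
  have : `|2 * D - D + 2 * (lambda * d) * (2 * pi * d) -
    lambda * d ^+ 2 * ((1 + e) * (2 * pi)) - K * 0 - C / L - low eta| <= eps / 2.
    by near: eta.
  rewrite ler_norml => /andP[_].
  rewrite -/D -/K -/(T eta) -/C -/(low eta).
  have -> : 2 * D - D + 2 * (lambda * d) * (2 * pi * d) - lambda * d ^+ 2 * ((1 + e) * (2 * pi)) -
    K * 0 - C / L = D + 2 * pi * lambda * d ^+ 2 - B * e - C / L.
    by rewrite /B; move: (C / L) => q; clear; ring.
  move: Be CL; clear.
  move: (B * e) (C / L) (low eta) (D + _) => p q l r.
  lra.
rewrite limf_einfE; apply: le_ereal_sup_tmp.
set V := [set eta | ((D + 2 * pi * lambda * d ^+ 2 - eps)%:E <= E_eta alpha lambda eta (m_ eta))%E].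
exists (ereal_inf [set E_eta alpha lambda eta (m_ eta) | eta in V]); first by exists V.
by apply: le_ereal_inf_tmp => _ [eta Veta <-].
Unshelve. all: by end_near. Qed.
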